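(* Let $C_1$ and $C_2$ be two distinct parallel circles of positive radius in $\mathbb{R}^3$ centered about a common axis $\Gamma$, and let $D_1$ and $D_2$ be the planar discs with boundaries $C_1$ and $C_2$, respectively. Let $\mathcal{S}$ be the set of connected rectifiable surfaces of revolution with boundary $C_1, C_2$ defined in the context, and let $\Lambda_j=\sup\{\lambda_j(\Sigma):\Sigma\in\mathcal{S}\}$ for each positive integer $j$. Assume there is a catenoid $\Sigma_{\mathrm{cat}}$ which is the unique area minimizing surface with boundary given by $C_1$ and $C_2$. Then $\Lambda_j>\lambda_j(D_1\cup D_2)$ for all sufficiently large $j$. For such $j$, let $\Sigma_j$ be any surface in $\mathcal{S}$ such that $\lambda_j(\Sigma_j)=\Lambda_j$. Then $$\lim_{j\to\infty}\mathrm{Area}(\Sigma_j)=\mathrm{Area}(\Sigma_{\mathrm{cat}}).$$ Moreover $\Sigma_j$ converges to $\Sigma_{\mathrm{cat}}$ in the Hausdorff metric as $j\to\infty$.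
   Context: Surfaces. $\Gamma$ is a line in $\mathbb{R}^3$; $C_1, C_2$ are distinct circles of positive radii lying in planes perpendicular to $\Gamma$ and centered on $\Gamma$. $\mathcal{S}$ is the set of connected surfaces of revolution $\Sigma$ about $\Gamma$ such that (i) $\Sigma$ has two boundary components, given by $C_1$ and $C_2$; (ii) $\Sigma$ is disjoint from $\Gamma$; (iii) a meridian of $\Sigma$ (the intersection of $\Sigma$ with a half-plane bounded by $\Gamma$) is an oriented rectifiable curve from $C_1$ to $C_2$, i.e. a curve admitting a Lipschitz parametrization. Curves. Fix an open half-plane in $\mathbb{R}^3$ bounded by $\Gamma$ and identify it with $\mathbb{R}^2_+ = \{(x,y)\in\mathbb{R}^2 : x>0\}$, where $x$ is the distance to $\Gamma$. Let $p, q$ be the points where $\mathbb{R}^2_+$ meets $C_1, C_2$, respectively. Let $\mathcal{R}$ be the set of Lipschitz functions $\alpha:[0,1]\to\mathbb{R}^2_+$ with $\alpha(0)=p$, $\alpha(1)=q$, and such that there is a constant $L$ with $|\alpha'(t)|=L$ for almost every $t$. Curves $\alpha\in\mathcal{R}$ correspond bijectively to surfaces $\Sigma\in\mathcal{S}$ ($\alpha$ is the constant speed parametrization of the meridian). If $\Sigma$ corresponds to $\alpha=(F,G)$, then $\mathrm{Area}(\Sigma)=2\pi\int_0^1F|\alpha'|\,dt$. Eigenvalues. Let $\mathrm{Lip}_0(0,1)$ be the space of Lipschitz functions $w:[0,1]\to\mathbb{R}$ with $w(0)=w(1)=0$. For $\alpha=(F,G)\in\mathcal{R}$, integers $k\ge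 0$, $n\ge 1$, define $$\lambda_{k,n}(\alpha)=\min_W\max_{w\in W\setminus\{0\}}\frac{\int_0^1 \frac{|w'|^2F}{|\alpha'|}+\frac{k^2|w|^2|\alpha'|}{F}\,dt}{\int_0^1|w|^2F|\alpha'|\,dt},$$ the minimum being over all $n$-dimensional subspaces $W$ of $\mathrm{Lip}_0(0,1)$. Only finitely many $\lambda_{k,n}(\alpha)$ lie in any bounded set. The numbers $\lambda_1(\alpha)\le\lambda_2(\alpha)\le\dots$ are the non-decreasing enumeration of all $\lambda_{k,n}(\alpha)$ ($k\ge0$, $n\ge1$), where each $\lambda_{k,n}(\alpha)$ with $k\ne0$ is counted twice and each $\lambda_{0,n}(\alpha)$ once. For the surface $\Sigma\in\mathcal{S}$ corresponding to $\alpha$, $\lambda_j(\Sigma)=\lambda_j(\alpha)$; for smooth $\Sigma$ these are the Dirichlet eigenvalues of $-\Delta_\Sigma$, where $\Delta_\Sigma$ is the Laplace-Beltrami operator. $\lambda_j(D_1\cup D_2)$ is the $j$-th Dirichlet eigenvalue of the Laplacian on the disjoint union of the two flat discs, counted with multiplicity. Area minimizers. ''Area minimizing surface with boundary given by $C_1$ and $C_2$'' refers to the Plateau problem in $\mathbb{R}^3$; the competitors include every surface in $\mathcal{S}$ as well as the disconnected surface $D_1\cup D_2$. A catenoid with this boundary means a piece of a catenoid (a catenary rotated about $\Gamma$) bounded by $C_1$ and $C_2$; it belongs to $\mathcal{S}$. *)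

(* Defs.v *)
From HB Require Import structures.
From mathcomp Require Import all_boot all_order all_algebra.
From mathcomp Require Import all_classical all_reals all_analysis.
Set Implicit Arguments.
Unset Strict Implicit.
Unset Printing Implicit Defensive.
Import Order.TTheory GRing.Theory Num.Theory.
Import numFieldNormedType.Exports.
Local Open Scope classical_set_scope.
Local Open Scope ring_scope.

(* The norms of the library on R * R and 'rV[R]_n are sup norms; lengths and
   distances below are Euclidean. *)
Definition enorm (R : realType) (n : nat) (v : 'rV[R]_n) : R :=
  Num.sqrt (\sum_i v 0 i ^+ 2).

Definition hausdorff_dist (R : realType) (n : nat) (A B : set 'rV[R]_n) :
    \bar R :=
  let excess (X Y : set 'rV[R]_n) : \bar R :=
    ereal_sup [set ereal_inf [set (enorm (x - y))%:E | y in Y] | x in X] in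
  maxe (excess A B) (excess B A).

Definition lin_indep (R : realType) (V : lmodType R) (n : nat)
    (e : 'I_n -> V) : Prop :=
  forall c : 'I_n -> R, \sum_i c i *: e i = 0 -> forall i, c i = 0.

Definition subspace_dim (R : realType) (V : lmodType R) (n : nat)
    (W : set V) : Prop :=
  exists e : 'I_n -> V,
    lin_indep e /\ W = [set \sum_i c i *: e i | c in [set: 'I_n -> R]].

(* The j-th term (j >= 1) of the non-decreasing enumeration, with repetitions,
   of the family x indexed by A: the least m such that x i <= m for at least j
   indices i. *)
Definition jth_smallest (R : realType) (I : Type) (A : set I)
    (x : I -> \bar R) (j : nat) : \bar R :=
  ereal_inf [set m : \bar R | exists s : 'I_j -> I,
    [/\ injective s, forall i, A (s i) & forall i, (x (s i) <= m)%E]].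

(* A curve [0, 1] -> {(x, y) | x > 0} is given by a function on R; only its
   restriction to [0, 1] is used. *)
Definition speed (R : realType) (a : R -> R * R) (t : R) : R :=
  Num.sqrt ((derive1 a t).1 ^+ 2 + (derive1 a t).2 ^+ 2).

Definition meridian (R : realType) (p q : R * R) (a : R -> R * R) : Prop :=
  [/\ [lipschitz a t | t in `[0 : R, 1]],
      forall t, t \in `[0, 1] -> 0 < (a t).1,
      a 0 = p,
      a 1 = q
    & exists L : R, {ae (@lebesgue_measure R), forall t : R,
        t \in `[0, 1] -> speed a t = L}].

Definition area (R : realType) (a : R -> R * R) : R :=
  2 * pi * (\int[@lebesgue_measure R]_(t in `[0, 1]) ((a t).1 * speed a t))%R.

(* Elements of Lip_0(0,1) are extended by 0 to R, so that they form a subspace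
   of R -> R. *)
Definition Lip0 (R : realType) : set (R -> R) :=
  [set w | [lipschitz w t | t in `[0 : R, 1]] /\
           forall t, t \notin `]0, 1[ -> w t = 0].

Definition rayleigh (R : realType) (a : R -> R * R) (k : nat) (w : R -> R) : R :=
  (\int[@lebesgue_measure R]_(t in `[0, 1])
     (`|derive1 w t| ^+ 2 * (a t).1 / speed a t
      + k%:R ^+ 2 * `|w t| ^+ 2 * speed a t / (a t).1))%R
  / (\int[@lebesgue_measure R]_(t in `[0, 1])
     (`|w t| ^+ 2 * (a t).1 * speed a t))%R.

(* The minimum and the maximum of the min-max are written as inf and sup in the
   extended reals, which agree with them whenever they are attained. *)
Definition lambda_mode (R : realType) (a : R -> R * R) (k n : nat) : \bar R :=
  ereal_inf [set ereal_sup [set (rayleigh a k w)%:E | w in W `\ 0]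
            | W in [set W : set (R -> R) |
                     subspace_dim n W /\ W `<=` @Lip0 R]].

(* The index (k, n, c) stands for the c-th copy of lambda_{k,n}: two copies
   when k > 0, a single one when k = 0. *)
Definition mode_index : set (nat * nat * bool) :=
  [set i | (0 < i.1.2)%N /\ (i.1.1 = 0%N -> i.2 = false)].

Definition lambda (R : realType) (a : R -> R * R) (j : nat) : \bar R :=
  jth_smallest mode_index (fun i => lambda_mode a i.1.1 i.1.2) j.

Definition Lambda (R : realType) (p q : R * R) (j : nat) : \bar R :=
  ereal_sup [set lambda a j | a in meridian p q].

Definition partial (R : realType) (i : 'I_2) (u : 'rV[R]_2 -> R) :
    'rV[R]_2 -> R :=
  fun z => derive u z (delta_mx 0 i).

Definition C2_at (R : realType) (u : 'rV[R]_2 -> R) (z : 'rV[R]_2) : Prop :=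
  forall i j : 'I_2,
    [/\ derivable u z (delta_mx 0 i),
        derivable (partial i u) z (delta_mx 0 j)
      & {for z, continuous (partial j (partial i u))}].

(* Classical Dirichlet eigenfunctions on the disc of radius r, extended by 0
   outside the open disc: continuity on the whole plane amounts to continuity
   up to the boundary together with the boundary condition. *)
Definition disc_eigenfunction (R : realType) (r mu : R) (u : 'rV[R]_2 -> R) :
    Prop :=
  [/\ continuous u,
      forall z, r <= enorm z -> u z = 0
    & forall z, enorm z < r ->
        C2_at u z /\ - (\sum_i partial i (partial i u) z) = mu * u z].

(* Functions on the disjoint union of the discs of radii r1 and r2 are pairs of
   functions, indexed by bool. Eigenvalues are repeated according to
   multiplicity: the j-th one is the least m such that the eigenvalues <= m
   have j linearly independent eigenfunctions. *)
Definition lambda_discs (R : realType) (r1 r2 : R) (j : nat) : \bar R :=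
  ereal_inf [set m%:E | m in [set m : R |
    exists u : 'I_j -> (bool -> 'rV[R]_2 -> R),
      lin_indep u /\
      forall i, exists2 mu : R, mu <= m &
        disc_eigenfunction r1 mu (u i true) /\
        disc_eigenfunction r2 mu (u i false)]].

(* Cylindrical coordinates around the line o + R e3, where e1, e2, e3 are the
   rows of the orthogonal matrix E; the half-plane of the meridians is the one
   containing o + e1. *)
Definition cyl (R : realType) (o : 'rV[R]_3) (E : 'M[R]_3) (z : R * R)
    (theta : R) : 'rV[R]_3 :=
  o + (\row_(i < 3) [:: z.1 * cos theta; z.1 * sin theta; z.2]`_i) *m E.

Definition revolve (R : realType) (o : 'rV[R]_3) (E : 'M[R]_3)
    (a : R -> R * R) : set 'rV[R]_3 :=
  [set cyl o E (a t) theta | t in `[0, 1] & theta in [set: R]].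

Definition disc (R : realType) (o : 'rV[R]_3) (E : 'M[R]_3) (c : R * R) :
    set 'rV[R]_3 :=
  [set cyl o E (x, c.2) theta | x in `[0, c.1] & theta in [set: R]].

(* A competitor for the Plateau problem. Its area is recorded separately, as it
   may count multiplicities and is then not a function of the underlying set. *)
Record surface (R : realType) := Surface {
  support : set 'rV[R]_3;
  surface_area : \bar R }.

Definition surface_of (R : realType) (o : 'rV[R]_3) (E : 'M[R]_3)
    (a : R -> R * R) : surface R :=
  Surface (revolve o E a) (area a)%:E.

Definition discs (R : realType) (o : 'rV[R]_3) (E : 'M[R]_3) (p q : R * R) :
    surface R :=
  Surface (disc o E p `|` disc o E q) (pi * p.1 ^+ 2 + pi * q.1 ^+ 2)%:E.

(* The class of surfaces in R^3 admitted in the Plateau problem (mappings,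
   currents, sets, ...) is left open: it is any class containing the surfaces
   of revolution and the pair of discs. *)
Definition plateau_class (R : realType) (o : 'rV[R]_3) (E : 'M[R]_3)
    (p q : R * R) (P : set (surface R)) : Prop :=
  (forall a, meridian p q a -> P (surface_of o E a)) /\ P (discs o E p q).

Definition unique_area_minimizer (R : realType) (P : set (surface R))
    (S : surface R) : Prop :=
  [/\ P S,
      forall T, P T -> (surface_area S <= surface_area T)%E
    & forall T, P T -> surface_area T = surface_area S -> T = S].

(* A non-overlapping arc of a catenary x = c cosh ((y - b) / c). *)
Definition catenoid (R : realType) (p q : R * R) (a : R -> R * R) : Prop :=
  [/\ meridian p q a,
      {in `[0, 1] &, injective a}
    & exists b c : R, 0 < c /\ forall t, t \in `[0, 1] ->
        (a t).1 = c * ((expR (((a t).2 - b) / c)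
                        + expR (- (((a t).2 - b) / c))) / 2)].

(* Main.v *)
(* The [k]-th mode of a band of radius [m] and meridian length [l] has about
   [(l / pi) sqrt (lam - k^2 / m^2)] eigenvalues below [lam]; summed over [k], this
   is a multiple of [lam] times the area of the band. Cutting a meridian into
   bands thus gives a Weyl law. Sine functions on the bands bound the eigenvalues
   of any curve from above, uniformly if the bands at distance less than [eta]
   from the axis are discarded; Wirtinger's inequality bounds the eigenvalues of
   the catenoid from below; on the discs, the eigenfunctions
   [J_k (sqrt mu r) cos (k t)], whose zeros are located by Sturm comparison, give
   an upper bound. The catenoid has less area than the discs, whence the first
   claim.
   A meridian approaching the axis would contain bands of total area almost that
   of the discs, too much for its [j]-th eigenvalue to exceed that of the
   catenoid. So the [j]-th maximizer stays away from the axis, no band is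
   discarded, and its area is at most that of the catenoid plus [o(1)]. Finally, a
   minimizing sequence of meridians away from the axis has a uniform limit which,
   by comparison with its inscribed polygons, has constant speed and minimal
   area, hence generates the catenoid. *)
Require Import Defs.
From HB Require Import structures.
From mathcomp Require Import all_boot all_order all_algebra.
From mathcomp Require Import all_classical all_reals all_analysis.
From mathcomp Require Import measurable_realfun ring lra.
Set Implicit Arguments.
Unset Strict Implicit.
Unset Printing Implicit Defensive.
Import Order.TTheory GRing.Theory Num.Theory.
Import numFieldNormedType.Exports.
Local Open Scope classical_set_scope.
Local Open Scope ring_scope.

(** * Almost everywhere differentiability of Lipschitz functions *)

(** Two obstacles shape the proof. The integrands of [rayleigh] and [area] contain [derive1], which
    is controlled only at almost every point. So every curve and every test function receives a
    bounded measurable density, obtained from the Radon-Nikodym derivative of a Stieltjes measure,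
    and the estimates are made on it. The other obstacle is uniformity. The maximizer changes with
    [j], so the threshold of the Weyl upper bound must be the same for all meridians: bands of
    length between [eps * eta / 4] and [eps * eta / 2], at distance at least [eta] from the axis,
    give one in terms of [eps] and [eta]. The lower bound is applied to the catenoid, and its
    threshold may depend on the curve. The discs enter as a barrier because half the squared
    distance to the axis varies along a meridian at most as fast as the area divided by [2 * pi].
    Going down to the axis and back costs [(p.1 ^+ 2 + q.1 ^+ 2) / 2], the area of the two discs
    divided by [2 * pi]. *)

Section ae_integral.
Context d (T : measurableType d) (R : realType)
  (mu : {measure set T -> \bar R}).
Import HBNNSimple.
Local Open Scope ereal_scope.

(* Needed because [derive1] and [speed] are not known to be measurable. *)
Lemma ge0_ae_le_integral_nonmeasurable (D : set T) (f g : T -> \bar R) :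
  (forall x, D x -> 0 <= f x) -> (forall x, D x -> 0 <= g x) ->
  {ae mu, forall x, D x -> f x = g x} ->
  \int[mu]_(x in D) f x <= \int[mu]_(x in D) g x.
Proof.
move=> f0 g0 [N [mN muN DN]].
rewrite !ge0_integralE//; apply: ge_ereal_sup => _ [h hf <-].
pose k := mul_nnsfun h (indic_nnsfun R (measurableC mN)).
have kE x : k x = (h x * \1_(~` N) x)%R by [].
have -> : sintegral mu h = sintegral mu k.
  rewrite -!integralT_nnsfun; apply: ae_eq_integral => //.
  - by apply/measurable_EFinP.
  - by apply/measurable_EFinP.
  - exists N; split => // x /=; apply: contra_notP => Nx _.
    by rewrite (_ : mindic _ _ x = \1_(~` N) x)// indicE mem_set// mulr1.
apply: ereal_sup_ubound; exists k => // x; rewrite kE indicE.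
have := hf x; rewrite /patch.
case: ifPn => Dx; last first.
  rewrite lee_fin => hx; have /eqP -> : h x == 0%R.
    by rewrite eq_le hx fun_ge0.
  by rewrite mul0r.
have [Nx|Nx] := pselect (N x).
  by rewrite memNset// mulr0 => _; apply: g0; exact: set_mem.
rewrite mem_set// mulr1 => /le_trans; apply.
suff -> : f x = g x by [].
by apply: contrapT => fg; apply/Nx/DN => /=; apply: contra_not fg; apply; exact: set_mem.
Qed.

Lemma ge0_ae_eq_integral_nonmeasurable (D : set T) (f g : T -> \bar R) :
  (forall x, D x -> 0 <= f x) -> (forall x, D x -> 0 <= g x) ->
  {ae mu, forall x, D x -> f x = g x} ->
  \int[mu]_(x in D) f x = \int[mu]_(x in D) g x.
Proof.
move=> f0 g0 fg; apply/eqP; rewrite eq_le !ge0_ae_le_integral_nonmeasurable//.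
by apply: filterS fg => x /[swap] Dx ->.
Qed.

Lemma ae_eq_Rintegral_nonmeasurable (D : set T) (f g : T -> R) :
  {ae mu, forall x, D x -> f x = g x} ->
  (\int[mu]_(x in D) f x = \int[mu]_(x in D) g x)%R.
Proof.
move=> fg; rewrite /Rintegral; congr fine.
rewrite [LHS]integralE [RHS]integralE; congr (_ - _);
  apply: ge0_ae_eq_integral_nonmeasurable => //.
- by apply: filterS fg => x /[swap] Dx fgx; rewrite !funeposE fgx.
- by apply: filterS fg => x /[swap] Dx fgx; rewrite !funenegE fgx.
Qed.

End ae_integral.

Section lipschitz_derivative.
Variable R : realType.
Notation mu := (@lebesgue_measure R).
Implicit Types (f : R -> R) (M a b : R).

Lemma ae_lebesgueS (P Q : R -> Prop) : (forall x, P x -> Q x) ->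
  {ae mu, forall x, P x} -> {ae mu, forall x, Q x}.
Proof.
by move=> PQ; apply: (@filterS _ _ (ae_filter_ringOfSetsType mu)).
Qed.

Lemma ae_lebesgueI (P Q : R -> Prop) : {ae mu, forall x, P x} ->
  {ae mu, forall x, Q x} -> {ae mu, forall x, P x /\ Q x}.
Proof.
by move=> aP aQ; apply: (@filterI _ _ (ae_filter_ringOfSetsType mu)).
Qed.

Lemma ae_lebesgue_neq (a : R) : {ae mu, forall x, x != a}.
Proof.
exists [set a]; split; [exact: measurable_set1|exact: lebesgue_measure_set1|].
by move=> x /= /negP; rewrite negbK => /eqP.
Qed.

Lemma lebesgue_stieltjes_itv (G : cumulative R R) (x y : R) : x <= y ->
  lebesgue_stieltjes_measure G `]x, y]%classic = (G y - G x)%:E.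
Proof.
move=> xy; rewrite /lebesgue_stieltjes_measure /measure_extension.
rewrite measurable_mu_extE/=; last exact: is_ocitv.
by rewrite wlength_itv_bnd.
Qed.

Lemma le_normr_cumulative f M : (forall s t, `|f s - f t| <= M * `|s - t|) ->
  nondecreasing (fun t => f t + M * t) /\ nondecreasing (fun t => M * t - f t).
Proof.
move=> fM; split=> s t st; have := fM t s;
  by rewrite (ger0_norm (_ : 0 <= t - s)) ?subr_ge0// ler_norml => /andP[]; lra.
Qed.

Lemma lipschitz_right_continuous f M :
  (forall s t, `|f s - f t| <= M * `|s - t|) -> continuous f.
Proof.
move=> fM x; apply/cvgrPdist_le => e e0.
have M0 : 0 <= M.
  by have := fM 1 0; rewrite subr0 normr1 mulr1; apply: le_trans.
near=> y; rewrite (le_trans (fM _ _))//.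
rewrite (@le_trans _ _ ((M + 1) * `|x - y|))//.
  by rewrite ler_wpM2r// lerDl.
rewrite mulrC -ler_pdivlMr; last by rewrite ltr_wpDl.
near: y; apply: cvgr_dist_le; first exact: cvg_id.
by rewrite divr_gt0// ltr_wpDl.
Unshelve. all: end_near. Qed.

(** With [H t = M * t - f t], which is nondecreasing too, [G + H] is [2 * M * t]. The sum of the two
    Stieltjes measures divided by [2 * M] is therefore Lebesgue measure, by uniqueness, and a null
    set is null for both summands. *)
Lemma lipschitz_stieltjes_dominated f M (G : cumulative R R) : 0 < M ->
  (forall s t, `|f s - f t| <= M * `|s - t|) ->
  (forall t, G t = f t + M * t) ->
  forall A : set R, measurable A -> mu A = 0%E ->
  lebesgue_stieltjes_measure G A = 0%E.
Proof.
move=> M0 fM GE A mA muA.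
have [_ ndH] := le_normr_cumulative fM.
have cf := lipschitz_right_continuous fM.
have rcH : right_continuous (fun t => M * t - f t).
  apply: right_continuousW => x; apply: cvgB; last exact: cf.
  by apply: cvgM; [exact: cvg_cst|exact: cvg_id].
pose H : cumulative R R := HB.pack (fun t => M * t - f t)
  (isCumulative.Build R _ R (fun t => M * t - f t) ndH rcH).
have c0 : 0 <= (2 * M)^-1 by rewrite invr_ge0; lra.
pose m := mscale (NngNum c0) (measure_add (lebesgue_stieltjes_measure G)
  (lebesgue_stieltjes_measure H)).
have mE X : (m X = (2 * M)^-1%:E * (lebesgue_stieltjes_measure G X +
    lebesgue_stieltjes_measure H X))%E.
  by rewrite -measure_addE.
have : (mu A = m A)%E.
  apply: lebesgue_measure_unique => // X /ocitvP[->|[[x y] /= xy ->]].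
    by rewrite !measure0.
  transitivity (m `]x, y]%classic) => //.
  rewrite mE !lebesgue_stieltjes_itv ?ltW//= lebesgue_measure_itv/= lte_fin xy.
  by rewrite -!EFinD -EFinM !GE; congr (_%:E); field; rewrite gt_eqF.
rewrite muA mE => /esym/eqP; rewrite mule_eq0 => /orP[|].
  by rewrite eqe invr_eq0 mulf_eq0 (negbTE (lt0r_neq0 M0)) pnatr_eq0.
by rewrite padde_eq0//; [case/andP => /eqP|exact: measure_ge0..].
Qed.

Lemma is_derive_le_norm (V : normedModType R) (f : R -> V) (M x : R) (l : V) :
  is_derive x 1 f l -> (\forall t \near x, `|f t - f x| <= M * `|t - x|) ->
  `|l| <= M.
Proof.
move=> [dF <-] fM.
apply: (cvgr_to_le (cvg_norm dF)).
have : \forall h \near 0, `|f (h + x) - f x| <= M * `|h|.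
  have := fM; rewrite (near_shift 0 x) => /=; apply: filterS => h /=.
  by rewrite /= subr0 addrK.
move=> H; rewrite near_withinE; near=> h => h0.
rewrite /= normrZ normfV ler_pdivrMl ?normr_gt0// mulrC.
by rewrite [_%:A]mulr1; near: h.
Unshelve. all: end_near. Qed.

Lemma integrable_itv_bounded f M (b0 b1 : bool) (s t : R) :
  measurable_fun setT f -> (forall x, `|f x| <= M) ->
  mu.-integrable [set` Interval (BSide b0 s) (BSide b1 t)] (EFin \o f).
Proof.
move=> mf fM; apply: measurable_bounded_integrable => //.
- by rewrite [ltLHS]lebesgue_measure_itv/=; case: ifP => // _; rewrite -EFinB ltry.
- exact: measurable_funTS.
- by exists M; split; rewrite ?num_real// => y My x _; exact: le_trans (ltW My).
Qed.

(** Adding [M * t] makes [f] nondecreasing. The density is the Radon-Nikodym derivative of the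
    Stieltjes measure of the sum, restricted to []a, b]] so as to be finite. *)
Lemma lipschitz_density f M a b : a < b -> 0 < M ->
  (forall s t, `|f s - f t| <= M * `|s - t|) ->
  exists2 h : R -> R, mu.-integrable setT (EFin \o h) &
    forall s t, a <= s -> s <= t -> t <= b ->
      \int[mu]_(x in `]s, t]) h x = f t - f s + M * (t - s).
Proof.
move=> ab M0 fM.
have [ndG _] := le_normr_cumulative fM.
have cf := lipschitz_right_continuous fM.
have rcG : right_continuous (fun t => f t + M * t).
  apply: right_continuousW => x; apply: cvgD; first exact: cf.
  by apply: cvgM; [exact: cvg_cst|exact: cvg_id].
pose G : cumulative R R := HB.pack (fun t => f t + M * t)
  (isCumulative.Build R _ R (fun t => f t + M * t) ndG rcG).
pose nu0 : {measure set (measurableTypeR R) -> \bar R} :=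
  lebesgue_stieltjes_measure G.
have nu0E x y : x <= y -> nu0 `]x, y]%classic = (G y - G x)%:E.
  exact: (@lebesgue_stieltjes_itv G).
have nuab : (nu0 `]a, b]%classic < +oo)%E.
  by rewrite nu0E ?ltry// ltW.
have mab : measurable (`]a, b]%classic : set (measurableTypeR R)) by [].
pose nu := charge_of_finite_measure (mfrestr mab nuab).
have nuE X : nu X = nu0 (X `&` `]a, b]) by [].
have nudom : nu `<< mu.
  apply/null_content_dominatesP => A mA muA.
  rewrite /nu /charge_of_finite_measure /mfrestr /mrestr/=.
  apply: (@lipschitz_stieltjes_dominated f M) => //.
    exact: measurableI.
  apply/eqP; rewrite eq_le measure_ge0 andbT -muA le_measure ?inE//.
  exact: measurableI.
pose h := fine \o Radon_Nikodym nu mu.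
have hE x : Radon_Nikodym nu mu x = (h x)%:E.
  by rewrite /h /= fineK//; exact: Radon_Nikodym_fin_num.
have ih : mu.-integrable setT (EFin \o h).
  apply: eq_integrable (Radon_Nikodym_integrable nudom) => //.
have hint t : a <= t -> t <= b -> \int[mu]_(x in `]a, t]) h x = G t - G a.
  move=> at_ tb; rewrite /Rintegral.
  under eq_integral do rewrite -hE.
  rewrite -Radon_Nikodym_integral//.
  transitivity (fine (nu0 (`]a, t] `&` `]a, b]))) => //.
  by rewrite setIidl ?nu0E//; apply: subset_itvl; rewrite bnd_simp.
have hint2 s t : a <= s -> s <= t -> t <= b ->
    \int[mu]_(x in `]s, t]) h x = G t - G s.
  move=> as_ st tb.
  rewrite -(@Rintegral_itvB _ _ (BRight a)) ?bnd_simp//.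
    by rewrite !hint ?(le_trans st)// ?(le_trans as_)//; lra.
  exact: integrableS ih.
exists h => // s t as_ st tb; rewrite hint2// /G/=; ring.
Qed.

(** Rademacher's theorem on the line: by Lebesgue differentiation the primitive of the density [h]
    has derivative [h] almost everywhere, and on []a, b[] this primitive differs from [f t + M * t]
    by a constant. *)
Lemma lipschitz_ae_derive f M a b : a < b -> 0 < M ->
  (forall s t, `|f s - f t| <= M * `|s - t|) ->
  exists g : R -> R,
    [/\ measurable_fun setT g, forall x, `|g x| <= M,
      {ae mu, forall x, a < x < b -> is_derive x 1 f (g x)} &
      forall s t, a <= s -> s <= t -> t <= b ->
        \int[mu]_(x in `[s, t]) g x = f t - f s].
Proof.
move=> ab M0 fM.
have cf := lipschitz_right_continuous fM.
have [h ih hint] := lipschitz_density ab M0 fM.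
have lih : locally_integrable setT h.
  by apply: open_integrable_locally ih; exact: openT.
have aeh : {ae mu, forall x, a < x < b -> is_derive x 1 f (h x - M)}.
  have iI (y : R) : mu.-integrable [set` Interval (BRight a) (BRight y)]
      (EFin \o h) by exact: integrableS ih.
  have := @FTC1 R h (BRight a) iI lih.
  apply: ae_lebesgueS => x + /andP[ax xb]; move=> /(_ ax) [dF F'].
  have dF1 : is_derive x 1 (fun x => \int[mu]_(t in `]a, x]) h t) (h x).
    by split; [exact: dF|rewrite -derive1E; exact: F'].
  apply: (@near_eq_is_derive _ _ _
    (fun t => \int[mu]_(t in `]a, t]) h t + (f a - M * (t - a)))).
    near=> t; rewrite hint//; first by lra.
      by apply/ltW; near: t; exact: lt_nbhsr.
    by apply/ltW; near: t; exact: lt_nbhsl.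
  apply: is_derive_eq.
  by rewrite /GRing.scale/=; ring.
have Mh x : a < x < b -> is_derive x 1 f (h x - M) -> `|h x - M| <= M.
  move=> _ dfx; apply: (is_derive_le_norm dfx).
  by near=> t; exact: fM.
(* At the points where [f] has derivative [h x - M] the bound [M] holds already; the truncation
   imposes it at all points. *)
pose g x := Num.max (- M) (Num.min M (h x - M)).
have gE x : `|h x - M| <= M -> g x = h x - M.
  rewrite ler_norml => /andP[hM Mh']; rewrite /g.
  by rewrite (min_idPr Mh') (max_idPr hM).
have mh : measurable_fun setT h by apply/measurable_EFinP; case/integrableP : ih.
have aeg : {ae mu, forall x, a < x < b -> is_derive x 1 f (g x)}.
  by apply: ae_lebesgueS aeh => x dfx xab; have dx := dfx xab; rewrite gE ?(Mh _ xab).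
have mg : measurable_fun setT g.
  apply: measurable_maxr; first exact: measurable_cst.
  apply: measurable_minr; first exact: measurable_cst.
  by apply: measurable_funB => //; exact: measurable_cst.
have gM x : `|g x| <= M.
  rewrite ler_norml /g le_max lexx/= ge_max ge_min lexx/= andbT.
  by rewrite -subr_ge0 opprK; lra.
exists g; split => //.
- move=> s t as_ st tb.
  have ist : mu.-integrable `]s, t] (EFin \o h) by exact: integrableS ih.
  rewrite -Rintegral_itv_obnd_cbnd; last exact: integrable_itv_bounded mg gM.
  transitivity (\int[mu]_(x in `]s, t]) (h x - M)).
    apply: ae_eq_Rintegral_nonmeasurable.
    have := ae_lebesgueI (ae_lebesgue_neq b) aeh; apply: ae_lebesgueS.
    move=> x [xb dx]; rewrite /= in_itv/= => /andP[sx xt].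
    have xab : a < x < b.
      by rewrite (le_lt_trans as_ sx)/= lt_neqAle xb (le_trans xt tb).
    by rewrite gE//; exact: (Mh _ xab (dx xab)).
  rewrite RintegralB//; last first.
    by apply: (@integrable_itv_bounded _ `|M|) => // x; exact: lexx.
  rewrite hint// Rintegral_cst//= lebesgue_measure_itv/= lte_fin.
  case: ltP => [_|ts]; first by rewrite -EFinD/=; ring.
  by rewrite (le_anti (introT andP (conj st ts)))/=; ring.
Unshelve. all: end_near. Qed.

End lipschitz_derivative.

(** * Integration of bounded measurable functions over intervals *)

Section bounded_measurable.
Variable R : realType.
Notation mu := (@lebesgue_measure R).
Implicit Types (f g : R -> R) (s t u c : R).

(** A class stable under the algebraic operations and integrable on bounded intervals, which reduces
    integrability conditions to closure lemmas. *)
Definition bounded_measurable f :=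
  measurable_fun setT f /\ exists M, forall x, `|f x| <= M.

Lemma bounded_measurable_cst c : bounded_measurable (fun=> c).
Proof. by split; [exact: measurable_cst|exists `|c|]. Qed.

Lemma bounded_measurableD f g : bounded_measurable f -> bounded_measurable g ->
  bounded_measurable (fun x => f x + g x).
Proof.
move=> [mf [M fM]] [mg [N gN]]; split; first exact: measurable_funD.
by exists (M + N) => x; rewrite (le_trans (ler_normD _ _))// lerD.
Qed.

Lemma bounded_measurableM f g : bounded_measurable f -> bounded_measurable g ->
  bounded_measurable (fun x => f x * g x).
Proof.
move=> [mf [M fM]] [mg [N gN]]; split; first exact: measurable_funM.
by exists (M * N) => x; rewrite normrM ler_pM.
Qed.

Lemma bounded_measurableZ c f : bounded_measurable f ->
  bounded_measurable (fun x => c * f x).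
Proof. by apply: bounded_measurableM; exact: bounded_measurable_cst. Qed.

Lemma bounded_measurableB f g : bounded_measurable f -> bounded_measurable g ->
  bounded_measurable (fun x => f x - g x).
Proof.
move=> bf bg; apply: bounded_measurableD => //.
by under eq_fun do rewrite -mulN1r; exact: bounded_measurableZ.
Qed.

Lemma bounded_measurableX f n : bounded_measurable f ->
  bounded_measurable (fun x => f x ^+ n).
Proof.
move=> [mf [M fM]]; split; first exact: measurable_funX.
by exists (M ^+ n) => x; rewrite normrX lerXn2r// nnegrE ?(le_trans _ (fM x)).
Qed.

Lemma bounded_measurable_continuous f M :
  continuous f -> (forall x, `|f x| <= M) -> bounded_measurable f.
Proof.
by move=> cf fM; split; [exact: continuous_measurable_fun|exists M].
Qed.

Lemma integrable_bounded_measurable f (b0 b1 : bool) s t :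
  bounded_measurable f ->
  mu.-integrable [set` Interval (BSide b0 s) (BSide b1 t)] (EFin \o f).
Proof. by move=> [mf [M fM]]; exact: integrable_itv_bounded fM. Qed.

Lemma RintegralD_itv f g s t : bounded_measurable f -> bounded_measurable g ->
  \int[mu]_(x in `[s, t]) (f x + g x) =
  \int[mu]_(x in `[s, t]) f x + \int[mu]_(x in `[s, t]) g x.
Proof.
by move=> bf bg; apply: RintegralD => //; exact: integrable_bounded_measurable.
Qed.

Lemma RintegralB_itv f g s t : bounded_measurable f -> bounded_measurable g ->
  \int[mu]_(x in `[s, t]) (f x - g x) =
  \int[mu]_(x in `[s, t]) f x - \int[mu]_(x in `[s, t]) g x.
Proof.
by move=> bf bg; apply: RintegralB => //; exact: integrable_bounded_measurable.
Qed.

Lemma RintegralZ_itv f c s t : bounded_measurable f ->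
  \int[mu]_(x in `[s, t]) (c * f x) = c * \int[mu]_(x in `[s, t]) f x.
Proof.
by move=> bf; apply: RintegralZl => //; exact: integrable_bounded_measurable.
Qed.

Lemma Rintegral_cst_itv c s t : s <= t ->
  \int[mu]_(x in `[s, t]) c = c * (t - s).
Proof.
move=> st; rewrite Rintegral_cst//= lebesgue_measure_itv/= lte_fin.
case: ltP => [_|ts]; first by rewrite -EFinD/=.
by rewrite (le_anti (introT andP (conj st ts)))/= subrr.
Qed.

Lemma le_Rintegral_itv f g s t : bounded_measurable f -> bounded_measurable g ->
  (forall x, s <= x <= t -> f x <= g x) ->
  \int[mu]_(x in `[s, t]) f x <= \int[mu]_(x in `[s, t]) g x.
Proof.
move=> bf bg fg; apply: le_Rintegral => //.
- exact: integrable_bounded_measurable.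
- exact: integrable_bounded_measurable.
Qed.

(** The maximum of [f] and [g] dominates [f] everywhere and agrees with [g] almost everywhere on the
    interval. *)
Lemma ae_le_Rintegral_itv f g s t :
  bounded_measurable f -> bounded_measurable g ->
  {ae mu, forall x, s <= x <= t -> f x <= g x} ->
  \int[mu]_(x in `[s, t]) f x <= \int[mu]_(x in `[s, t]) g x.
Proof.
move=> bf bg fg; pose h x := Num.max (f x) (g x).
have bh : bounded_measurable h.
  case: bf bg => [mf [M fM]] [mg [N gN]]; split; first exact: measurable_maxr.
  exists (Num.max M N) => x; rewrite /h /Num.max.
  by case: ifP => _; rewrite le_max ?fM ?gN ?orbT.
rewrite [leRHS](_ : _ = \int[mu]_(x in `[s, t]) h x).
  by apply: le_Rintegral_itv => // x _; rewrite /h le_max lexx.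
apply: ae_eq_Rintegral_nonmeasurable; apply: ae_lebesgueS fg => x + /=.
by rewrite in_itv/= => /[apply] fg; rewrite /h; apply/esym/max_idPr.
Qed.

Lemma Rintegral_split_itv f s t u : bounded_measurable f -> s <= t -> t <= u ->
  \int[mu]_(x in `[s, u]) f x =
  \int[mu]_(x in `[s, t]) f x + \int[mu]_(x in `[t, u]) f x.
Proof.
move=> bf st tu; rewrite -(@Rintegral_itv_obnd_cbnd _ t); last first.
  exact: integrable_bounded_measurable.
rewrite -(@Rintegral_itvB _ f (BLeft s) (BRight u) t) ?bnd_simp//; last first.
  exact: integrable_bounded_measurable.
by rewrite addrC subrK.
Qed.

Lemma Rintegral_itv_set1 f s : \int[mu]_(x in `[s, s]) f x = 0.
Proof. by rewrite set_itv1 Rintegral_set1. Qed.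

Lemma Rintegral_sum_itv f (p : nat -> R) n : bounded_measurable f ->
  (forall i, p i <= p i.+1) ->
  \int[mu]_(x in `[p 0, p n]) f x =
  \sum_(i < n) \int[mu]_(x in `[p i, p i.+1]) f x.
Proof.
move=> bf pS; elim: n => [|n IHn]; first by rewrite big_ord0 Rintegral_itv_set1.
rewrite big_ord_recr/= -IHn; apply: Rintegral_split_itv => //.
by elim: n {IHn} => // n /le_trans; apply.
Qed.

Lemma Rintegral_itv_ge0 f s t : (forall x, s <= x <= t -> 0 <= f x) ->
  0 <= \int[mu]_(x in `[s, t]) f x.
Proof. by move=> f0; apply: Rintegral_ge0 => x /=; rewrite in_itv/=; exact: f0. Qed.

Lemma Rintegral_itv_gt0 f s t x : bounded_measurable f -> continuous f ->
  (forall x, 0 <= f x) -> s < x < t -> 0 < f x ->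
  0 < \int[mu]_(x in `[s, t]) f x.
Proof.
move=> bf cf f0 /andP[sx xt] fx.
have : \forall y \near x, f x / 2 < f y.
  by have := cf x; move/cvgr_gt; apply; lra.
move=> [e /= e0 He].
pose d := Num.min (e / 2) (Num.min (x - s) (t - x)).
have d0 : 0 < d by rewrite !lt_min; apply/and3P; split; lra.
have [de ds dt] : [/\ d <= e / 2, d <= x - s & d <= t - x].
  by rewrite /d !ge_min !lexx !orbT.
rewrite (@Rintegral_split_itv _ _ (x - d))//; [|lra..].
rewrite (@Rintegral_split_itv _ (x - d) (x + d))//; [|lra..].
apply: ltr_wpDl; first exact: Rintegral_itv_ge0.
apply: ltr_pwDl; last exact: Rintegral_itv_ge0.
apply: (@lt_le_trans _ _ (\int[mu]_(y in `[x - d, x + d]) (f x / 2))).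
  by rewrite Rintegral_cst_itv ?mulr_gt0//; lra.
apply: le_Rintegral_itv => //; first exact: bounded_measurable_cst.
move=> y /andP[xy yx]; apply/ltW/He; rewrite /ball/= ltr_norml; lra.
Qed.

End bounded_measurable.

(** * Plane curves *)

Section lipschitz_unit_interval.
Variable R : realType.
Notation mu := (@lebesgue_measure R).
Implicit Types (f g : R -> R) (s t M L : R).

Lemma lipschitz01P (V : normedModType R) (f : R -> V) :
  [lipschitz f t | t in `[0 : R, 1]] ->
  exists2 M, 0 < M & forall s t, 0 <= s <= 1 -> 0 <= t <= 1 ->
    `|f s - f t| <= M * `|s - t|.
Proof.
move=> [M0 [_ H]]; exists (`|M0| + 1); first by rewrite ltr_pwDr.
move=> s t s01 t01.
have /(_ (s, t)) := H (`|M0| + 1) (ltr_pwDr ltr01 (ler_norm _)).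
by apply; split; rewrite /= in_itv.
Qed.

Lemma lipschitz01I (V : normedModType R) (f : R -> V) M :
  (forall s t, 0 <= s <= 1 -> 0 <= t <= 1 -> `|f s - f t| <= M * `|s - t|) ->
  [lipschitz f t | t in `[0 : R, 1]].
Proof.
move=> H; exists M; split; first exact: num_real.
move=> N MN [s t] [] /=; rewrite !in_itv/= => s01 t01.
by rewrite (le_trans (H _ _ s01 t01))// ler_wpM2r// ltW.
Qed.

(** Retraction onto [[0, 1]]; composition with it extends a Lipschitz function on [[0, 1]] to the
    line with the same constant. *)
Definition clamp01 t : R := Num.max 0 (Num.min 1 t).

Lemma clamp01_itv t : 0 <= clamp01 t <= 1.
Proof.
rewrite /clamp01 /Num.max /Num.min.
by do 2 case: ifP; move=> *; apply/andP; split; lra.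
Qed.

Lemma clamp01_id t : 0 <= t <= 1 -> clamp01 t = t.
Proof.
move=> /andP[t0 t1]; rewrite /clamp01 /Num.max /Num.min.
by do 2 case: ifP; move=> *; lra.
Qed.

Lemma clamp01_lipschitz s t : `|clamp01 s - clamp01 t| <= `|s - t|.
Proof.
wlog st : s t / s <= t.
  move=> H; have [/H//|/ltW/H] := leP s t.
  by rewrite distrC (distrC t).
rewrite ler0_norm ?(ler0_norm (_ : s - t <= 0)); [|lra|];
rewrite /clamp01 /Num.max /Num.min;
  by do 4 case: ifP; move=> *; lra.
Qed.

Lemma lipschitz_clamp01 (V : normedModType R) (f : R -> V) M : 0 < M ->
  (forall s t, 0 <= s <= 1 -> 0 <= t <= 1 -> `|f s - f t| <= M * `|s - t|) ->
  forall s t, `|f (clamp01 s) - f (clamp01 t)| <= M * `|s - t|.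
Proof.
move=> M0 fM s t; rewrite (le_trans (fM _ _ (clamp01_itv _) (clamp01_itv _)))//.
by rewrite ler_pM2l// clamp01_lipschitz.
Qed.

Lemma near_clamp01 t : 0 < t < 1 -> \forall s \near t, clamp01 s = s.
Proof.
move=> /andP[t0 t1]; near=> s; apply: clamp01_id; apply/andP; split; apply/ltW.
  by near: s; exact: lt_nbhsr.
by near: s; exact: lt_nbhsl.
Unshelve. all: end_near. Qed.

Lemma bounded_measurable_clamp01 f M : 0 < M ->
  (forall s t, 0 <= s <= 1 -> 0 <= t <= 1 -> `|f s - f t| <= M * `|s - t|) ->
  bounded_measurable (f \o clamp01).
Proof.
move=> M0 fM; apply: (@bounded_measurable_continuous _ _ (`|f 0| + M)).
  exact: lipschitz_right_continuous (lipschitz_clamp01 M0 fM).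
move=> t /=; rewrite -[f (clamp01 t)](subrK (f 0)) addrC.
rewrite (le_trans (ler_normD _ _))// lerD2l.
have c01 := clamp01_itv t.
rewrite (le_trans (fM _ _ c01 _)) ?lexx ?ler01// subr0.
by case/andP: c01 => c0 c1; rewrite ger0_norm// ler_piMr// ltW.
Qed.

Lemma lipschitz01_derivative f M : 0 < M ->
  (forall s t, 0 <= s <= 1 -> 0 <= t <= 1 -> `|f s - f t| <= M * `|s - t|) ->
  exists g : R -> R, [/\ bounded_measurable g,
    {ae mu, forall x : R, 0 < x < 1 -> is_derive x 1 f (g x)} &
    forall s t, 0 <= s -> s <= t -> t <= 1 ->
      \int[mu]_(x in `[s, t]) g x = f t - f s].
Proof.
move=> M0 fM.
have [g [mg gM dg ig]] :=
  lipschitz_ae_derive ltr01 M0 (lipschitz_clamp01 M0 fM).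
exists g; split; first by split => //; exists M.
  apply: ae_lebesgueS dg => x dx x01; have := dx x01.
  apply: near_eq_is_derive.
  by have := near_clamp01 x01; apply: filterS => y ->.
move=> s t s0 st t1; rewrite ig// !clamp01_id//.
  by rewrite s0 (le_trans st).
by rewrite t1 (le_trans s0).
Qed.

End lipschitz_unit_interval.

Section plane_curves.
Variable R : realType.
Notation mu := (@lebesgue_measure R).
Implicit Types (a : R -> R * R) (s t u v M L : R) (p q z : R * R).

Definition norm2 z : R := Num.sqrt (z.1 ^+ 2 + z.2 ^+ 2).

Lemma norm2_ge0 z : 0 <= norm2 z. Proof. exact: sqrtr_ge0. Qed.

Lemma sqr_norm2 z : norm2 z ^+ 2 = z.1 ^+ 2 + z.2 ^+ 2.
Proof. by rewrite sqr_sqrtr// addr_ge0// sqr_ge0. Qed.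

Lemma norm2_le z M : 0 <= M -> (norm2 z <= M) = (z.1 ^+ 2 + z.2 ^+ 2 <= M ^+ 2).
Proof. by move=> M0; rewrite -sqr_norm2 ler_sqr ?nnegrE ?norm2_ge0. Qed.

Lemma norm2_opp z : norm2 (- z) = norm2 z.
Proof. by rewrite /norm2 /= !sqrrN. Qed.

Lemma norm2_0 : norm2 0 = 0.
Proof. by rewrite /norm2 /= expr0n/= addr0 sqrtr0. Qed.

Lemma norm2_eq0 z : norm2 z = 0 -> z = 0.
Proof.
move=> z0; have := sqr_norm2 z; rewrite z0 expr0n/= => /esym/eqP.
rewrite paddr_eq0 ?sqr_ge0// !sqrf_eq0 => /andP[/eqP z1 /eqP z2].
by rewrite (surjective_pairing z) z1 z2.
Qed.

Lemma norm2_scale u z : norm2 (u * z.1, u * z.2) = `|u| * norm2 z.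
Proof.
rewrite /norm2/= !exprMn -mulrDr sqrtrM ?sqr_ge0// sqrtr_sqr//.
Qed.

Lemma dot_le_norm2 (z w : R * R) : z.1 * w.1 + z.2 * w.2 <= norm2 z * norm2 w.
Proof.
apply: (@le_trans _ _ `|z.1 * w.1 + z.2 * w.2|); first exact: ler_norm.
rewrite -ler_sqr ?nnegrE// ?mulr_ge0 ?norm2_ge0// exprMn !sqr_norm2 real_normK ?num_real//.
by rewrite -subr_ge0; have := sqr_ge0 (z.1 * w.2 - z.2 * w.1); nra.
Qed.

Lemma norm2D (z w : R * R) : norm2 (z + w) <= norm2 z + norm2 w.
Proof.
rewrite norm2_le ?addr_ge0 ?norm2_ge0// [leRHS]sqrrD !sqr_norm2/=.
by have := dot_le_norm2 z w; nra.
Qed.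

Lemma norm2_abs1 z : `|z.1| <= norm2 z.
Proof.
by rewrite -ler_sqr ?nnegrE ?norm2_ge0// sqr_norm2 real_normK ?num_real// lerDl sqr_ge0.
Qed.

Lemma norm2_abs2 z : `|z.2| <= norm2 z.
Proof.
by rewrite -ler_sqr ?nnegrE ?norm2_ge0// sqr_norm2 real_normK ?num_real// lerDr sqr_ge0.
Qed.

Lemma norm2_le_norm z : norm2 z <= 2 * `|z|.
Proof.
have h1 : `|z.1| <= `|z| by rewrite prod_normE le_max lexx.
have h2 : `|z.2| <= `|z| by rewrite prod_normE le_max lexx orbT.
rewrite norm2_le ?mulr_ge0// -(real_normK (num_real z.1)) -(real_normK (num_real z.2)).
by have := normr_ge0 z.1; have := normr_ge0 z.2; nra.
Qed.

Lemma norm_le_norm2 z : `|z| <= norm2 z.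
Proof. by rewrite prod_normE ge_max norm2_abs1 norm2_abs2. Qed.

Lemma derive1_pair a t (l1 l2 : R) :
  is_derive t 1 (fun s => (a s).1) l1 -> is_derive t 1 (fun s => (a s).2) l2 ->
  derive1 a t = (l1, l2).
Proof.
move=> [d1 <-] [d2 <-]; rewrite derive1E.
apply: cvg_lim; first exact: norm_hausdorff.
exact: (cvg_pair d1 d2).
Qed.

(** A bounded measurable velocity standing in for [derive1 a]: it is both the derivative almost
    everywhere and the density of the increments. *)
Definition curve_density a (g1 g2 : R -> R) :=
  [/\ bounded_measurable g1, bounded_measurable g2,
    {ae mu, forall t : R, 0 < t < 1 ->
      [/\ is_derive t 1 (fun s => (a s).1) (g1 t),
          is_derive t 1 (fun s => (a s).2) (g2 t) &
          speed a t = norm2 (g1 t, g2 t)]},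
    forall s t, 0 <= s -> s <= t -> t <= 1 ->
      \int[mu]_(x in `[s, t]) g1 x = (a t).1 - (a s).1 &
    forall s t, 0 <= s -> s <= t -> t <= 1 ->
      \int[mu]_(x in `[s, t]) g2 x = (a t).2 - (a s).2].

Lemma curve_density_exists a : [lipschitz a t | t in `[0 : R, 1]] ->
  exists g1 g2, curve_density a g1 g2.
Proof.
move=> /lipschitz01P[M M0 aM].
have a1 s t : 0 <= s <= 1 -> 0 <= t <= 1 -> `|(a s).1 - (a t).1| <= M * `|s - t|.
  move=> s01 t01; apply: le_trans (aM _ _ s01 t01).
  by rewrite [leRHS]prod_normE le_max lexx.
have a2 s t : 0 <= s <= 1 -> 0 <= t <= 1 -> `|(a s).2 - (a t).2| <= M * `|s - t|.
  move=> s01 t01; apply: le_trans (aM _ _ s01 t01).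
  by rewrite [leRHS]prod_normE le_max lexx orbT.
have [g1 [bg1 dg1 ig1]] := lipschitz01_derivative M0 a1.
have [g2 [bg2 dg2 ig2]] := lipschitz01_derivative M0 a2.
exists g1, g2; split => //.
apply: ae_lebesgueS (ae_lebesgueI dg1 dg2) => t [d1 d2] t01.
have D1 := d1 t01; have D2 := d2 t01; split => //.
by rewrite /speed (derive1_pair D1 D2).
Qed.

Lemma bounded_measurable_norm2 (g1 g2 : R -> R) :
  bounded_measurable g1 -> bounded_measurable g2 ->
  bounded_measurable (fun t => norm2 (g1 t, g2 t)).
Proof.
move=> [m1 [M1 b1]] [m2 [M2 b2]]; split.
  rewrite (_ : (fun t => _) = Num.sqrt \o (fun t => g1 t ^+ 2 + g2 t ^+ 2))//.
  apply: measurableT_comp.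
    by apply: continuous_measurable_fun => x; exact: sqrt_continuous.
  by apply: measurable_funD; exact: measurable_funX.
exists (2 * Num.max M1 M2) => x; rewrite ger0_norm ?norm2_ge0//.
rewrite (le_trans (norm2_le_norm _))// ler_pM2l// prod_normE/=.
by rewrite ge_max !le_max b1 b2 orbT.
Qed.

(** For [D = a t - a s], the square of [norm2 D] is the integral of the scalar product of [D] with
    the velocity; Cauchy-Schwarz under the integral and division by [norm2 D] conclude. *)
Lemma chord_le_Rintegral a g1 g2 s t : curve_density a g1 g2 ->
  0 <= s -> s <= t -> t <= 1 ->
  norm2 (a t - a s) <= \int[mu]_(x in `[s, t]) norm2 (g1 x, g2 x).
Proof.
move=> [b1 b2 _ i1 i2] s0 st t1.
set I := \int[mu]_(x in _) _; set D := a t - a s.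
have [D0|D0] := eqVneq (norm2 D) 0.
  by rewrite D0; apply: Rintegral_ge0 => x _; exact: norm2_ge0.
have Dp : 0 < norm2 D by rewrite lt_neqAle eq_sym D0 norm2_ge0.
rewrite -(ler_pM2l Dp) -expr2 sqr_norm2.
have -> : D.1 ^+ 2 + D.2 ^+ 2 =
    \int[mu]_(x in `[s, t]) (D.1 * g1 x + D.2 * g2 x).
  rewrite RintegralD_itv ?RintegralZ_itv ?i1 ?i2 ?expr2//;
    exact: bounded_measurableZ.
rewrite -RintegralZ_itv; last exact: bounded_measurable_norm2.
apply: le_Rintegral_itv => [||x _]; last exact: (dot_le_norm2 D (g1 x, g2 x)).
  by apply: bounded_measurableD; exact: bounded_measurableZ.
exact/bounded_measurableZ/bounded_measurable_norm2.
Qed.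

(** At a point with velocity [z], the scalar product of [z] with the curve has derivative
    [norm2 z ^+ 2], while it is Lipschitz with constant [norm2 z * L]. *)
Lemma speed_le a g1 g2 L : 0 <= L -> curve_density a g1 g2 ->
  (forall s t, 0 <= s <= 1 -> 0 <= t <= 1 -> norm2 (a s - a t) <= L * `|s - t|) ->
  {ae mu, forall t, 0 < t < 1 -> norm2 (g1 t, g2 t) <= L}.
Proof.
move=> L0 [_ _ dg _ _] aL; apply: ae_lebesgueS dg => t H t01.
have [d1 d2 _] := H t01.
set z := (g1 t, g2 t).
have [z0|z0] := eqVneq (norm2 z) 0; first by rewrite z0.
have zp : 0 < norm2 z by rewrite lt_neqAle eq_sym z0 norm2_ge0.
have dz : is_derive t 1 (fun s => z.1 * (a s).1 + z.2 * (a s).2)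
    (z.1 * z.1 + z.2 * z.2).
  by apply: is_derive_eq; rewrite /GRing.scale/=; ring.
rewrite -(ler_pM2l zp) -expr2 sqr_norm2 !expr2 (le_trans (ler_norm _))//.
apply: (is_derive_le_norm dz).
have t01' : 0 <= t <= 1 by case/andP: t01 => ? ?; apply/andP; split; exact: ltW.
have := near_clamp01 t01; apply: filterS => s <-.
have := clamp01_itv s; set s' := clamp01 s => s01.
rewrite -mulrA; apply: (@le_trans _ _ (norm2 z * norm2 (a s' - a t))); last first.
  by rewrite ler_pM2l// aL.
rewrite [X in `|X|](_ : _ = z.1 * (a s' - a t).1 + z.2 * (a s' - a t).2); last first.
  by rewrite /=; ring.
rewrite ler_norml dot_le_norm2 andbT lerNl.
have := dot_le_norm2 (- z) (a s' - a t); rewrite norm2_opp; apply: le_trans.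
by rewrite /= le_eqVlt; apply/orP; left; apply/eqP; ring.
Qed.

Definition meridian_of_speed p q a L :=
  [/\ [lipschitz a t | t in `[0 : R, 1]], 0 <= L,
      forall t, 0 <= t <= 1 -> 0 < (a t).1,
      a 0 = p /\ a 1 = q &
      {ae mu, forall t : R, 0 <= t <= 1 -> speed a t = L}].

Lemma meridian_of_speed_dist p q a L : meridian_of_speed p q a L ->
  forall s t, 0 <= s <= 1 -> 0 <= t <= 1 -> norm2 (a s - a t) <= L * `|s - t|.
Proof.
move=> [/curve_density_exists[g1 [g2 ga]] L0 _ _ aeL] s t s01 t01.
wlog st : s t s01 t01 / s <= t.
  move=> H; have [/H|/ltW/H] := leP s t; first exact.
  by rewrite -norm2_opp opprB distrC; exact.
rewrite -norm2_opp opprB ler0_norm ?subr_le0// opprB.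
case/andP: s01 => s0 _; case/andP: t01 => _ t1.
rewrite (le_trans (chord_le_Rintegral ga s0 st t1))//.
rewrite -Rintegral_cst_itv//; apply: ae_le_Rintegral_itv.
- by case: ga => b1 b2 _ _ _; exact: bounded_measurable_norm2.
- exact: bounded_measurable_cst.
case: ga => _ _ dg _ _.
have := ae_lebesgueI (ae_lebesgueI (ae_lebesgue_neq 0) (ae_lebesgue_neq 1))
  (ae_lebesgueI dg aeL).
apply: ae_lebesgueS => x [[x0 x1] [H1 H2]] /andP[sx xt].
have x01 : 0 < x < 1 by rewrite !lt_neqAle eq_sym x0 x1 (le_trans s0)// (le_trans xt).
have [_ _ <-] := H1 x01.
by rewrite H2// (le_trans s0)// (le_trans xt).
Qed.

(** A negative [L] is excluded: [speed] is nonnegative and [[0, 1]] is not a null set. *)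
Lemma meridianP p q a : meridian p q a <-> exists L, meridian_of_speed p q a L.
Proof.
split=> [[lip pos a0 a1 [L aeL]]|[L [lip L0 pos [a0 a1] aeL]]]; last first.
  split => //.
  by exists L; apply: ae_lebesgueS aeL => t; rewrite in_itv.
have [L0|L0] := leP 0 L.
  by exists L; split.
exfalso; case: aeL => N [mN N0 HN].
have : (mu `[0%R, 1%R] <= mu N)%E.
  apply: le_measure; rewrite ?inE// => x /= x01; apply: HN => /= /(_ x01) sL.
  by have := sqrtr_ge0 ((derive1 a x).1 ^+ 2 + (derive1 a x).2 ^+ 2);
    rewrite -/(speed a x) sL leNgt L0.
by rewrite N0 lebesgue_measure_itv/= lte_fin ltr01 oppr0 adde0 lee_fin ler10.
Qed.

Lemma area_meridian p q a L : meridian_of_speed p q a L ->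
  area a = 2 * pi * (L * \int[mu]_(t in `[0, 1]) (a (clamp01 t)).1).
Proof.
move=> [/lipschitz01P[M M0 aM] _ _ _ aeL]; rewrite /area; congr (_ * _).
have b1 : bounded_measurable (fun t => (a (clamp01 t)).1).
  apply: (@bounded_measurable_clamp01 _ (fun t => (a t).1) _ M0) => s t s01 t01.
  by apply: le_trans (aM _ _ s01 t01); rewrite [leRHS]prod_normE le_max lexx.
rewrite -RintegralZ_itv//; apply: ae_eq_Rintegral_nonmeasurable.
apply: ae_lebesgueS aeL => t H; rewrite /= in_itv/= => t01.
by rewrite H// clamp01_id// mulrC.
Qed.

End plane_curves.

(** * Counting modes *)

Section mode_counting.
Variables (R : realType) (n : nat -> nat) (K : nat).

Let copies (k : nat) : seq bool := if k == 0%N then [:: false] else [:: false; true].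

Let modes : seq (nat * nat * bool) :=
  [seq (k, ic.1.+1, ic.2) | k <- iota 0 K.+1,
     ic <- [seq (i, c) | i <- iota 0 (n k), c <- copies k]].

Let size_modes : size modes = (n 0 + (\sum_(i < K) n i.+1).*2)%N.
Proof.
have sz k : size [seq (i, c) | i <- iota 0 (n k), c <- copies k] =
    (n k * size (copies k))%N by rewrite size_allpairs size_iota.
rewrite size_allpairs_dep sumnE big_map; under eq_bigr do rewrite sz.
rewrite -[iota 0 K.+1]/(0%N :: iota 1 K) big_cons /= muln1.
congr (_ + _)%N; rewrite (iotaDl 1 0) big_map -(big_mkord xpredT (fun i => n i.+1)).
by rewrite /index_iota subn0 -mul2n big_distrr/=; apply: eq_bigr => i _; rewrite mulnC.
Qed.

Let uniq_modes : uniq modes.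
Proof.
apply: allpairs_uniq_dep; first exact: iota_uniq.
- move=> k _; apply: allpairs_uniq; rewrite ?iota_uniq//.
    by rewrite /copies; case: ifP.
  by move=> [? ?] [? ?].
- by move=> [k [i c]] [k' [i' c']] _ _ /= [-> -> ->].
Qed.

Let mem_modes k i c : ((k, i, c) \in modes) =
  [&& (k <= K)%N, (0 < i)%N, (i <= n k)%N & (k == 0%N) ==> ~~ c].
Proof.
apply/allpairsPdep/and4P.
- move=> [k' [[i' c'] [+ /allpairsP[[i'' c''] /= [+ + [-> ->]]] [-> -> ->]]]].
  rewrite !mem_iota/= !add0n => kK ikn ck; split => //.
  by move: ck; rewrite /copies; case: ifP => //= _; rewrite inE => /eqP ->.
- move=> [kK]; case: i => // i _ ink ck; exists k, (i, c); split => //.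
    by rewrite mem_iota add0n ltnS.
  apply/allpairsP; exists (i, c); split; rewrite /= ?mem_iota ?add0n//.
  by move: ck; rewrite /copies; case: (k == 0%N) => //=; case: c.
Qed.

(** The list [modes] enumerates the pairwise distinct indices with [k <= K] and [1 <= i <= n k],
    with one copy for [k = 0] and two otherwise; its first [j] entries form the required
    injection. *)
Lemma jth_smallest_le (x : nat * nat * bool -> \bar R) (m : \bar R) j :
  (forall k i c, (k <= K)%N -> (0 < i <= n k)%N -> (x (k, i, c) <= m)%E) ->
  (j <= n 0 + (\sum_(i < K) n i.+1).*2)%N ->
  (jth_smallest mode_index x j <= m)%E.
Proof.
rewrite -size_modes => xm jm; apply: ereal_inf_lbound.
have jlt (i : 'I_j) : (i < size modes)%N by rewrite (leq_trans (ltn_ord i)).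
exists (fun i => nth (0, 0, false)%N modes i); split.
- move=> i i' /eqP; rewrite nth_uniq// => /eqP; exact: val_inj.
- move=> i; have := mem_nth (0, 0, false)%N (jlt i).
  case: (nth _ _ _) => -[k l] c; rewrite mem_modes => /and4P[_ l0 _ kc].
  by split=> //= k0; move: kc; rewrite k0/=; case: c.
- move=> i; have := mem_nth (0, 0, false)%N (jlt i).
  case: (nth _ _ _) => -[k l] c; rewrite mem_modes => /and4P[kK l0 ln _].
  by apply: xm => //; rewrite l0.
Qed.

(** Distinct indices whose values lie below [m] all occur in [modes], so there are fewer than [j] of
    them. *)
Lemma jth_smallest_ge (x : nat * nat * bool -> \bar R) (m : \bar R) j :
  (forall k i c, (0 < i)%N -> (K < k)%N || (n k < i)%N -> (m <= x (k, i, c))%E) ->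
  (n 0 + (\sum_(i < K) n i.+1).*2 < j)%N ->
  (m <= jth_smallest mode_index x j)%E.
Proof.
rewrite -size_modes => xm jm; apply: le_ereal_inf_tmp => y [s [sI sA sy]].
rewrite leNgt; apply/negP => ym.
suff : (j <= size modes)%N by rewrite leqNgt jm.
rewrite -[leqLHS](size_enum_ord j) -(size_map s); apply: uniq_leq_size.
  by rewrite map_inj_uniq ?enum_uniq.
move=> _ /mapP[i _ ->].
have := sA i; have := le_lt_trans (sy i) ym.
case: (s i) => -[k l] c xlt [/= l0 kc]; rewrite mem_modes l0/=.
have [kl|] := boolP ((K < k)%N || (n k < l)%N).
  by have := xm k l c l0 kl; rewrite leNgt xlt.
rewrite negb_or -!leqNgt => /andP[-> ->].
by apply/implyP => /eqP /kc ->.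
Qed.

End mode_counting.

(** * Sums of radial frequencies as Riemann sums of the quarter circle *)

Section quarter_circle.
Variable R : realType.
Notation mu := (@lebesgue_measure R).
Implicit Types (x m lam l : R).

Let f x : R := Num.sqrt (1 - x ^+ 2).

Let f_continuous : continuous f.
Proof.
move=> x; apply: continuous_comp; last exact: sqrt_continuous.
apply: cvgB; first exact: cvg_cst.
by apply: cvgM; exact: cvg_id.
Qed.

Let f_ge0 x : 0 <= f x. Proof. exact: sqrtr_ge0. Qed.

Let f_le1 x : f x <= 1.
Proof. by rewrite -[leRHS]sqrtr1 ler_wsqrtr// gerBl sqr_ge0. Qed.

Let f_bounded : bounded_measurable f.
Proof.
by apply: (@bounded_measurable_continuous _ _ 1) => // x; rewrite ger0_norm.
Qed.

Let f_nonincreasing x y : 0 <= x -> x <= y -> f y <= f x.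
Proof. by move=> x0 xy; rewrite ler_wsqrtr// lerB// ler_sqr// nnegrE (le_trans x0). Qed.

(** The area [pi / 4] of a quarter of the unit disc. It is kept as an integral, since the counts for
    curves and for discs carry the same constant. *)
Definition quarter_disc : R := \int[mu]_(x in `[0, 1]) f x.

Lemma quarter_disc_gt0 : 0 < quarter_disc.
Proof.
apply: (@Rintegral_itv_gt0 _ _ _ _ (2^-1)) => //; first by apply/andP; split; lra.
by rewrite sqrtr_gt0; lra.
Qed.

Let intf y : 0 <= y -> \int[mu]_(x in `[0, y]) f x <= quarter_disc /\
  (1 <= y -> \int[mu]_(x in `[0, y]) f x = quarter_disc).
Proof.
move=> y0; have [y1|/ltW y1] := leP y 1.
  split.
    by rewrite /quarter_disc (Rintegral_split_itv f_bounded y0 y1) lerDl Rintegral_itv_ge0.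
  by move=> y1'; rewrite (le_anti (introT andP (conj y1 y1'))).
suff -> : \int[mu]_(x in `[0, y]) f x = quarter_disc by [].
rewrite (Rintegral_split_itv f_bounded ler01 y1) -[RHS]addr0; congr (_ + _).
rewrite -[RHS](mul0r (y - 1)) -Rintegral_cst_itv//; apply: eq_Rintegral => x.
rewrite inE/= in_itv/= => /andP[x1 _]; apply/eqP; rewrite sqrtr_eq0 subr_le0.
by rewrite -[leLHS](expr1n _ 2) ler_sqr// nnegrE (le_trans ler01).
Qed.

Let riemann (h : R) (N : nat) : 0 < h ->
  h * (\sum_(i < N) f (h * i.+1%:R)) <= \int[mu]_(x in `[0, h * N%:R]) f x
  <= h * (\sum_(i < N) f (h * i%:R)).
Proof.
move=> h0; pose p i := h * i%:R.
have pS i : p i <= p i.+1 by rewrite ler_pM2l// ler_nat.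
rewrite -[X in `[X, _]](mulr0 h) (Rintegral_sum_itv _ f_bounded pS) !mulr_sumr.
have p0 i : 0 <= p i by rewrite mulr_ge0// ltW.
have hE i : h = p i.+1 - p i by rewrite /p -mulrBr -natrB// subSnn mulr1.
apply/andP; split; apply: ler_sum => i _.
- rewrite mulrC {2}(hE i) -Rintegral_cst_itv//.
  apply: le_Rintegral_itv => //; first exact: bounded_measurable_cst.
  by move=> x /andP[ix xi]; apply: f_nonincreasing => //; exact: le_trans ix.
- rewrite mulrC {2}(hE i) -Rintegral_cst_itv//.
  apply: le_Rintegral_itv => //; first exact: bounded_measurable_cst.
  by move=> x /andP[ix xi]; exact: (f_nonincreasing (p0 i)).
Qed.

(** The wave number left to the meridian direction by the angular mode [k] on a circle of radius
    [m]. Since the square root of a negative number is [0], it vanishes for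
    [k >= m * Num.sqrt lam]. *)
Definition radial_freq lam m (k : nat) : R := Num.sqrt (lam - k%:R ^+ 2 / m ^+ 2).

Let radial_freqE lam m k : 0 < lam -> 0 < m ->
  radial_freq lam m k = Num.sqrt lam * f ((m * Num.sqrt lam)^-1 * k%:R).
Proof.
move=> l0 m0; rewrite /radial_freq /f -sqrtrM ?ltW//; congr Num.sqrt.
rewrite mulrBr mulr1 exprMn exprVn exprMn sqr_sqrtr ?ltW//.
by congr (_ - _); field; rewrite !gt_eqF.
Qed.

(** With step [h], the inverse of [m * Num.sqrt lam], the frequencies are samples of the quarter
    circle scaled by [Num.sqrt lam]; starting at [k = 1] gives a right Riemann sum of a
    nonincreasing function. *)
Lemma sum_radial_freq_le lam m (N : nat) : 0 < lam -> 0 < m ->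
  \sum_(i < N) radial_freq lam m i.+1 <= m * lam * quarter_disc.
Proof.
move=> l0 m0; set h := (m * Num.sqrt lam)^-1.
have sl0 : 0 < Num.sqrt lam by rewrite sqrtr_gt0.
have h0 : 0 < h by rewrite invr_gt0 mulr_gt0.
have hml : h * (m * lam * quarter_disc) = Num.sqrt lam * quarter_disc.
  by rewrite -[X in m * X](sqr_sqrtr (ltW l0)) /h; field; rewrite !gt_eqF.
under eq_bigr do rewrite radial_freqE//.
rewrite -mulr_sumr -(ler_pM2l h0).
have /andP[+ _] := riemann N h0; rewrite -(ler_pM2l sl0).
rewrite mulrCA => /le_trans; apply.
rewrite [leRHS](_ : _ = Num.sqrt lam * quarter_disc).
  by rewrite ler_pM2l//; apply: (intf _).1; rewrite mulr_ge0// ltW.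
exact: hml.
Qed.

(** The left Riemann sum contains in addition the term [k = 0], which is the subtracted
    [Num.sqrt lam]; the condition on [N] makes the samples reach the end of the quarter circle. *)
Lemma sum_radial_freq_ge lam m (N : nat) : 0 < lam -> 0 < m ->
  m * Num.sqrt lam <= N.+1%:R ->
  m * lam * quarter_disc - Num.sqrt lam <= \sum_(i < N) radial_freq lam m i.+1.
Proof.
move=> l0 m0 mN; set h := (m * Num.sqrt lam)^-1.
have sl0 : 0 < Num.sqrt lam by rewrite sqrtr_gt0.
have h0 : 0 < h by rewrite invr_gt0 mulr_gt0.
have hml : h * (m * lam * quarter_disc) = Num.sqrt lam * quarter_disc.
  by rewrite -[X in m * X](sqr_sqrtr (ltW l0)) /h; field; rewrite !gt_eqF.
under eq_bigr do rewrite radial_freqE//.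
rewrite -mulr_sumr lerBlDr -(ler_pM2l h0).
have /andP[_] := riemann N.+1 h0; rewrite (intf _).2; last first.
- by rewrite mulrC ler_pdivlMr ?mulr_gt0// mul1r.
- by rewrite mulr_ge0// ltW.
rewrite big_ord_recl/= mulr0 -(ler_pM2l sl0) => H.
rewrite [leLHS](_ : _ = Num.sqrt lam * quarter_disc); last first.
  exact: hml.
rewrite (le_trans H)// le_eqVlt; apply/orP; left; apply/eqP.
rewrite {1}/f expr0n/= subr0 sqrtr1.
under eq_bigr do rewrite /bump/= add1n.
by ring.
Qed.

Lemma sum_truncn_radial_freq_ge lam m l (N : nat) :
  0 < lam -> 0 < m -> 0 <= l ->
  m * Num.sqrt lam <= N.+1%:R ->
  l / pi * (m * lam * quarter_disc - Num.sqrt lam) - m * Num.sqrt lam <=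
  (\sum_(i < N) Num.truncn (l / pi * radial_freq lam m i.+1))%:R.
Proof.
move=> l0 m0 lp mN; set s := Num.sqrt lam in mN *.
have lpi : 0 <= l / pi by rewrite divr_ge0// pi_ge0.
(* The error [-1] of the truncation is paid only for the [k] with a positive
   frequency, that is [k < m * s]. *)
pose c (k : nat) : R := if k%:R < m * s then 1 else 0.
have tr k : l / pi * radial_freq lam m k - c k <=
    (Num.truncn (l / pi * radial_freq lam m k))%:R.
  rewrite /c; case: ltP => [_|msk].
    by rewrite lerBlDr natr1 ltW// truncnS_gt.
  rewrite (_ : radial_freq lam m k = 0) ?mulr0 ?subr0//.
  apply/eqP; rewrite sqrtr_eq0 subr_le0 ler_pdivlMr ?exprn_gt0//.
  rewrite -(sqr_sqrtr (ltW l0)) -exprMn -/s ler_sqr ?nnegrE ?mulr_ge0 ?sqrtr_ge0//.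
    by rewrite mulrC.
  exact: ltW.
have cs : \sum_(i < N) c i.+1 <= m * s.
  rewrite /c; elim: {mN} N => [|N IHN].
    by rewrite big_ord0 mulr_ge0 ?sqrtr_ge0// ltW.
  rewrite big_ord_recr/=; case: ltP => [Nms|_]; last by rewrite addr0.
  rewrite (le_trans _ (ltW Nms))// -natr1 lerD2r -[X in _ <= X%:R]card_ord -sumr_const.
  by apply: ler_sum => i _; case: ifP.
rewrite natr_sum.
apply: le_trans (_ : \sum_(i < N) (l / pi * radial_freq lam m i.+1 - c i.+1) <= _).
  rewrite sumrB lerB// -mulr_sumr ler_wpM2l//.
  exact: sum_radial_freq_ge.
by apply: ler_sum => i _.
Qed.

(* [quarter_disc * 2 / pi] is the density of the Weyl law with respect to the
   length weighted by the radius, i.e. the area divided by [2 pi]. *)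
Definition weyl_density : R := 2 * quarter_disc / pi.

Lemma weyl_density_gt0 : 0 < weyl_density.
Proof. by rewrite /weyl_density divr_gt0 ?mulr_gt0 ?quarter_disc_gt0 ?pi_gt0. Qed.

(** The threshold depends only on [del] and on the lower bounds [eta] of the radius and [l0] of the
    length, so that one value serves all bands of all curves. *)
Lemma truncn_mode_count_ge (del eta l0 : R) : 0 < del -> 0 < eta -> 0 < l0 ->
  exists2 lam0 : R, 0 < lam0 & forall lam l m (N : nat),
    lam0 <= lam -> l0 <= l -> eta <= m -> m * Num.sqrt lam <= N.+1%:R ->
    (1 - del) * weyl_density * lam * (l * m) <=
    ((\sum_(i < N) Num.truncn (l / pi * radial_freq lam m i.+1)).*2)%:R.
Proof.
move=> d0 e0 l00; have C0 := quarter_disc_gt0; have pi0 := pi_gt0 R.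
set C := quarter_disc in C0 *.
(* Up to the factor [2 * (l * m * s / pi)], the surplus of the count over the target is
   [s * (del * C) - (m^-1 + pi / l)]; [s0] makes it nonnegative in the worst case [m = eta],
   [l = l0]. *)
pose s0 := (eta^-1 + pi / l0) / (del * C).
have s00 : 0 < s0.
  by rewrite divr_gt0 ?addr_gt0 ?invr_gt0 ?divr_gt0 ?mulr_gt0.
exists (s0 ^+ 2); first by rewrite exprn_gt0.
move=> lam l m N laml ll mm mN.
have lam_gt0 : 0 < lam by rewrite (lt_le_trans _ laml)// exprn_gt0.
have m0 : 0 < m by rewrite (lt_le_trans e0).
have lgt0 : 0 < l by rewrite (lt_le_trans l00).
have := sum_truncn_radial_freq_ge lam_gt0 m0 (ltW lgt0) mN.
set T := (\sum_(i < N) _)%N; set s := Num.sqrt lam => HT.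
have s0s : s0 <= s by rewrite -(ger0_norm (ltW s00)) -sqrtr_sqr ler_wsqrtr.
have s_gt0 : 0 < s by rewrite (lt_le_trans s00).
have lamE : lam = s ^+ 2 by rewrite /s sqr_sqrtr// ltW.
rewrite -muln2 natrM mulr_natr -[leRHS]mulr_natl.
apply: le_trans (_ : 2 * (l / pi * (m * lam * C - s) - m * s) <= _); last first.
  by rewrite ler_pM2l// natr_sum -?natr_sum.
rewrite /weyl_density -/C -subr_ge0.
have -> : 2 * (l / pi * (m * lam * C - s) - m * s) -
    (1 - del) * (2 * C / pi) * lam * (l * m) =
    2 * (l * m * s / pi) * (s * (del * C) - (m^-1 + pi / l)).
  move: pi0; move: (pi : R) => pp pp0.
  by rewrite lamE; field; rewrite !gt_eqF.
rewrite mulr_ge0//; first by rewrite !mulr_ge0 ?invr_ge0// ltW.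
rewrite subr_ge0; apply: le_trans (_ : eta^-1 + pi / l0 <= _).
  by rewrite lerD ?lef_pV2 ?posrE// ler_pM2l// lef_pV2 ?posrE.
by rewrite -ler_pdivrMr ?mulr_gt0.
Qed.

End quarter_circle.

(** * Eigenvalues of a curve: upper bound *)

Section calculus.
Variable R : realType.
Notation mu := (@lebesgue_measure R).

Lemma is_derive_continuous (f : R -> R) (x l : R) :
  is_derive x 1 f l -> {for x, continuous f}.
Proof. by move=> [df _]; exact/differentiable_continuous/derivable1_diffP. Qed.

Lemma Rintegral_FTC2 (f F : R -> R) (s t : R) : s <= t ->
  (forall x : R, is_derive x 1 F (f x)) -> continuous f ->
  \int[mu]_(x in `[s, t]) f x = F t - F s.
Proof.
rewrite le_eqVlt => /predU1P[->|st] dF cf; first by rewrite Rintegral_itv_set1 subrr.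
rewrite /Rintegral (@continuous_FTC2 _ f F)//.
- exact: continuous_subspaceT.
- split.
  + by move=> x _; exact: ex_derive.
  + by apply: cvg_at_right_filter; exact: is_derive_continuous.
  + by apply: cvg_at_left_filter; exact: is_derive_continuous.
- by move=> x _; rewrite derive1E; exact: derive_val.
Qed.

Lemma is_derive_lipschitz (f df : R -> R) (M : R) :
  (forall x : R, is_derive x 1 f (df x)) -> (forall x, `|df x| <= M) ->
  forall s t, `|f s - f t| <= M * `|s - t|.
Proof.
move=> dF dM s t; wlog st : s t / s <= t.
  move=> H; have [/H//|/ltW/H] := leP s t.
  by rewrite distrC (distrC t).
have [|c _] := @MVT_segment R f df s t st (fun x _ => dF x).
  by apply: continuous_subspaceT => x; exact: is_derive_continuous.
move=> E; rewrite distrC E (distrC s) normrM ler_wpM2r//.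
Qed.

Lemma sin_lipschitz (x y : R) : `|sin x - sin y| <= `|x - y|.
Proof.
have := @is_derive_lipschitz sin cos 1 (@is_derive_sin R).
rewrite -[leRHS]mul1r; apply => z; rewrite ler_norml; apply/andP; split.
  exact: cos_geN1.
exact: cos_le1.
Qed.

End calculus.

(** * Half sine waves as test functions *)

Section sine_bumps.
Variable R : realType.
Notation mu := (@lebesgue_measure R).
Implicit Types (u v s t x : R).

(** The clamp extends the half wave by [0] outside [[u, v]], as the sine vanishes at [0] and at
    [pi]. *)
Definition sine_bump u v t : R := sin (pi * clamp01 ((t - u) / (v - u))).

Definition sine_bump_derivative u v t : R :=
  if u < t < v then pi / (v - u) * cos (pi * ((t - u) / (v - u))) else 0.

Lemma sine_bump_out u v t : u < v -> ~~ (u < t < v) -> sine_bump u v t = 0.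
Proof.
move=> uv; rewrite negb_and -!leNgt => /orP[tu|vt].
  rewrite /sine_bump /clamp01 (max_idPl _) ?mulr0 ?sin0// ge_min; apply/orP; right.
  by rewrite pmulr_lle0 ?invr_gt0 ?subr_gt0// subr_le0.
have h : 1 <= (t - u) / (v - u) by rewrite ler_pdivlMr ?subr_gt0// mul1r lerD2r.
by rewrite /sine_bump /clamp01 (min_idPl h) (max_idPr ler01) mulr1 sinpi.
Qed.

Lemma unit_itvP u v t : u < v ->
  (0 <= (t - u) / (v - u) <= 1) = (u <= t <= v).
Proof.
move=> uv; rewrite ler_pdivlMr ?subr_gt0// ler_pdivrMr ?subr_gt0//.
by rewrite mul0r mul1r subr_ge0 lerD2r.
Qed.

Lemma sine_bump_in u v t : u < v -> u <= t <= v ->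
  sine_bump u v t = sin (pi * ((t - u) / (v - u))).
Proof. by move=> uv utv; rewrite /sine_bump clamp01_id// unit_itvP. Qed.

Lemma sine_bump_midpoint u v : u < v -> sine_bump u v ((u + v) / 2) = 1.
Proof.
move=> uv; rewrite sine_bump_in//; last by apply/andP; split; lra.
rewrite (_ : pi * _ = pi / 2) ?sin_pihalf//; congr (_ * _).
by field; lra.
Qed.

Lemma sine_bump_lipschitz u v : u < v -> forall s t,
  `|sine_bump u v s - sine_bump u v t| <= pi / (v - u) * `|s - t|.
Proof.
move=> uv s t; rewrite (le_trans (sin_lipschitz _ _))// -mulrBr normrM.
have pi0 := pi_gt0 R; rewrite (gtr0_norm pi0) -mulrA ler_pM2l//.
rewrite (le_trans (clamp01_lipschitz _ _))// -mulrBl normrM mulrC.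
rewrite (gtr0_norm (_ : 0 < (v - u)^-1)) ?invr_gt0 ?subr_gt0//.
by rewrite ler_pM2l ?invr_gt0 ?subr_gt0// le_eqVlt; apply/orP; left; apply/eqP; congr `|_|; lra.
Qed.

Lemma is_derive_sin_affine (c d t : R) :
  is_derive t 1 (fun t => sin (c * (t - d))) (c * cos (c * (t - d))).
Proof. by apply: is_derive_eq; rewrite /GRing.scale/=; ring. Qed.

Lemma is_derive_cos_affine (c d t : R) :
  is_derive t 1 (fun t => cos (c * (t - d))) (- (c * sin (c * (t - d)))).
Proof. by apply: is_derive_eq; rewrite /GRing.scale/=; ring. Qed.

Lemma is_derive_sin_affineV (c d t : R) : c != 0 ->
  is_derive t 1 (fun t => c^-1 * sin (c * (t - d))) (cos (c * (t - d))).
Proof. by move=> c0; apply: is_derive_eq; rewrite /GRing.scale/=; field. Qed.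

Lemma is_derive_sine_bump u v t : u < v -> t != u -> t != v ->
  is_derive t 1 (sine_bump u v) (sine_bump_derivative u v t).
Proof.
move=> uv tu tv; rewrite /sine_bump_derivative; case: ifPn => [utv|].
  have := is_derive_sin_affine (pi / (v - u)) u t.
  rewrite (_ : pi / (v - u) * (t - u) = pi * ((t - u) / (v - u))); last by rewrite mulrA mulrAC.
  apply: near_eq_is_derive; case/andP: utv => ut tv'.
  near=> s; rewrite sine_bump_in//; first by rewrite mulrA mulrAC.
  apply/andP; split; apply/ltW; near: s; [exact: lt_nbhsr|exact: lt_nbhsl].
rewrite negb_and -!leNgt => utv.
apply: (@near_eq_is_derive _ _ _ (cst 0)).
case/orP: utv => [ut|vt]; near=> s; rewrite sine_bump_out// negb_and -!leNgt.
- have : s < u by near: s; apply: lt_nbhsl; rewrite lt_neqAle tu.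
  by move/ltW ->.
- have : v < s by near: s; apply: lt_nbhsr; rewrite lt_neqAle eq_sym tv.
  by move/ltW ->; rewrite orbT.
Unshelve. all: end_near. Qed.

Lemma bounded_measurable_sine_bump u v : u < v -> bounded_measurable (sine_bump u v).
Proof.
move=> uv; apply: (@bounded_measurable_continuous _ _ 1) => [|t].
  exact: lipschitz_right_continuous (sine_bump_lipschitz uv).
by rewrite ler_norml sin_geN1 sin_le1.
Qed.

Lemma bounded_measurable_sine_bump_derivative u v : u < v ->
  bounded_measurable (sine_bump_derivative u v).
Proof.
move=> uv; split.
  apply: measurable_fun_if => //.
  - apply: measurable_and; exact: measurable_fun_ltr.
  - apply: measurable_funTS; apply: continuous_measurable_fun.
    move=> t; apply: cvgM; first exact: cvg_cst.
    apply: continuous_comp; last exact: continuous_cos.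
    apply: cvgM; first exact: cvg_cst.
    by apply: cvgM; [apply: cvgB; [exact: cvg_id|exact: cvg_cst]|exact: cvg_cst].
exists (pi / (v - u)) => t; rewrite /sine_bump_derivative.
have h : 0 <= pi / (v - u) by rewrite divr_ge0 ?pi_ge0// subr_ge0 ltW.
case: ifP => _; rewrite ?normr0// normrM ger0_norm// ler_piMr//.
by rewrite ler_norml cos_geN1 cos_le1.
Qed.

Lemma Rintegral_cos_period u v : u < v ->
  \int[mu]_(t in `[u, v]) cos (2 * pi / (v - u) * (t - u)) = 0.
Proof.
move=> uv; set c := 2 * pi / (v - u).
have c0 : 0 < c by rewrite divr_gt0 ?mulr_gt0 ?pi_gt0// subr_gt0.
have dS (t : R) :
    is_derive t 1 (fun t => c^-1 * sin (c * (t - u))) (cos (c * (t - u))).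
  exact: is_derive_sin_affineV (lt0r_neq0 c0).
have cc : continuous (fun t => cos (c * (t - u))).
  by move=> t; exact: is_derive_continuous (is_derive_cos_affine c u t).
rewrite (Rintegral_FTC2 (ltW uv) dS cc) subrr mulr0 sin0 mulr0 subr0.
rewrite (_ : c * (v - u) = pi *+ 2) ?sin2pi ?mulr0//.
by rewrite /c mulfVK ?gt_eqF ?subr_gt0// mulr_natl.
Qed.

(** With [B = (pi / (v - u)) ^+ 2 * M / L] and [th] the phase, the derivative term is at most
    [B * cos th ^+ 2], and by the assumption on [lam] the remaining terms are at most
    [- B * sin th ^+ 2]. The difference of the two sides is thus bounded pointwise by
    [B * cos (th + th)], whose integral over the full period [[u, v]] is [0]. *)
Lemma sine_bump_energy_le (F : R -> R) (K lam L m M u v : R) :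
  0 <= u -> u < v -> v <= 1 -> 0 < L -> 0 < m -> 0 <= K ->
  bounded_measurable F -> bounded_measurable (fun t => (F t)^-1) ->
  (forall t, u <= t <= v -> m <= F t <= M) ->
  (pi / (v - u)) ^+ 2 * M / L + K * L / m <= lam * m * L -> 0 <= lam ->
  \int[mu]_(t in `[0, 1]) (sine_bump_derivative u v t ^+ 2 * F t / L +
     K * sine_bump u v t ^+ 2 * L / F t) <=
  lam * \int[mu]_(t in `[0, 1]) (sine_bump u v t ^+ 2 * F t * L).
Proof.
move=> u0 uv v1 L0 m0 K0 bF bFi mFM cond lam0.
have bb := bounded_measurable_sine_bump uv.
have bd := bounded_measurable_sine_bump_derivative uv.
pose H t := sine_bump_derivative u v t ^+ 2 * F t / L +
  K * sine_bump u v t ^+ 2 * L / F t - lam * (sine_bump u v t ^+ 2 * F t * L).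
have b1 : bounded_measurable (fun t => sine_bump_derivative u v t ^+ 2 * F t / L +
    K * sine_bump u v t ^+ 2 * L / F t).
  apply: bounded_measurableD.
    apply: bounded_measurableM; last exact: bounded_measurable_cst.
    by apply: bounded_measurableM => //; exact: bounded_measurableX.
  apply: bounded_measurableM => //.
  apply: bounded_measurableM; last exact: bounded_measurable_cst.
  by apply: bounded_measurableZ; exact: bounded_measurableX.
have b2 : bounded_measurable (fun t => sine_bump u v t ^+ 2 * F t * L).
  apply: bounded_measurableM; last exact: bounded_measurable_cst.
  by apply: bounded_measurableM => //; exact: bounded_measurableX.
have bH : bounded_measurable H.
  by apply: bounded_measurableB => //; exact: bounded_measurableZ.
rewrite -subr_le0 -RintegralZ_itv// -RintegralB_itv//; last exact: bounded_measurableZ.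
rewrite -/H; change (\int[mu]_(t in `[0, 1]) H t <= 0).
have H0 t : ~~ (u < t < v) -> H t = 0.
  move=> utv; rewrite /H /sine_bump_derivative (negbTE utv) sine_bump_out// expr0n/=.
  by rewrite !(mul0r, mulr0) subr0 addr0.
have out s t : (t <= u) || (v <= s) -> s <= t -> \int[mu]_(x in `[s, t]) H x = 0.
  move=> uvst st; rewrite -[RHS](mul0r (t - s)) -Rintegral_cst_itv//.
  apply: eq_Rintegral => x; rewrite inE/= in_itv/= => /andP[sx xt].
  apply: H0; rewrite negb_and -!leNgt.
  by case/orP: uvst => h; rewrite ?(le_trans xt h)// (le_trans h sx) orbT.
have uW := ltW uv.
rewrite (@Rintegral_split_itv _ _ 0 u 1)// ?(le_trans uW)//.
rewrite (@Rintegral_split_itv _ _ u v 1)//.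
rewrite (out 0 u) ?lexx// (out v 1) ?lexx ?orbT// add0r addr0.
pose B := (pi / (v - u)) ^+ 2 * M / L.
apply: le_trans (_ : \int[mu]_(t in `[u, v]) (B * cos (2 * pi / (v - u) * (t - u))) <= _).
  have bcos : bounded_measurable (fun t => cos (2 * pi / (v - u) * (t - u))).
    apply: (@bounded_measurable_continuous _ _ 1) => [t|t].
      exact: is_derive_continuous (is_derive_cos_affine _ _ t).
    by rewrite ler_norml cos_geN1 cos_le1.
  apply: le_Rintegral_itv => //; first exact: bounded_measurableZ.
  move=> t utv; have /andP[mF FM] := mFM t utv.
  have M0 : 0 < M by rewrite (lt_le_trans m0)// (le_trans mF).
  have F0 : 0 < F t by rewrite (lt_le_trans m0).
  have B0 : 0 <= B by apply: divr_ge0; [apply: mulr_ge0; [exact: sqr_ge0|exact: ltW]|exact: ltW].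
  set th := pi * ((t - u) / (v - u)).
  have -> : 2 * pi / (v - u) * (t - u) = th + th.
    by rewrite /th -mulr2n -[RHS]mulr_natl; field; lra.
  rewrite cosD -!expr2.
  have hd : sine_bump_derivative u v t ^+ 2 * F t / L <= B * cos th ^+ 2.
    have BE (x y : R) : x ^+ 2 * M / L * y ^+ 2 = (x * y) ^+ 2 * M / L by ring.
    rewrite /B BE ler_pM2r ?invr_gt0//.
    apply: le_trans (_ : (pi / (v - u) * cos th) ^+ 2 * F t <= _).
      rewrite ler_pM2r// /sine_bump_derivative; case: ifP => _ //.
      by rewrite expr0n/= sqr_ge0.
    by rewrite ler_wpM2l// sqr_ge0.
  rewrite mulrBr /H sine_bump_in// -/th -addrA lerD//.
  have -> : K * sin th ^+ 2 * L / F t - lam * (sin th ^+ 2 * F t * L) =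
      sin th ^+ 2 * (K * L / F t - lam * F t * L) by field; rewrite gt_eqF.
  rewrite -mulNr mulrC; apply: ler_wpM2r; first exact: sqr_ge0.
  rewrite lerBlDr -lerBlDl opprK addrC; apply: le_trans (_ : lam * m * L <= _).
    apply: le_trans cond; rewrite lerD2l.
    apply: ler_wpM2l; first exact: mulr_ge0 K0 (ltW L0).
    by rewrite lef_pV2 ?posrE.
  by rewrite ler_pM2r// ler_wpM2l.
rewrite RintegralZ_itv ?Rintegral_cos_period ?mulr0//.
apply: (@bounded_measurable_continuous _ _ 1) => [t|t].
  exact: is_derive_continuous (is_derive_cos_affine _ _ t).
by rewrite ler_norml cos_geN1 cos_le1.
Qed.

End sine_bumps.

Section bounded_measurable_sum.
Variable R : realType.
Notation mu := (@lebesgue_measure R).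

Lemma bounded_measurable_sum (I : Type) (r : seq I) (h : I -> R -> R) :
  (forall i, bounded_measurable (h i)) ->
  bounded_measurable (fun t => \sum_(i <- r) h i t).
Proof.
move=> bh; elim: r => [|i r IHr].
  by under eq_fun do rewrite big_nil; exact: bounded_measurable_cst.
by under eq_fun do rewrite big_cons; exact: bounded_measurableD.
Qed.

Lemma Rintegral_bigsum_itv (I : Type) (r : seq I) (h : I -> R -> R) (s t : R) :
  (forall i, bounded_measurable (h i)) ->
  \int[mu]_(x in `[s, t]) (\sum_(i <- r) h i x) =
  \sum_(i <- r) \int[mu]_(x in `[s, t]) h i x.
Proof.
move=> bh; elim: r => [|i r IHr].
  rewrite big_nil -[RHS](mul0r (\int[mu]_(x in `[s, t]) 0)) -RintegralZ_itv.
    by apply: eq_Rintegral => x _; rewrite big_nil mul0r.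
  exact: bounded_measurable_cst.
rewrite big_cons -IHr -RintegralD_itv//; last exact: bounded_measurable_sum.
by apply: eq_Rintegral => x _; rewrite big_cons.
Qed.

End bounded_measurable_sum.

Section meridian_rayleigh.
Variable R : realType.
Notation mu := (@lebesgue_measure R).
Implicit Types (a : R -> R * R) (w g : R -> R).

(** Clamped, so that for a meridian it is positive, bounded and continuous on the whole line. *)
Definition axis_dist a (t : R) : R := (a (clamp01 t)).1.

Variables (p q : R * R) (a : R -> R * R) (L : R).
Hypothesis aL : meridian_of_speed p q a L.

Lemma axis_dist_lipschitz (s t : R) : `|axis_dist a s - axis_dist a t| <= L * `|s - t|.
Proof.
have [_ L0 _ _ _] := aL.
apply: le_trans (_ : norm2 (a (clamp01 s) - a (clamp01 t)) <= _).
  exact: (norm2_abs1 (a (clamp01 s) - a (clamp01 t))).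
rewrite (le_trans (meridian_of_speed_dist aL (clamp01_itv _) (clamp01_itv _)))//.
by rewrite ler_wpM2l// clamp01_lipschitz.
Qed.

Lemma axis_dist_continuous : continuous (axis_dist a).
Proof. exact: lipschitz_right_continuous axis_dist_lipschitz. Qed.

Lemma axis_dist_gt0 (t : R) : 0 < axis_dist a t.
Proof. by have [_ _ a0 _ _] := aL; apply: a0; exact: clamp01_itv. Qed.

Lemma axis_dist_min : exists2 m, 0 < m & forall t, m <= axis_dist a t.
Proof.
have [|c _ H] := @EVT_min R (axis_dist a) 0 1 ler01.
  by apply: continuous_subspaceT; exact: axis_dist_continuous.
exists (axis_dist a c); first exact: axis_dist_gt0.
move=> t; have := H (clamp01 t); rewrite in_itv/= clamp01_itv => /(_ isT).
by rewrite {2}/axis_dist [clamp01 (clamp01 t)]clamp01_id// clamp01_itv.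
Qed.

Lemma axis_dist_max : exists2 M, 0 < M & forall t, axis_dist a t <= M.
Proof.
have [|c _ H] := @EVT_max R (axis_dist a) 0 1 ler01.
  by apply: continuous_subspaceT; exact: axis_dist_continuous.
exists (axis_dist a c); first exact: axis_dist_gt0.
move=> t; have := H (clamp01 t); rewrite in_itv/= clamp01_itv => /(_ isT).
by rewrite {1}/axis_dist [clamp01 (clamp01 t)]clamp01_id// clamp01_itv.
Qed.

Lemma bounded_measurable_axis_dist : bounded_measurable (axis_dist a).
Proof.
have [M M0 aM] := axis_dist_max.
apply: (@bounded_measurable_continuous _ _ M); first exact: axis_dist_continuous.
by move=> t; rewrite gtr0_norm ?axis_dist_gt0.
Qed.

Lemma bounded_measurable_axis_distV : bounded_measurable (fun t => (axis_dist a t)^-1).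
Proof.
have [m m0 am] := axis_dist_min.
apply: (@bounded_measurable_continuous _ _ m^-1).
  move=> t; apply: cvgV; first by rewrite gt_eqF ?axis_dist_gt0.
  exact: axis_dist_continuous.
by move=> t; rewrite normfV gtr0_norm ?axis_dist_gt0// lef_pV2 ?posrE ?axis_dist_gt0.
Qed.

Lemma area_axis_dist : area a = 2 * pi * (L * \int[mu]_(t in `[0, 1]) axis_dist a t).
Proof. exact: (area_meridian aL). Qed.

(** Trades [derive1 w] for any [g] that is its derivative almost everywhere, so that a bounded
    measurable one can be chosen. *)
Lemma rayleighE (k : nat) w g :
  {ae mu, forall t : R, 0 < t < 1 -> is_derive t 1 w (g t)} ->
  rayleigh a k w =
  (\int[mu]_(t in `[0, 1]) (g t ^+ 2 * axis_dist a t / L +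
     k%:R ^+ 2 * w t ^+ 2 * L / axis_dist a t)) /
  \int[mu]_(t in `[0, 1]) (w t ^+ 2 * axis_dist a t * L).
Proof.
move=> dw; have [_ _ _ _ aeL] := aL; rewrite /rayleigh; congr (_ / _).
- apply: ae_eq_Rintegral_nonmeasurable.
  have := ae_lebesgueI (ae_lebesgueI (ae_lebesgue_neq 0) (ae_lebesgue_neq 1))
    (ae_lebesgueI dw aeL).
  apply: ae_lebesgueS => t [[t0 t1] [H1 H2]]; rewrite /= in_itv/= => t01.
  have t01' : 0 < t < 1 by rewrite !lt_neqAle eq_sym t0 t1.
  have D := H1 t01'.
  by rewrite H2// derive1E derive_val /axis_dist clamp01_id// !real_normK ?num_real.
- apply: ae_eq_Rintegral_nonmeasurable.
  apply: ae_lebesgueS aeL => t H; rewrite /= in_itv/= => t01.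
  by rewrite H// /axis_dist clamp01_id// !real_normK ?num_real.
Qed.

(** The trial space is spanned by half waves on non-overlapping intervals. All cross terms vanish,
    both quadratic forms become diagonal, and the Rayleigh bound follows from that of each half
    wave. *)
Lemma lambda_mode_le (k n : nat) (lam : R) (u v : 'I_n -> R) :
  0 < L -> 0 <= lam ->
  (forall i, [/\ 0 <= u i, u i < v i & v i <= 1]) ->
  (forall i j, i != j -> (v i <= u j) || (v j <= u i)) ->
  (forall i, exists m M, [/\ 0 < m,
     forall t, u i <= t <= v i -> m <= axis_dist a t <= M &
     (pi / (v i - u i)) ^+ 2 * M / L + k%:R ^+ 2 * L / m <= lam * m * L]) ->
  (lambda_mode a k n <= lam%:E)%E.
Proof.
move=> L0 lam0 uv dis cond.
have uvl i : u i < v i by have [] := uv i.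
pose e (i : 'I_n) : R -> R := sine_bump (u i) (v i).
pose ge (i : 'I_n) : R -> R := sine_bump_derivative (u i) (v i).
have excl i j t : i != j -> u i < t < v i -> u j < t < v j -> False.
  move=> /dis /orP[h|h] /andP[a1 a2] /andP[b1 b2].
    by have := lt_trans (lt_le_trans a2 h) b1; rewrite ltxx.
  by have := lt_trans (lt_le_trans b2 h) a1; rewrite ltxx.
have ee i j t : i != j -> e i t * e j t = 0.
  move=> ij; have [ti|ti] := boolP (u i < t < v i); last by rewrite /e sine_bump_out ?mul0r.
  have [tj|tj] := boolP (u j < t < v j); first by have := excl _ _ _ ij ti tj.
  by rewrite mulrC /e sine_bump_out ?mul0r.
have gg i j t : i != j -> ge i t * ge j t = 0.
  move=> ij; have [ti|/negbTE ti] := boolP (u i < t < v i); last by rewrite /ge /sine_bump_derivative ti mul0r.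
  have [tj|/negbTE tj] := boolP (u j < t < v j); first by have := excl _ _ _ ij ti tj.
  by rewrite /ge /sine_bump_derivative tj mulr0.
have sqr_sum (c : 'I_n -> R) (h : 'I_n -> R -> R) t :
    (forall i j, i != j -> h i t * h j t = 0) ->
    (\sum_i c i * h i t) ^+ 2 = \sum_i c i ^+ 2 * h i t ^+ 2.
  move=> hh; rewrite expr2 mulr_suml; apply: eq_bigr => i _.
  rewrite mulr_sumr (bigD1 i)//= big1 ?addr0 => [|j ji]; first by rewrite -exprMn expr2.
  by rewrite mulrACA hh ?mulr0// eq_sym.
have combE (c : 'I_n -> R) t : (\sum_i c i *: e i) t = \sum_i c i * e i t.
  by rewrite fct_sumE.
pose W := [set \sum_i c i *: e i | c in [set: 'I_n -> R]].
(* At the midpoints of the intervals the half waves take the values of a Kronecker symbol, whence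
   their independence. *)
have e_mid i j : e j ((u i + v i) / 2) = (i == j)%:R.
  have ei : e i ((u i + v i) / 2) = 1 by exact: sine_bump_midpoint.
  have [<-//|ij] := eqVneq i j.
  by have := ee i j ((u i + v i) / 2) ij; rewrite ei mul1r.
have dW : subspace_dim n W.
  exists e; split => // c c0 i.
  have := congr1 (fun f : R -> R => f ((u i + v i) / 2)) c0.
  rewrite combE (bigD1 i)//= big1 ?addr0 => [|j ji]; rewrite e_mid ?eqxx ?mulr1//.
  by rewrite eq_sym (negbTE ji) mulr0.
have LW : W `<=` @Lip0 R.
  move=> _ [c _ <-]; split; last first.
    move=> t t01; rewrite combE big1// => i _; rewrite /e sine_bump_out ?mulr0//.
    have [u0 _ v1] := uv i; apply: contra t01 => /andP[ut tv].
    by rewrite in_itv/= (le_lt_trans u0 ut) (lt_le_trans tv v1).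
  apply: (@lipschitz01I _ _ _ (\sum_i `|c i| * (pi / (v i - u i)))) => s t _ _.
  rewrite !combE -sumrB (le_trans (ler_norm_sum _ _ _))// mulr_suml.
  apply: ler_sum => i _; rewrite -mulrBr normrM -mulrA ler_wpM2l//.
  exact: sine_bump_lipschitz.
apply: ge_ereal_inf; exists (ereal_sup [set (rayleigh a k w)%:E | w in W `\ 0]).
  by exists W.
apply: ge_ereal_sup => _ [_ [[c _ <-] _] <-]; rewrite lee_fin.
have dw : {ae mu, forall t : R, 0 < t < 1 ->
    is_derive t 1 (\sum_i c i *: e i) (\sum_i c i * ge i t)}.
  have : {ae mu, forall t, forall i, t != u i /\ t != v i}.
    apply: (@filter_forall _ _ _ _ (ae_filter_ringOfSetsType mu)) => i.
    by apply: ae_lebesgueI; exact: ae_lebesgue_neq.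
  apply: ae_lebesgueS => t Ht _.
  apply: is_derive_sum => i; have [tu tv] := Ht i.
  by apply: is_deriveZ; exact: is_derive_sine_bump.
rewrite (rayleighE k dw).
have bF := bounded_measurable_axis_dist; have bFi := bounded_measurable_axis_distV.
have be i : bounded_measurable (e i) by exact: bounded_measurable_sine_bump.
have bg i : bounded_measurable (ge i) by exact: bounded_measurable_sine_bump_derivative.
pose N i := \int[mu]_(t in `[0, 1]) (ge i t ^+ 2 * axis_dist a t / L +
   k%:R ^+ 2 * e i t ^+ 2 * L / axis_dist a t).
pose D i := \int[mu]_(t in `[0, 1]) (e i t ^+ 2 * axis_dist a t * L).
have bN i : bounded_measurable (fun t => ge i t ^+ 2 * axis_dist a t / L +
   k%:R ^+ 2 * e i t ^+ 2 * L / axis_dist a t).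
  apply: bounded_measurableD.
    apply: bounded_measurableM; last exact: bounded_measurable_cst.
    by apply: bounded_measurableM => //; exact: bounded_measurableX.
  apply: bounded_measurableM => //.
  apply: bounded_measurableM; last exact: bounded_measurable_cst.
  by apply: bounded_measurableZ; exact: bounded_measurableX.
have bD i : bounded_measurable (fun t => e i t ^+ 2 * axis_dist a t * L).
  apply: bounded_measurableM; last exact: bounded_measurable_cst.
  by apply: bounded_measurableM => //; exact: bounded_measurableX.
have Isum (h : 'I_n -> R -> R) : (forall i, bounded_measurable (h i)) ->
    \int[mu]_(t in `[0, 1]) (\sum_i c i ^+ 2 * h i t) =
    \sum_i c i ^+ 2 * \int[mu]_(t in `[0, 1]) h i t.
  move=> bh; under [RHS]eq_bigr do rewrite -RintegralZ_itv//.
  by apply: Rintegral_bigsum_itv => i; exact: bounded_measurableZ.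
have -> : \int[mu]_(t in `[0, 1]) ((\sum_i c i * ge i t) ^+ 2 * axis_dist a t / L +
    k%:R ^+ 2 * (\sum_i c i *: e i) t ^+ 2 * L / axis_dist a t) =
    \sum_i c i ^+ 2 * N i.
  rewrite -Isum//; apply: eq_Rintegral => t _.
  rewrite combE !sqr_sum; [|by move=> i j; exact: ee|by move=> i j; exact: gg].
  rewrite mulr_sumr !mulr_suml -big_split/=; apply: eq_bigr => i _; ring.
have -> : \int[mu]_(t in `[0, 1]) ((\sum_i c i *: e i) t ^+ 2 * axis_dist a t * L) =
    \sum_i c i ^+ 2 * D i.
  rewrite -Isum//; apply: eq_Rintegral => t _.
  rewrite combE sqr_sum; last by move=> i j; exact: ee.
  by rewrite !mulr_suml; apply: eq_bigr => i _; ring.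
have ND i : N i <= lam * D i.
  have [u0 uvi v1] := uv i; have [m [M [m0 mM cnd]]] := cond i.
  exact: (sine_bump_energy_le u0 uvi v1 L0 m0 (sqr_ge0 _) bF bFi mM cnd lam0).
have D0 i : 0 <= D i.
  apply: Rintegral_itv_ge0 => t _.
  exact: (mulr_ge0 (mulr_ge0 (sqr_ge0 _) (ltW (axis_dist_gt0 t))) (ltW L0)).
set S := \sum_i c i ^+ 2 * D i.
have S0 : 0 <= S by apply: sumr_ge0 => i _; rewrite mulr_ge0 ?sqr_ge0.
(* If the denominator is [0], the quotient is [0] by convention, and [lam] is nonnegative. *)
have [->|Sn0] := eqVneq S 0; first by rewrite invr0 mulr0.
rewrite ler_pdivrMr ?lt_neqAle 1?eq_sym ?Sn0//= mulr_sumr.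
by apply: ler_sum => i _; rewrite mulrCA ler_wpM2l ?sqr_ge0.
Qed.

End meridian_rayleigh.

Section cells.
Variables (R : realType) (good : pred nat) (n : nat -> nat) (N : nat).

(** The pair [(i, l)] stands for the [l]-th of the [n i] equal parts of [[h * i, h * i.+1]], with
    [l] counted from [0]; only the intervals selected by [good] are subdivided. *)
Definition cells : seq (nat * nat) :=
  [seq (i, l) | i <- [seq i <- iota 0 N | good i], l <- iota 0 (n i)].

Lemma size_cells : size cells = (\sum_(i < N | good i) n i)%N.
Proof.
rewrite size_allpairs_dep sumnE big_map big_filter.
rewrite -(big_mkord good n) /index_iota subn0.
by apply: eq_bigr => i _; rewrite size_iota.
Qed.

Lemma uniq_cells : uniq cells.
Proof.
apply: allpairs_uniq_dep; first by rewrite filter_uniq ?iota_uniq.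
  by move=> i _; exact: iota_uniq.
by move=> [i l] [i' l'] _ _ /= [-> ->].
Qed.

Lemma mem_cells x : (x \in cells) = [&& (x.1 < N)%N, good x.1 & (x.2 < n x.1)%N].
Proof.
case: x => i l; apply/allpairsPdep/and3P => /=.
  by move=> [i' [l' [+ + [-> ->]]]]; rewrite mem_filter !mem_iota => /andP[? ?].
move=> [iN gi li]; exists i, l; split => //; last by rewrite mem_iota.
by rewrite mem_filter gi mem_iota.
Qed.

Variable h : R.
Hypothesis h0 : 0 < h.

Definition cell_left (x : nat * nat) : R := h * (x.1%:R + x.2%:R / (n x.1)%:R).
Definition cell_right (x : nat * nat) : R := h * (x.1%:R + x.2.+1%:R / (n x.1)%:R).

Lemma cell_width x : cell_right x - cell_left x = h / (n x.1)%:R.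
Proof. by rewrite /cell_left /cell_right -natr1; ring. Qed.

Lemma cell_lt x : (x.2 < n x.1)%N -> cell_left x < cell_right x.
Proof.
move=> xn; rewrite -subr_gt0 cell_width divr_gt0// ltr0n.
exact: leq_ltn_trans xn.
Qed.

Lemma cell_left_ge x : h * x.1%:R <= cell_left x.
Proof. by rewrite /cell_left ler_pM2l// lerDl divr_ge0. Qed.

Lemma cell_right_le x : (x.2 < n x.1)%N -> cell_right x <= h * x.1.+1%:R.
Proof.
move=> xn; rewrite /cell_right ler_pM2l// -[x.1.+1%:R]natr1 lerD2l ler_pdivrMr ?mul1r ?ler_nat//.
by rewrite ltr0n; exact: leq_ltn_trans xn.
Qed.

Lemma cells_disjoint x y : (x.2 < n x.1)%N -> (y.2 < n y.1)%N -> x != y ->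
  (cell_right x <= cell_left y) || (cell_right y <= cell_left x).
Proof.
move=> xn yn xy.
wlog : x y xn yn xy / (x.1 < y.1)%N || ((x.1 == y.1) && (x.2 < y.2)%N).
  move=> H; case: (ltngtP x.1 y.1) => [xy1|yx1|xy1].
  - by apply: H => //; rewrite xy1.
  - by rewrite orbC; apply: H => //; rewrite 1?eq_sym// yx1.
  - case: (ltngtP x.2 y.2) => xy2.
    + by apply: H => //; rewrite xy1 eqxx xy2 orbT.
    + by rewrite orbC; apply: H => //; rewrite 1?eq_sym// xy1 eqxx xy2 orbT.
    + by move: xy; rewrite [x]surjective_pairing [y]surjective_pairing xy1 xy2 eqxx.
move=> /orP[lt1|/andP[/eqP e1 lt2]]; apply/orP; left.
  rewrite (le_trans (cell_right_le xn))// (le_trans _ (cell_left_ge y))//.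
  by rewrite ler_pM2l// ler_nat.
rewrite /cell_right /cell_left e1 ler_pM2l// lerD2l ler_wpM2r ?invr_ge0//.
by rewrite ler_nat.
Qed.

End cells.

(** * Weyl upper bound, uniform over the meridians *)

Section weyl_curve_upper.
Variable R : realType.
Notation mu := (@lebesgue_measure R).
Implicit Types (p q : R * R) (a : R -> R * R) (L eps eta lam : R).

Lemma double_sum_exchange (K N : nat) (P : pred nat) (T : nat -> nat -> nat) :
  ((\sum_(k < K) \sum_(i < N | P i) T k i).*2 =
   \sum_(i < N | P i) (\sum_(k < K) T k i).*2)%N.
Proof.
rewrite exchange_big/= -mul2n big_distrr/=.
by apply: eq_bigr => i _; rewrite mul2n.
Qed.

(** On a retained band the distance to the axis lies between [m i] and [m i + 2 * l], which is at
    most [(1 + eps) * m i]. Evaluating the frequencies at [lam / (1 + eps)] pays for this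
    oscillation: [n k i] half waves then fit into the band with Rayleigh quotient at most [lam]. *)
Lemma lambda_le_of_partition p q a L (N K j : nat) eps eta lam :
  meridian_of_speed p q a L -> 0 < L -> (0 < N)%N -> 0 < eps -> 0 < eta -> 0 < lam ->
  2 * (L / N%:R) <= eps * eta ->
  let m i := axis_dist a (N%:R^-1 * i%:R) - L / N%:R in
  let n k i := Num.truncn (L / N%:R / pi * radial_freq (lam / (1 + eps)) (m i) k) in
  (j <= \sum_(i < N | (eta <= m i)%R) n 0%N i +
    (\sum_(k < K) \sum_(i < N | (eta <= m i)%R) n k.+1 i).*2)%N ->
  (lambda a j <= lam%:E)%E.
Proof.
move=> aL L0 N0 eps0 eta0 lam0 lN m n jn.
have NR : 0 < N%:R :> R by rewrite ltr0n.
have hN0 : 0 < N%:R^-1 :> R by rewrite invr_gt0.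
set l := L / N%:R in lN m n jn.
have l0 : 0 < l by rewrite divr_gt0.
pose good i := eta <= m i.
apply: (@jth_smallest_le R (fun k => \sum_(i < N | good i) n k i)%N K) => //.
move=> k i c kK /andP[i0 ink] /=.
pose s := cells good (n k) N.
have szs : size s = (\sum_(i < N | good i) n k i)%N by exact: size_cells.
pose x (o : 'I_i) := nth (0, 0)%N s o.
have xs o : x o \in s by rewrite mem_nth// szs (leq_trans (ltn_ord o)).
have xP o : [/\ (x (o : 'I_i)).1 < N, good (x o).1 & (x o).2 < n k (x o).1]%N.
  by have := xs o; rewrite mem_cells => /and3P.
have xI o o' : o != o' -> x (o : 'I_i) != x o'.
  apply: contra; rewrite nth_uniq ?uniq_cells// ?szs ?(leq_trans (ltn_ord _))//.
apply: (@lambda_mode_le R p q a L aL k i lam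
  (fun o => cell_left (n k) N%:R^-1 (x o)) (fun o => cell_right (n k) N%:R^-1 (x o))) => //.
- exact: ltW.
- move=> o; have [xN _ xn] := xP o; split.
  + by rewrite (le_trans _ (cell_left_ge _ hN0 _))// mulr_ge0// ltW.
  + exact: cell_lt.
  + by rewrite (le_trans (cell_right_le hN0 xn))// ler_pdivrMl// mulr1 ler_nat.
- move=> o o' oo; have [_ _ xn] := xP o; have [_ _ xn'] := xP o'.
  by apply: cells_disjoint => //; exact: xI.
- move=> o; have [xN gx xn] := xP o; set y := x o in xN gx xn *.
  have m0 : 0 < m y.1 by rewrite (lt_le_trans eta0).
  exists (m y.1), (m y.1 + 2 * l); split => //.
    move=> t /andP[ut tv].
    have h1 : `|axis_dist a t - axis_dist a (N%:R^-1 * y.1%:R)| <= l.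
      rewrite (le_trans (axis_dist_lipschitz aL _ _))// ler_pM2l//.
      have t1 := le_trans (cell_left_ge _ hN0 y) ut.
      have t2 := le_trans tv (cell_right_le hN0 xn).
      rewrite ger0_norm ?subr_ge0// lerBlDr (le_trans t2)// -natr1 mulrDr mulr1 addrC.
      by [].
    by move: h1; rewrite ler_norml /m => /andP[]; lra.
  rewrite cell_width.
  set r := radial_freq (lam / (1 + eps)) (m y.1) k.
  have nle : (n k y.1)%:R <= l / pi * r.
    by rewrite truncn_le mulr_ge0 ?sqrtr_ge0// divr_ge0 ?pi_ge0 ?ltW.
  have n0 : 0 < (n k y.1)%:R :> R by rewrite ltr0n (leq_ltn_trans _ xn).
  (* The band contains a cell, so [n k y.1] is positive and the square root in [r] is not truncated
     to [0]. *)
  have r0 : 0 < r.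
    by move: (lt_le_trans n0 nle); rewrite pmulr_rgt0// divr_gt0 ?pi_gt0.
  have e1 : 0 < 1 + eps by lra.
  have r2 : r ^+ 2 = lam / (1 + eps) - k%:R ^+ 2 / m y.1 ^+ 2.
    by rewrite sqr_sqrtr// ltW// -sqrtr_gt0.
  have M1 : m y.1 + 2 * l <= (1 + eps) * m y.1.
    by have : eps * eta <= eps * m y.1; [rewrite ler_pM2l|move: lN; lra].
  have pin : pi / (N%:R^-1 / (n k y.1)%:R) <= L * r.
    move: nle; rewrite /l; move: (pi : R) (pi_gt0 R) => pp pp0 nle.
    rewrite (_ : pp / _ = (n k y.1)%:R * (N%:R * pp)); last first.
      by field; rewrite !gt_eqF.
    rewrite -ler_pdivlMr ?mulr_gt0// (le_trans nle)// le_eqVlt.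
    by apply/orP; left; apply/eqP; field; rewrite !gt_eqF.
  have pin2 : (pi / (N%:R^-1 / (n k y.1)%:R)) ^+ 2 <= (L * r) ^+ 2.
    rewrite ler_sqr ?nnegrE// ?mulr_ge0 ?(ltW L0) ?(ltW r0)//.
    exact: pi_ge0.
  have Mp : 0 <= m y.1 + 2 * l by lra.
  apply: le_trans (_ : (L * r) ^+ 2 * ((1 + eps) * m y.1) / L +
      k%:R ^+ 2 * L / m y.1 <= _).
    rewrite lerD2r ler_pM2r ?invr_gt0//; apply: ler_pM => //; exact: sqr_ge0.
  (* What remains of the factor [1 + eps] is the nonnegative term [eps * k%:R ^+ 2 * L / mm]. *)
  rewrite exprMn r2 -subr_ge0; move: (m y.1) m0 => mm mm0.
  have -> : lam * mm * L - (L ^+ 2 * (lam / (1 + eps) - k%:R ^+ 2 / mm ^+ 2) *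
      ((1 + eps) * mm) / L + k%:R ^+ 2 * L / mm) = eps * k%:R ^+ 2 * L / mm.
    by field; rewrite !gt_eqF.
  exact: divr_ge0 (mulr_ge0 (mulr_ge0 (ltW eps0) (sqr_ge0 _)) (ltW L0)) (ltW mm0).
Qed.

(** The curve is quantified after [lam0]. The lower bound [eps * eta / 4] on the band length is what
    keeps the truncation errors small relative to the count, uniformly in the curve; the mode
    [k = 0] is dropped. *)
Lemma weyl_curve_upper eps eta : 0 < eps < 1 -> 0 < eta ->
  exists2 lam0, 0 < lam0 & forall lam p q a L (N j : nat), lam0 <= lam ->
    meridian_of_speed p q a L -> 0 < L -> (0 < N)%N ->
    2 * (L / N%:R) <= eps * eta -> eps * eta / 4 <= L / N%:R ->
    let m i := axis_dist a (N%:R^-1 * i%:R) - L / N%:R in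
    j%:R <= (1 - eps) * weyl_density R * (lam / (1 + eps)) *
      \sum_(i < N | eta <= m i) (L / N%:R * m i) ->
    (lambda a j <= lam%:E)%E.
Proof.
move=> /andP[eps0 eps1] eta0.
have l00 : 0 < eps * eta / 4 by rewrite divr_gt0 ?mulr_gt0.
have [lam1 lam10 H] := truncn_mode_count_ge eps0 eta0 l00.
have e1 : 0 < 1 + eps by lra.
exists (lam1 * (1 + eps)); first exact: mulr_gt0.
move=> lam p q a L N j lamlam aL L0 N0 lN Nl m jm.
have lam0 : 0 < lam by rewrite (lt_le_trans _ lamlam)// mulr_gt0.
have [M M0 aM] := axis_dist_max aL.
set lam' := lam / (1 + eps) in jm.
have lam'1 : lam1 <= lam' by rewrite ler_pdivlMr.
(* This cutoff, beyond all angular modes with a positive frequency, depends on the curve, whereas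
   the threshold [lam1] is valid for every such cutoff. *)
pose K := Num.truncn (M * Num.sqrt lam').
apply: (@lambda_le_of_partition p q a L N K j eps eta) => //.
rewrite -(ler_nat R) (le_trans jm)//.
rewrite natrD ler_wpDl//.
rewrite (double_sum_exchange K N (fun i => eta <= m i) (fun k i =>
  Num.truncn (L / N%:R / pi * radial_freq lam' (m i) k.+1))).
rewrite natr_sum mulr_sumr; apply: ler_sum => i mi.
apply: (H lam' (L / N%:R) (m i) K) => //.
apply: le_trans (_ : M * Num.sqrt lam' <= _); last exact/ltW/truncnS_gt.
rewrite ler_wpM2r ?sqrtr_ge0// (le_trans _ (aM (N%:R^-1 * i%:R)))// gerBl.
by rewrite divr_ge0// ltW.
Qed.

End weyl_curve_upper.

(** * Eigenvalues of a curve: lower bound *)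

Ltac nonneg := repeat first [ by [] | exact: ltW | exact: sqr_ge0
  | rewrite invr_ge0 | apply: addr_ge0 | apply: mulr_ge0 | apply: exprn_ge0 ].

Section wirtinger.
Variable R : realType.
Notation mu := (@lebesgue_measure R).
Implicit Types (u v s t c d : R).

Lemma is_derive_cot_affine c d t : sin (c * t + d) != 0 ->
  is_derive t 1 (fun t => cos (c * t + d) / sin (c * t + d))
    (- (c / sin (c * t + d) ^+ 2)).
Proof.
move=> s0.
have ds : is_derive t 1 (fun t => sin (c * t + d)) (c * cos (c * t + d)).
  by apply: is_derive_eq; rewrite /GRing.scale/=; ring.
have dc : is_derive t 1 (fun t => cos (c * t + d)) (- (c * sin (c * t + d))).
  by apply: is_derive_eq; rewrite /GRing.scale/=; ring.
have di := is_deriveV s0 ds.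
have h := cos2Dsin2 (c * t + d).
suff -> : - (c / sin (c * t + d) ^+ 2) =
    cos (c * t + d) *: (- sin (c * t + d) ^- 2 *: (c * cos (c * t + d))) +
    (sin (c * t + d))^-1 *: (- (c * sin (c * t + d))) by exact: is_deriveM dc di.
rewrite /GRing.scale/=.
set x := sin _ in s0 h *; set y := cos _ in h *.
rewrite (_ : - (c / x ^+ 2) = - (c * (y ^+ 2 + x ^+ 2) / x ^+ 2)); last by rewrite h mulr1.
by field.
Qed.

(* Wirtinger's inequality, from [(g - c w cot)^2 >= 0] integrated against the
   exact derivative of [c w^2 cot]; the phase of the cotangent is shifted away
   from its poles, which is possible because [c] is not the optimal constant. *)
Lemma wirtinger (w g : R -> R) (Mw c u v : R) :
  u < v -> 0 < c -> c * (v - u) < pi ->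
  (forall s t, `|w s - w t| <= Mw * `|s - t|) -> bounded_measurable g ->
  {ae mu, forall t : R, u < t < v -> is_derive t 1 w (g t)} ->
  w u = 0 -> w v = 0 ->
  c ^+ 2 * \int[mu]_(t in `[u, v]) (w t ^+ 2) <= \int[mu]_(t in `[u, v]) (g t ^+ 2).
Proof.
move=> uv c0 cpi wM bg dw wu wv.
have Mw0 : 0 <= Mw.
  by have := wM 1 0; rewrite subr0 normr1 mulr1; apply: le_trans.
have vu0 : 0 < v - u by rewrite subr_gt0.
(* This phase centres the image of [[u, v]] under [c * t + d] at [pi / 2]; having length less than
   [pi], the image stays inside []0, pi[]. *)
pose d := (pi - c * (v - u)) / 2 - c * u.
have thP t : u <= t <= v -> 0 < c * t + d < pi.
  move=> /andP[ut tv].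
  have h1 : c * u <= c * t by rewrite ler_pM2l.
  have h2 : c * t <= c * v by rewrite ler_pM2l.
  by move: cpi; rewrite /d mulrBr; move: (pi : R) => pp; lra.
have sin0 t : u <= t <= v -> 0 < sin (c * t + d) by move=> /thP; exact: sin_gt0_pi.
have [x xuv xmin] : exists2 x, x \in `[u, v] & forall t, t \in `[u, v] ->
    sin (c * x + d) <= sin (c * t + d).
  apply: (@EVT_min R (fun t => sin (c * t + d)) u v (ltW uv)).
  apply: continuous_subspaceT => t; apply: continuous_comp; last exact: continuous_sin.
  by apply: cvgD; [apply: cvgM; [exact: cvg_cst|exact: cvg_id]|exact: cvg_cst].
set s0 := sin (c * x + d) in xmin.
have s00 : 0 < s0 by apply: sin0; move: xuv; rewrite in_itv.
have s0min t : u <= t <= v -> s0 <= sin (c * t + d).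
  by move=> utv; apply: xmin; rewrite in_itv.
pose phi t := cos (c * t + d) / sin (c * t + d).
have phi_lip s t : u <= s <= v -> u <= t <= v ->
    `|phi s - phi t| <= c / s0 ^+ 2 * `|s - t|.
  move=> suv tuv.
  have -> : phi s - phi t =
      sin ((c * t + d) - (c * s + d)) / (sin (c * s + d) * sin (c * t + d)).
    by rewrite sinB /phi; field; rewrite !gt_eqF ?sin0.
  rewrite normrM (ger0_norm (_ : 0 <= _^-1)); last first.
    by rewrite invr_ge0 mulr_ge0 ?ltW ?sin0.
  have h1 : `|sin ((c * t + d) - (c * s + d))| <= c * `|s - t|.
    have := sin_lipschitz ((c * t + d) - (c * s + d)) 0.
    rewrite trigo.sin0 !subr0 => /le_trans; apply.
    rewrite (_ : _ - _ = c * (t - s)); last by ring.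
    by rewrite normrM gtr0_norm// distrC.
  rewrite mulrAC; apply: ler_pM => //; first by rewrite invr_ge0 mulr_ge0 ?ltW ?sin0.
  rewrite lef_pV2 ?posrE ?exprn_gt0 ?mulr_gt0 ?sin0// expr2.
  by apply: ler_pM; rewrite ?(ltW s00) ?s0min.
have phi_bd s : u <= s <= v -> `|phi s| <= s0^-1.
  move=> suv; rewrite normrM normfV (gtr0_norm (sin0 _ suv)) -[leRHS]mul1r.
  apply: ler_pM => //; first by rewrite invr_ge0 ltW ?sin0.
    by rewrite ler_norml cos_geN1 cos_le1.
  by rewrite lef_pV2 ?posrE ?sin0// s0min.
pose B := Mw * (v - u).
have wB s : u <= s <= v -> `|w s| <= B.
  move=> /andP[us sv]; have := wM s u; rewrite wu subr0 => /le_trans; apply.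
  by rewrite ler_wpM2l// ger0_norm ?subr_ge0// lerD2r.
(* Retraction onto [[u, v]]. It keeps the cotangent away from its poles and makes [f] Lipschitz on
   the whole line, so that [f] has an integrable derivative. *)
pose cl t := u + (v - u) * clamp01 ((t - u) / (v - u)).
have cl_itv t : u <= cl t <= v.
  have /andP[h0 h1] := clamp01_itv ((t - u) / (v - u)); rewrite /cl.
  by rewrite lerDl mulr_ge0 ?(ltW vu0)//= -lerBrDl -[leRHS]mulr1 ler_pM2l.
have cl_lip s t : `|cl s - cl t| <= `|s - t|.
  rewrite /cl opprD addrACA subrr add0r -mulrBr normrM (gtr0_norm vu0).
  rewrite -ler_pdivlMl// (le_trans (clamp01_lipschitz _ _))// -mulrBl opprB addrA subrK.
  by rewrite normrM mulrC (gtr0_norm (_ : 0 < (v - u)^-1)) ?invr_gt0.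
have cl_id t : u <= t <= v -> cl t = t.
  by move=> utv; rewrite /cl clamp01_id ?unit_itvP// mulrCA mulfV ?mulr1 ?gt_eqF// addrC subrK.
pose f t := w (cl t) ^+ 2 * (c * phi (cl t)).
pose Mf := 2 * B * Mw * (c / s0) + B ^+ 2 * (c * (c / s0 ^+ 2)).
have B0 : 0 <= B by rewrite mulr_ge0// ltW.
have Mf0 : 0 <= Mf.
  by nonneg.
have f_lip s t : `|f s - f t| <= (Mf + 1) * `|s - t|.
  apply: (@le_trans _ _ (Mf * `|s - t|)); last by rewrite ler_wpM2r// lerDl.
  apply: (@le_trans _ _ (Mf * `|cl s - cl t|)); last by rewrite ler_wpM2l.
  rewrite /f; move: (cl s) (cl t) (cl_itv s) (cl_itv t) => {}s {}t suv tuv.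
  have -> : w s ^+ 2 * (c * phi s) - w t ^+ 2 * (c * phi t) =
    (w s + w t) * (w s - w t) * (c * phi s) + w t ^+ 2 * (c * (phi s - phi t)) by ring.
  rewrite (le_trans (ler_normD _ _))// /Mf [leRHS]mulrDl; apply: lerD.
    rewrite normrM (normrM (w s + w t)) (normrM c) (gtr0_norm c0).
    rewrite [leRHS](_ : _ = (2 * B) * (Mw * `|s - t|) * (c * s0^-1)); last by ring.
    apply: ler_pM; rewrite ?mulr_ge0 ?(ltW c0)//.
      apply: ler_pM => //; rewrite (le_trans (ler_normD _ _))// mulrDl !mul1r.
      by apply: lerD; exact: wB.
    by rewrite ler_pM2l// phi_bd.
  rewrite normrM (normrM c) (gtr0_norm c0) normrX.
  rewrite [leRHS](_ : _ = B ^+ 2 * (c * (c / s0 ^+ 2 * `|s - t|))); last by ring.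
  apply: ler_pM; rewrite ?mulr_ge0 ?(ltW c0) ?sqr_ge0//.
    by rewrite ler_sqr ?nnegrE// wB.
  by rewrite ler_pM2l// phi_lip.
have [h [mh hM dh ih]] := lipschitz_ae_derive uv (ltr_wpDl Mf0 ltr01) f_lip.
have bh : bounded_measurable h by split => //; exists (Mf + 1).
have bw : bounded_measurable (w \o cl).
  apply: (@bounded_measurable_continuous _ _ B) => [|t]; last exact: wB.
  apply: (@lipschitz_right_continuous _ _ Mw) => s t /=.
  by rewrite (le_trans (wM _ _))// ler_wpM2l.
have -> : \int[mu]_(t in `[u, v]) (w t ^+ 2) =
    \int[mu]_(t in `[u, v]) ((w \o cl) t ^+ 2).
  by apply: eq_Rintegral => t; rewrite inE/= in_itv/= => utv; rewrite cl_id.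
rewrite -RintegralZ_itv; last exact: bounded_measurableX.
rewrite -subr_ge0 -RintegralB_itv; [|exact: bounded_measurableX|];
  last by apply: bounded_measurableZ; exact: bounded_measurableX.
have hfuv : \int[mu]_(t in `[u, v]) h t = 0.
  rewrite ih ?lexx ?(ltW uv)// /f !cl_id ?lexx ?(ltW uv)// wu wv expr0n/=.
  by rewrite !mul0r subrr.
rewrite -hfuv; apply: ae_le_Rintegral_itv => //.
  apply: bounded_measurableB; first exact: bounded_measurableX.
  by apply: bounded_measurableZ; exact: bounded_measurableX.
have := ae_lebesgueI (ae_lebesgueI (ae_lebesgue_neq u) (ae_lebesgue_neq v))
  (ae_lebesgueI dw dh).
apply: ae_lebesgueS => t [[tu tv] [Hw Hh]] utv.
have utv' : u < t < v by rewrite !lt_neqAle eq_sym tu tv.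
have Dw := Hw utv'; have Df := Hh utv'.
have st := sin0 _ utv.
have Dphi := is_derive_cot_affine (lt0r_neq0 st).
have Df' : is_derive t 1 f (2 * w t * g t * (c * phi t) -
    w t ^+ 2 * (c * (c / sin (c * t + d) ^+ 2))).
  apply: (@near_eq_is_derive _ _ _ (fun t => w t ^+ 2 *
    (c * (cos (c * t + d) / sin (c * t + d))))).
    case/andP: utv' => ut' tv'; near=> s; rewrite /f cl_id//.
    by apply/andP; split; apply/ltW; near: s; [exact: lt_nbhsr|exact: lt_nbhsl].
  by apply: is_derive_eq; rewrite /GRing.scale/= /phi; ring.
have -> : h t = 2 * w t * g t * (c * phi t) -
    w t ^+ 2 * (c * (c / sin (c * t + d) ^+ 2)).
  by rewrite -(@derive_val _ _ _ _ _ _ _ Df) -(@derive_val _ _ _ _ _ _ _ Df').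
rewrite /= cl_id// -subr_ge0.
have hcs := cos2Dsin2 (c * t + d).
rewrite (_ : _ - _ = (g t - w t * (c * phi t)) ^+ 2); first exact: sqr_ge0.
rewrite /phi; move: hcs st; move: (sin _) (cos _) => x1 y1 hcs st.
rewrite (_ : w t ^+ 2 * (c * (c / x1 ^+ 2)) =
  w t ^+ 2 * (c * (c * (y1 ^+ 2 + x1 ^+ 2) / x1 ^+ 2))); last by rewrite hcs mulr1.
by field; rewrite gt_eqF.
Unshelve. all: end_near. Qed.

End wirtinger.

(** * Rayleigh quotients of functions with prescribed zeros *)

Section rayleigh_lower_bound.
Variable R : realType.
Notation mu := (@lebesgue_measure R).
Implicit Types (w g : R -> R) (u v s t c : R).

Lemma Lip0_lipschitz w : @Lip0 R w ->
  exists2 M, 0 < M & forall s t, `|w s - w t| <= M * `|s - t|.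
Proof.
move=> [/lipschitz01P[M M0 wM] w0]; exists M => // s t.
suff wc x : w x = w (clamp01 x) by rewrite wc (wc t) (lipschitz_clamp01 M0 wM).
have [x01|x01] := boolP (x \in `]0, 1[).
  by move: x01; rewrite in_itv/= => /andP[x0 x1]; rewrite clamp01_id// !ltW.
rewrite w0//; apply/esym/w0; apply: contra x01; rewrite !in_itv/= /clamp01.
by rewrite /Num.max /Num.min; do 2 case: ifP; rewrite ?ltxx//; move=> *; lra.
Qed.

Lemma Lip0_bounded w : @Lip0 R w -> bounded_measurable w.
Proof.
move=> w0; have [M M0 wM] := Lip0_lipschitz w0.
have -> : w = w \o @clamp01 R.
  apply/funext => x /=; case: w0 => _ w0.
  have [x01|x01] := boolP (x \in `]0, 1[).
    by move: x01; rewrite in_itv/= => /andP[x0 x1]; rewrite clamp01_id// !ltW.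
  rewrite w0//; apply/esym/w0; apply: contra x01; rewrite !in_itv/= /clamp01.
  by rewrite /Num.max /Num.min; do 2 case: ifP; rewrite ?ltxx//; move=> *; lra.
by apply: (bounded_measurable_clamp01 M0) => s t _ _; exact: wM.
Qed.

Lemma Lip0_derivative w : @Lip0 R w -> exists g, bounded_measurable g /\
  {ae mu, forall t : R, 0 < t < 1 -> is_derive t 1 w (g t)}.
Proof.
move=> w0; have [M M0 wM] := Lip0_lipschitz w0.
have [g [bg dg _]] := lipschitz01_derivative M0 (fun s t _ _ => wM s t).
by exists g.
Qed.

(** Fewer linear conditions than unknowns: the matrix of values has a nonzero left kernel. *)
Lemma exists_vanishing_combination n (e : 'I_n -> R -> R) (pts : seq R) :
  (size pts < n)%N -> lin_indep e ->
  exists2 c : 'I_n -> R, \sum_i c i *: e i != 0 &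
    forall x, x \in pts -> (\sum_i c i *: e i) x = 0.
Proof.
move=> sn ei.
pose A := \matrix_(i < n, j < size pts) e i (nth 0 pts j).
have : kermx A != 0.
  rewrite kermx_eq0; apply/negP => rf.
  by have := rank_leq_col A; rewrite (eqP rf) leqNgt sn.
rewrite -nz_row_eq0 => v0; set v := nz_row (kermx A) in v0.
have vA : v *m A = 0 by apply/sub_kermxP; exact: nz_row_sub.
exists (fun i => v 0 i).
  apply: contra v0 => /eqP /ei vi; apply/eqP/rowP => i; by rewrite vi mxE.
move=> x /(nthP 0)[j js <-].
have := congr1 (fun B : 'rV_(size pts) => B 0 (Ordinal js)) vA.
rewrite [LHS]mxE [RHS]mxE => H; rewrite fct_sumE -[RHS]H.
by apply: eq_bigr => i _; rewrite mxE.
Qed.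

(** Every [n]-dimensional trial space contains a nonzero function vanishing at the fewer than [n]
    points of [pts]; its quotient bounds the maximum over the space from below. *)
Lemma lambda_mode_ge (a : R -> R * R) (k n : nat) (pts : seq R) (lam : R) :
  (size pts < n)%N ->
  (forall w, @Lip0 R w -> w != 0 -> (forall x, x \in pts -> w x = 0) ->
    lam <= rayleigh a k w) ->
  (lam%:E <= lambda_mode a k n)%E.
Proof.
move=> sn H; apply: le_ereal_inf_tmp => _ [W [[e [ei ->]] Wlip] <-].
have [c c0 cpts] := exists_vanishing_combination sn ei.
apply: (@le_trans _ _ (rayleigh a k (\sum_i c i *: e i))%:E).
  by rewrite lee_fin; apply: H => //; apply: Wlip; exists c.
apply: ereal_sup_ubound; exists (\sum_i c i *: e i) => //; split; first by exists c.
by apply/eqP.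
Qed.

Variables (p q : R * R) (a : R -> R * R) (L : R).
Hypotheses (aL : meridian_of_speed p q a L) (L0 : 0 < L).

Let F := axis_dist a.

Lemma rayleigh_denominator_gt0 w : @Lip0 R w -> w != 0 ->
  0 < \int[mu]_(t in `[0, 1]) (w t ^+ 2 * F t * L).
Proof.
move=> w0 wn0; have [M M0 wM] := Lip0_lipschitz w0.
have [t wt] : exists t, w t != 0.
  apply: contrapT => H; move/eqP: wn0; apply; apply/funext => t.
  by apply: contrapT => /eqP wt; apply: H; exists t.
have t01 : 0 < t < 1.
  apply: contraNT wt => t01; case: w0 => _ -> //; by rewrite in_itv.
apply: (@Rintegral_itv_gt0 _ _ _ _ t) => //.
- apply: bounded_measurableM; last exact: bounded_measurable_cst.
  apply: bounded_measurableM; last exact: bounded_measurable_axis_dist aL.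
  exact/bounded_measurableX/Lip0_bounded.
- move=> x; apply: cvgM; last exact: cvg_cst.
  apply: cvgM; last exact: (axis_dist_continuous aL).
  by apply: cvgM; exact: (lipschitz_right_continuous wM).
- by move=> x; have F0 : 0 < F x := axis_dist_gt0 aL x; nonneg.
- apply: mulr_gt0 => //; apply: mulr_gt0; last exact: (axis_dist_gt0 aL).
  by rewrite exprn_even_gt0.
Qed.

(** For [k] this large the angular term of the energy suffices, pointwise. *)
Lemma rayleigh_ge_of_bound (k : nat) lam M w : 0 < lam -> 0 < M ->
  (forall t, F t <= M) -> lam * M ^+ 2 <= k%:R ^+ 2 -> @Lip0 R w -> w != 0 ->
  lam <= rayleigh a k w.
Proof.
move=> lam0 M0 FM kM w0 wn0; have [g [bg dg]] := Lip0_derivative w0.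
rewrite (rayleighE aL k dg) ler_pdivlMr ?rayleigh_denominator_gt0//.
have bF := bounded_measurable_axis_dist aL; have bFi := bounded_measurable_axis_distV aL.
have bw := Lip0_bounded w0.
rewrite -RintegralZ_itv; last first.
  apply: bounded_measurableM; last exact: bounded_measurable_cst.
  by apply: bounded_measurableM => //; exact: bounded_measurableX.
apply: le_Rintegral_itv.
- apply: bounded_measurableZ.
  apply: bounded_measurableM; last exact: bounded_measurable_cst.
  by apply: bounded_measurableM => //; exact: bounded_measurableX.
- apply: bounded_measurableD.
    apply: bounded_measurableM; last exact: bounded_measurable_cst.
    by apply: bounded_measurableM => //; exact: bounded_measurableX.
  apply: bounded_measurableM => //.
  apply: bounded_measurableM; last exact: bounded_measurable_cst.
  by apply: bounded_measurableZ; exact: bounded_measurableX.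
move=> t _; have F0 := axis_dist_gt0 aL t.
apply: ler_wpDl; first by nonneg.
rewrite ler_pdivlMr//.
have -> : lam * (w t ^+ 2 * axis_dist a t * L) * axis_dist a t =
  (w t ^+ 2 * L) * (lam * F t ^+ 2) by rewrite /F; ring.
have -> : k%:R ^+ 2 * w t ^+ 2 * L = (w t ^+ 2 * L) * k%:R ^+ 2 by ring.
apply: ler_wpM2l; first exact: mulr_ge0 (sqr_ge0 _) (ltW L0).
rewrite (le_trans _ kM)// ler_pM2l//.
by rewrite ler_sqr ?nnegrE ?(ltW F0) ?(ltW M0)// FM.
Qed.

(** Wirtinger's inequality on one cell, with the weights replaced by their extreme values [m] and
    [M]. *)
Lemma cell_energy_ge (k : nat) lam m M c u v w g :
  0 <= u -> u < v -> v <= 1 -> 0 < m -> 0 <= c -> c * (v - u) < pi ->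
  (forall t, u <= t <= v -> m <= F t <= M) ->
  lam * M * L <= c ^+ 2 * m / L + k%:R ^+ 2 * L / M ->
  @Lip0 R w -> w u = 0 -> w v = 0 -> bounded_measurable g ->
  {ae mu, forall t : R, 0 < t < 1 -> is_derive t 1 w (g t)} -> 0 <= lam ->
  lam * \int[mu]_(t in `[u, v]) (w t ^+ 2 * F t * L) <=
  \int[mu]_(t in `[u, v]) (g t ^+ 2 * F t / L + k%:R ^+ 2 * w t ^+ 2 * L / F t).
Proof.
move=> u0 uv v1 m0 c0 cpi mFM cond w0 wu wv bg dg lam0.
have bF := bounded_measurable_axis_dist aL; have bFi := bounded_measurable_axis_distV aL.
have bw := Lip0_bounded w0.
have bw2 : bounded_measurable (fun t => w t ^+ 2) by exact: bounded_measurableX.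
have bg2 : bounded_measurable (fun t => g t ^+ 2) by exact: bounded_measurableX.
have M0 : 0 < M.
  by have /andP[h1 h2] := mFM u (introT andP (conj (lexx _) (ltW uv))); rewrite (lt_le_trans m0)// (le_trans h1).
have wirt : c ^+ 2 * \int[mu]_(t in `[u, v]) (w t ^+ 2) <=
    \int[mu]_(t in `[u, v]) (g t ^+ 2).
  (* The value [c = 0] occurs for angular modes without a positive radial frequency; [wirtinger] is
     stated for [c > 0]. *)
  have [->|cn0] := eqVneq c 0.
    by rewrite expr0n mul0r; apply: Rintegral_itv_ge0 => t _; exact: sqr_ge0.
  have [Mw Mw0 wM] := Lip0_lipschitz w0.
  apply: (wirtinger uv _ cpi wM bg) => //; first by rewrite lt_neqAle eq_sym cn0.
  apply: ae_lebesgueS dg => t H /andP[ut tv]; apply: H.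
  by rewrite (le_lt_trans u0)// (lt_le_trans tv).
set I2 := \int[mu]_(t in `[u, v]) (w t ^+ 2) in wirt.
set J2 := \int[mu]_(t in `[u, v]) (g t ^+ 2) in wirt.
have I20 : 0 <= I2 by apply: Rintegral_itv_ge0 => t _; exact: sqr_ge0.
apply: (@le_trans _ _ (lam * (M * L) * I2)).
  rewrite -mulrA ler_wpM2l// -RintegralZ_itv//.
  apply: le_Rintegral_itv => //.
  - apply: bounded_measurableM; last exact: bounded_measurable_cst.
    exact: bounded_measurableM.
  - exact: bounded_measurableZ.
  move=> t /mFM /andP[_ tM]; rewrite -mulrA [leRHS]mulrC ler_wpM2l ?sqr_ge0//.
  by rewrite ler_pM2r.
apply: (@le_trans _ _ (m / L * J2 + k%:R ^+ 2 * L / M * I2)).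
  apply: (@le_trans _ _ ((c ^+ 2 * m / L + k%:R ^+ 2 * L / M) * I2)).
    by rewrite ler_wpM2r// mulrA.
  rewrite mulrDl lerD2r (_ : _ * I2 = m / L * (c ^+ 2 * I2)); last by ring.
  by rewrite ler_wpM2l// divr_ge0// ltW.
rewrite -!RintegralZ_itv// -RintegralD_itv//; [|exact: bounded_measurableZ..].
apply: le_Rintegral_itv => //.
- by apply: bounded_measurableD; exact: bounded_measurableZ.
- apply: bounded_measurableD.
    apply: bounded_measurableM; last exact: bounded_measurable_cst.
    exact: bounded_measurableM.
  apply: bounded_measurableM => //.
  apply: bounded_measurableM; last exact: bounded_measurable_cst.
  exact: bounded_measurableZ.
move=> t tuv; have /andP[mt tM] := mFM t tuv.
have Ft0 : 0 < F t := axis_dist_gt0 aL t.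
apply: lerD.
  rewrite mulrAC ler_pM2r ?invr_gt0// mulrC ler_wpM2l ?sqr_ge0//.
rewrite [leRHS](_ : _ = k%:R ^+ 2 * L / F t * w t ^+ 2); last by ring.
rewrite ler_wpM2r ?sqr_ge0// ler_wpM2l ?mulr_ge0 ?sqr_ge0 ?(ltW L0)//.
by rewrite lef_pV2 ?posrE.
Qed.

End rayleigh_lower_bound.

(** * Weyl lower bound for a fixed curve *)

Section weyl_curve_lower.
Variable R : realType.
Notation mu := (@lebesgue_measure R).
Variables (p q : R * R) (a : R -> R * R) (L : R).
Hypotheses (aL : meridian_of_speed p q a L) (L0 : 0 < L).

Let F := axis_dist a.

(** True also for negative [x], where the root is [0]; this covers the angular modes with truncated
    frequency. *)
Lemma le_sqr_sqrt (x : R) : x <= Num.sqrt x ^+ 2.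
Proof.
have [x0|/ltW x0] := leP 0 x; first by rewrite sqr_sqrtr.
exact: le_trans (sqr_ge0 _).
Qed.

Section partition.
Variables (N : nat) (eps lam : R).
Hypotheses (N0 : (0 < N)%N) (eps0 : 0 < eps) (lam0 : 0 < lam).
Let l := L / N%:R.
Let t_ (i : nat) : R := N%:R^-1 * i%:R.
Hypothesis l_small : forall i, 2 * l <= eps * (F (t_ i) - l).

Let M i := F (t_ i) + l.
(** The successor makes every cell strictly shorter than a half wave, as Wirtinger's inequality
    demands. The factor [1 + eps] absorbs the ratio of the largest to the smallest radius in the
    band. *)
Let n k i := (Num.truncn (l / pi * ((1 + eps) * radial_freq lam (M i) k))).+1.

Let hN0 : 0 < N%:R^-1 :> R. Proof. by rewrite invr_gt0 ltr0n. Qed.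

Let l0 : 0 < l. Proof. by rewrite divr_gt0// ltr0n. Qed.

Let m_gt0 i : 0 < F (t_ i) - l.
Proof. by rewrite -(pmulr_rgt0 _ eps0) (lt_le_trans _ (l_small i))// mulr_gt0. Qed.

Let M_gt0 i : 0 < M i. Proof. by rewrite /M; have := m_gt0 i; have := l0; lra. Qed.

Let M_le i : M i <= (1 + eps) * (F (t_ i) - l).
Proof. by have := l_small i; rewrite /M; lra. Qed.

Let F_bounds i t : t_ i <= t <= t_ i.+1 -> F (t_ i) - l <= F t <= M i.
Proof.
move=> /andP[it ti].
have : `|F t - F (t_ i)| <= l.
  rewrite (le_trans (axis_dist_lipschitz aL _ _))// ler_pM2l//.
  rewrite ger0_norm ?subr_ge0// lerBlDr (le_trans ti)// /t_ -natr1 mulrDr mulr1.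
  by rewrite addrC.
by rewrite ler_norml /M => /andP[]; lra.
Qed.

(** The prescribed zeros are the right ends of all cells. A left end is the right end of the
    preceding cell or the point [0], so a function with these zeros vanishes at both ends of every
    cell, and the cell estimates add up. *)
Lemma lambda_mode_ge_of_partition k (j : nat) :
  (\sum_(i < N) n k i < j)%N -> (lam%:E <= lambda_mode a k j)%E.
Proof.
move=> nj.
pose pts := [seq cell_right (n k) (N%:R^-1 : R) x | x <- cells predT (n k) N].
apply: (@lambda_mode_ge _ a k j pts).
  by rewrite size_map size_cells.
move=> w w0 wn0 wpts; have [g [bg dg]] := Lip0_derivative w0.
rewrite (rayleighE aL k dg) ler_pdivlMr ?(rayleigh_denominator_gt0 aL)//.
have bF := bounded_measurable_axis_dist aL; have bFi := bounded_measurable_axis_distV aL.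
have bw := Lip0_bounded w0.
have b1 : bounded_measurable (fun t => w t ^+ 2 * F t * L).
  apply: bounded_measurableM; last exact: bounded_measurable_cst.
  by apply: bounded_measurableM => //; exact: bounded_measurableX.
have b2 : bounded_measurable (fun t => g t ^+ 2 * F t / L +
    k%:R ^+ 2 * w t ^+ 2 * L / F t).
  apply: bounded_measurableD.
    apply: bounded_measurableM; last exact: bounded_measurable_cst.
    by apply: bounded_measurableM => //; exact: bounded_measurableX.
  apply: bounded_measurableM => //.
  apply: bounded_measurableM; last exact: bounded_measurable_cst.
  by apply: bounded_measurableZ; exact: bounded_measurableX.
have tS i : t_ i <= t_ i.+1 by rewrite /t_ ler_pM2l// ler_nat.
have tN : t_ N = 1 by rewrite /t_ mulVf// pnatr_eq0 -lt0n.
have t00 : t_ 0 = 0 by rewrite /t_ mulr0.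
have w_end : w 0 = 0 /\ w 1 = 0.
  by case: w0 => _ H; split; apply: H; rewrite in_itv/= ltxx ?andbF.
pose s_ i (r : nat) : R := N%:R^-1 * (i%:R + r%:R / (n k i)%:R).
have nR i : 0 < (n k i)%:R :> R by rewrite ltr0n.
have s0 i : s_ i 0 = t_ i by rewrite /s_ mul0r addr0.
have sn i : s_ i (n k i) = t_ i.+1 by rewrite /s_ /t_ mulfV ?gt_eqF// natr1.
have sS i r : s_ i r <= s_ i r.+1.
  by rewrite /s_ ler_pM2l// lerD2l ler_pM2r ?invr_gt0// ler_nat.
have w_right i r : (i < N)%N -> (r < n k i)%N -> w (s_ i r.+1) = 0.
  move=> iN ri; apply: wpts; apply/mapP; exists (i, r) => //.
  by rewrite mem_cells iN ri.
have w_left i r : (i < N)%N -> (r <= n k i)%N -> w (s_ i r) = 0.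
  case: r => [|r]; last exact: w_right.
  rewrite s0; case: i => [|i] iN _; first by rewrite t00 w_end.1.
  by rewrite -sn; apply: w_right => //; exact: ltnW.
have -> : lam * \int[mu]_(t in `[0, 1]) (w t ^+ 2 * axis_dist a t * L) =
    lam * \int[mu]_(t in `[t_ 0, t_ N]) (w t ^+ 2 * F t * L) by rewrite t00 tN.
rewrite -[X in _ <= \int[mu]_(t in `[X, _]) _]t00 -[X in _ <= \int[mu]_(t in `[_, X]) _]tN.
rewrite (Rintegral_sum_itv N b1 tS) (Rintegral_sum_itv N b2 tS) mulr_sumr.
apply: ler_sum => i _; rewrite -(s0 i) -(sn i).
rewrite (Rintegral_sum_itv _ b1 (sS i)) (Rintegral_sum_itv _ b2 (sS i)) mulr_sumr.
apply: ler_sum => r _.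
have [iN rn] := (ltn_ord i, ltn_ord r).
have t_mono i1 i2 : (i1 <= i2)%N -> t_ i1 <= t_ i2.
  by move=> ?; rewrite /t_ ler_pM2l// ler_nat.
have s_ge : t_ i <= s_ i r by rewrite /s_ /t_ ler_pM2l// lerDl divr_ge0.
have s_le : s_ i r.+1 <= t_ i.+1.
  rewrite /s_ /t_ ler_pM2l// -(natr1 i) lerD2l ler_pdivrMr// mul1r ler_nat//.
set rf := radial_freq lam (M i) k.
have rf0 : 0 <= rf by exact: sqrtr_ge0.
have e1 : 0 < 1 + eps by rewrite addr_gt0.
apply: (@cell_energy_ge R p q a L aL L0 k lam (F (t_ i) - l) (M i) (L * ((1 + eps) * rf))) => //.
- by rewrite (le_trans _ s_ge)// -t00 t_mono.
- by rewrite /s_ ltr_pM2l// ltrD2l ltr_pM2r ?invr_gt0// ltr_nat.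
- by rewrite (le_trans s_le)// -tN t_mono.
- by nonneg.
- rewrite (_ : s_ i r.+1 - s_ i r = N%:R^-1 / (n k i)%:R); last first.
    by rewrite /s_ -natr1; ring.
  have tr : l / pi * ((1 + eps) * rf) < (n k i)%:R by exact: truncnS_gt.
  rewrite (_ : _ * _ = l * ((1 + eps) * rf) / (n k i)%:R); last by rewrite /l; ring.
  rewrite ltr_pdivrMr// [ltRHS]mulrC -ltr_pdivrMr ?pi_gt0//.
  by move: tr; rewrite mulrAC.
- move=> t /andP[st ts]; apply: F_bounds.
  by rewrite (le_trans s_ge st) (le_trans ts s_le).
- have Mi := M_gt0 i; have := le_sqr_sqrt (lam - k%:R ^+ 2 / M i ^+ 2).
  rewrite -/(radial_freq lam (M i) k) -/rf => rf2.
  apply: (@le_trans _ _ (L * M i * (rf ^+ 2 + k%:R ^+ 2 / M i ^+ 2))).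
    rewrite [leLHS](_ : _ = L * M i * lam); last by ring.
    by rewrite ler_pM2l ?mulr_gt0// -lerBlDr.
  rewrite mulrDr; apply: lerD; last first.
    by rewrite le_eqVlt; apply/orP; left; apply/eqP; field; rewrite !gt_eqF.
  rewrite [leRHS](_ : _ = L * rf ^+ 2 * ((1 + eps) * ((1 + eps) * (F (t_ i) - l)))); last first.
    by field; rewrite gt_eqF.
  rewrite mulrAC; apply: ler_wpM2l; first by nonneg.
  apply: (le_trans (M_le i)); rewrite ler_peMl//; first by rewrite mulr_ge0// ltW.
  by rewrite lerDl ltW.
- by apply: w_left => //; exact: ltnW.
- exact: w_right.
- exact: ltW.
Qed.

Lemma sum_partition_le : \sum_(i < N) l * M i <=
  (1 + eps) * (L * \int[mu]_(t in `[0, 1]) F t).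
Proof.
have bF := bounded_measurable_axis_dist aL.
have tS i : t_ i <= t_ i.+1 by rewrite /t_ ler_pM2l// ler_nat.
have tN : t_ N = 1 by rewrite /t_ mulVf// pnatr_eq0 -lt0n.
have t00 : t_ 0 = 0 by rewrite /t_ mulr0.
rewrite -[X in \int[mu]_(t in `[X, _]) _]t00 -[X in \int[mu]_(t in `[_, X]) _]tN.
rewrite (Rintegral_sum_itv N bF tS) !mulr_sumr; apply: ler_sum => i _.
apply: (@le_trans _ _ ((1 + eps) * (L * ((F (t_ i) - l) * (t_ i.+1 - t_ i))))).
  rewrite (_ : t_ i.+1 - t_ i = N%:R^-1); last by rewrite /t_ -natr1; ring.
  rewrite [leRHS](_ : _ = l * ((1 + eps) * (F (t_ i) - l))); last by rewrite /l; ring.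
  by rewrite ler_pM2l.
rewrite ler_pM2l ?addr_gt0// ler_pM2l// -Rintegral_cst_itv//.
apply: le_Rintegral_itv => //; first exact: bounded_measurable_cst.
by move=> t /F_bounds/andP[].
Qed.

(** The error terms are the mode [k = 0], of order [Num.sqrt lam], and one unit for each successor
    in [n]. With [K] of order [Num.sqrt lam] and [N] fixed, all of it is of lower order than the
    main term. *)
Lemma mode_count_le (K : nat) :
  (\sum_(i < N) n 0 i + (\sum_(k < K) \sum_(i < N) n k.+1 i).*2)%:R <=
  weyl_density R * lam * ((1 + eps) * \sum_(i < N) l * M i) +
  (L / pi * ((1 + eps) * Num.sqrt lam) + N%:R * (1 + 2 * K%:R)).
Proof.
have lpi : 0 <= l / pi by rewrite divr_ge0 ?pi_ge0 ?(ltW l0).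
have nle k i : (n k i)%:R <= l / pi * ((1 + eps) * radial_freq lam (M i) k) + 1.
  rewrite /n -natr1 lerD2r truncn_le mulr_ge0// mulr_ge0 ?sqrtr_ge0//.
  by rewrite addr_ge0 ?ltW.
have h0 : (\sum_(i < N) n 0 i)%:R <= L / pi * ((1 + eps) * Num.sqrt lam) + N%:R.
  rewrite natr_sum; apply: (@le_trans _ _
      (\sum_(i < N) (l / pi * ((1 + eps) * Num.sqrt lam) + 1))).
    apply: ler_sum => i _; apply: (le_trans (nle _ _)).
    by rewrite lerD2r /radial_freq expr0n mul0r subr0.
  rewrite big_split/= !sumr_const card_ord lerD2r -[leLHS]mulr_natl mulrA.
  by rewrite (_ : N%:R * (l / pi) = L / pi)// /l mulrA mulrCA mulfV ?mulr1// pnatr_eq0 -lt0n.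
have hk : (\sum_(k < K) \sum_(i < N) n k.+1 i)%:R <=
    l / pi * ((1 + eps) * (\sum_(i < N) M i * lam * quarter_disc R)) + N%:R * K%:R.
  rewrite exchange_big natr_sum.
  apply: (@le_trans _ _ (\sum_(i < N) (l / pi * ((1 + eps) * (M i * lam * quarter_disc R)) + K%:R))).
    apply: ler_sum => i _; rewrite natr_sum.
    apply: (@le_trans _ _ (\sum_(k < K) (l / pi * ((1 + eps) * radial_freq lam (M i) k.+1) + 1))).
      by apply: ler_sum => k _; exact: nle.
    rewrite big_split/= sumr_const card_ord lerD2r -!mulr_sumr ler_wpM2l// ler_pM2l ?addr_gt0//.
    exact: (sum_radial_freq_le K lam0 (M_gt0 i)).
  by rewrite big_split/= sumr_const card_ord -!mulr_sumr lerD2l -[leLHS]mulr_natl mulrC.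
rewrite natrD -mul2n natrM.
rewrite (_ : weyl_density R * lam * _ =
    2 * (l / pi * ((1 + eps) * (\sum_(i < N) M i * lam * quarter_disc R)))); last first.
  by rewrite -!mulr_suml -mulr_sumr /weyl_density; ring.
move: h0 hk; set A := (\sum_(i < N) n 0 i)%:R; set B := (_)%:R.
move: (l / pi * _) (L / pi * _) => X Y h0 hk.
by apply: (le_trans (lerD h0 (ler_wpM2l _ hk))) => //; lra.
Qed.

End partition.

Lemma weyl_curve_lower (gam : R) : 0 < gam ->
  exists2 lam0, 0 < lam0 & forall lam (j : nat), lam0 <= lam ->
    (1 + gam) * weyl_density R * lam * (L * \int[mu]_(t in `[0, 1]) F t) <= j%:R ->
    (lam%:E <= lambda a j)%E.
Proof.
move=> gam0.
(* Then [(1 + eps) ^+ 2 <= 1 + 3 * eps <= 1 + gam / 2]; the other half of [gam] is left for the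
   lower-order terms. *)
pose eps := Num.min 1 (gam / 6).
have eps0 : 0 < eps by rewrite lt_min ltr01 divr_gt0.
have [eps1 eps6] : eps <= 1 /\ eps <= gam / 6 by rewrite /eps !ge_min !lexx orbT.
have [eta eta0 Feta] := axis_dist_min aL.
have [Mx Mx0 FMx] := axis_dist_max aL.
(* The number of bands is fixed by the curve: their length is at most [eps / 4] times the least
   distance to the axis. *)
pose N := (Num.truncn (4 * L / (eps * eta))).+1.
have NR : 0 < N%:R :> R by rewrite ltr0n.
have lN : 4 * (L / N%:R) <= eps * eta.
  have := truncnS_gt (4 * L / (eps * eta)); rewrite -/N ltr_pdivrMr ?mulr_gt0// => h.
  by rewrite mulrA ler_pdivrMr// [leRHS]mulrC ltW.
have eeta : eps * eta <= eta by rewrite ler_piMl// ltW.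
have lsmall i : 2 * (L / N%:R) <= eps * (F (N%:R^-1 * i%:R) - L / N%:R).
  apply: (@le_trans _ _ (eps * (eta / 2))); first by lra.
  rewrite ler_pM2l//; have := Feta (N%:R^-1 * i%:R).
  have l0 : 0 < L / N%:R by rewrite divr_gt0.
  by rewrite /F; lra.
have bF := bounded_measurable_axis_dist aL.
set S := L * \int[mu]_(t in `[0, 1]) F t.
have S0 : 0 < S.
  rewrite mulr_gt0// (@Rintegral_itv_gt0 _ _ _ _ 2^-1)//.
  - exact: axis_dist_continuous aL.
  - by move=> t; exact/ltW/(axis_dist_gt0 aL).
  - by apply/andP; split; lra.
  - exact: (axis_dist_gt0 aL).
have W0 := weyl_density_gt0 R.
(* [C1 * Num.sqrt lam] bounds the lower-order terms and [D * lam] is the margin left for them;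
   beyond [s1] the margin is larger. *)
pose C1 := L / pi * (1 + eps) + N%:R * (1 + 2 * Mx).
have C10 : 0 < C1.
  by rewrite addr_gt0// !mulr_gt0 ?invr_gt0 ?pi_gt0 ?addr_gt0 ?mulr_gt0.
pose D := gam / 2 * (weyl_density R * S).
have D0 : 0 < D := mulr_gt0 (divr_gt0 gam0 (ltr0Sn R 1)) (mulr_gt0 W0 S0).
pose s1 := C1 / D + 1.
have s10 : 1 < s1 by rewrite ltrDr divr_gt0.
exists (s1 ^+ 2); first by rewrite exprn_gt0// (lt_trans ltr01).
move=> lam j laml jl.
have lam_gt0 : 0 < lam by rewrite (lt_le_trans _ laml)// exprn_gt0// (lt_trans ltr01).
set s := Num.sqrt lam.
have s1s : s1 <= s by rewrite -(gtr0_norm (lt_trans ltr01 s10)) -sqrtr_sqr ler_wsqrtr.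
have lamE : lam = s ^+ 2 by rewrite /s sqr_sqrtr// ltW.
have s_gt0 : 0 < s by rewrite (lt_le_trans _ s1s)// (lt_trans ltr01).
have WL : 0 < weyl_density R * lam := mulr_gt0 W0 lam_gt0.
have e1 : 0 < 1 + eps := addr_gt0 ltr01 eps0.
(* For [k > K] one has [k >= Mx * s], and the angular energy alone is large enough. *)
pose K := Num.truncn (Mx * s).
pose n k i := (Num.truncn (L / N%:R / pi * ((1 + eps) *
  radial_freq lam (F (N%:R^-1 * i%:R) + L / N%:R) k))).+1.
apply: (@jth_smallest_ge R (fun k => \sum_(i < N) n k i)%N K) => /=.
  move=> k i c i0 /orP[Kk|ni]; last exact: (@lambda_mode_ge_of_partition N eps).
  apply: (@lambda_mode_ge R a k i [::]) => // w w0 wn0 _.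
  apply: (@rayleigh_ge_of_bound R p q a L aL L0 k lam Mx) => //.
  rewrite lamE mulrC -exprMn ler_sqr ?nnegrE ?mulr_ge0 ?(ltW Mx0) ?(ltW s_gt0)//.
  by rewrite (le_trans (ltW (truncnS_gt _)))// ler_nat.
rewrite -(ltr_nat R) (lt_le_trans _ jl)//.
apply: (le_lt_trans (@mode_count_le N eps lam isT eps0 lam_gt0 lsmall K)).
have h1 := @sum_partition_le N eps isT eps0 lsmall.
have hK : K%:R <= Mx * s by rewrite truncn_le mulr_ge0// ltW.
apply: (@le_lt_trans _ _ (weyl_density R * lam * ((1 + eps) * ((1 + eps) * S)) + C1 * s)).
  apply: lerD; first by rewrite (ler_pM2l WL) (ler_pM2l e1).
  have -> : C1 * s = L / pi * ((1 + eps) * s) + N%:R * ((1 + 2 * Mx) * s).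
    by rewrite /C1 mulrDl -!mulrA.
  rewrite -/s lerD2l ler_pM2l//.
  have : 1 <= s by rewrite (le_trans (ltW s10)).
  by move: hK; rewrite -/s; lra.
have h3 : C1 * s < D * lam.
  rewrite lamE expr2 mulrA ltr_pM2r// mulrC -ltr_pdivrMr//.
  by rewrite (lt_le_trans _ s1s)// ltrDl.
have h4 : (1 + eps) * ((1 + eps) * S) <= (1 + gam / 2) * S.
  rewrite mulrA ler_pM2r//; have : eps * eps <= eps by rewrite ler_piMl// ltW.
  by nra.
have h5 : weyl_density R * lam * ((1 + eps) * ((1 + eps) * S)) <=
    weyl_density R * lam * ((1 + gam / 2) * S) by rewrite (ler_pM2l WL).
apply: (le_lt_trans (lerD h5 (lexx _))).
by move: h3; rewrite /D; move: (C1 * s) => X; lra.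
Qed.

End weyl_curve_lower.

(** * Eigenfunctions of a disc *)

Section bessel.
Variable R : realType.
Implicit Types (x y : R) (k m n : nat).

Definition bessel_coef k m : R := (- 4^-1) ^+ m / (m`! * (m + k)`!)%:R.

(* [bessel k x] is the Bessel function [J_k(s) * (2/s)^k] at [x = s^2]. *)
Definition bessel k x : R := limn (pseries (bessel_coef k) x).

Lemma bessel_cvg k x : cvgn (pseries (bessel_coef k) x).
Proof.
apply: normed_cvg; apply: (@series_le_cvg _ _ (exp_coeff `|x|)) => //.
- by move=> n; exact: normr_ge0.
- by move=> n; rewrite /exp_coeff/= divr_ge0// exprn_ge0.
- move=> n; rewrite /exp_coeff/= normrM normrX mulrC ler_wpM2l ?exprn_ge0//.
  rewrite /bessel_coef normrM normrX normrN normfV normr_nat.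
  rewrite normfV normr_nat.
  rewrite natrM invfM mulrCA ler_piMr ?invr_ge0// mulr_ile1 ?exprn_ge0 ?invr_ge0//.
    by rewrite exprn_ile1 ?invr_ge0// invf_le1// ler1n.
  by rewrite invf_le1 ?ltr0n ?fact_gt0// ler1n fact_gt0.
- exact: is_cvg_series_exp_coeff.
Qed.

Lemma bessel_coef_diffs k : pseries_diffs (bessel_coef k) = - 4^-1 *: bessel_coef k.+1.
Proof.
apply/funext => i; transitivity (- 4^-1 * bessel_coef k.+1 i) => //.
rewrite /pseries_diffs /bessel_coef exprS addSnnS factS !natrM.
have h1 : 0 < i.+1%:R :> R by rewrite ltr0n.
have h2 : 0 < i`!%:R :> R by rewrite ltr0n fact_gt0.
have h3 : 0 < (i + k.+1)`!%:R :> R by rewrite ltr0n fact_gt0.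
move: h1 h2 h3; move: (i.+1%:R) (i`!%:R) ((i + k.+1)`!%:R) => f1 f2 f3 h1 h2 h3.
by field; rewrite !gt_eqF.
Qed.

Lemma pseriesZ (c : R) (u : nat -> R) x : pseries (c *: u) x = c *: pseries u x.
Proof.
apply/funext => n; transitivity (c * pseries u x n) => //.
rewrite /pseries /series/= mulr_sumr.
by apply: eq_bigr => i _; rewrite -mulrA.
Qed.

Global Instance is_derive_bessel k x :
  is_derive x 1 (bessel k) (- 4^-1 * bessel k.+1 x).
Proof.
have cZ (c : R) j y : cvgn (pseries (c *: bessel_coef j) y).
  by rewrite pseriesZ; apply: is_cvgZr; exact: bessel_cvg.
have -> : - 4^-1 * bessel k.+1 x = limn (pseries (pseries_diffs (bessel_coef k)) x).
  by rewrite bessel_coef_diffs pseriesZ limZr//; exact: bessel_cvg.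
apply: (@pseries_snd_diffs _ _ (`|x| + 1)).
- exact: bessel_cvg.
- by rewrite bessel_coef_diffs.
- rewrite bessel_coef_diffs (_ : pseries_diffs _ = (- 4^-1 * - 4^-1) *: bessel_coef k.+2)//.
  rewrite -scalerA -(bessel_coef_diffs k.+1); apply/funext => i.
  by rewrite /pseries_diffs /= [LHS]mulrCA.
- by rewrite [ltRHS]ger0_norm ?addr_ge0// ltrDl.
Qed.

(** The classical relation between [J_k], [J_(k+1)] and [J_(k+2)], compared coefficient by
    coefficient. As differentiation raises the index, it is Bessel's differential equation in this
    normalization. *)
Lemma bessel_recurrence k x :
  bessel k x = k.+1%:R * bessel k.+1 x - x / 4 * bessel k.+2 x.
Proof.
have H n : pseries (bessel_coef k) x n.+1 =
    k.+1%:R * pseries (bessel_coef k.+1) x n.+1 - x / 4 * pseries (bessel_coef k.+2) x n.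
  rewrite /pseries /series/= !big_mkord !mulr_sumr big_ord_recl [in RHS]big_ord_recl/=.
  rewrite -addrA -sumrB; congr (_ + _).
    rewrite /bessel_coef !expr0 !add0n fact0 !mul1n !mulr1 factS natrM !mul1r.
    have h1 : 0 < k.+1%:R :> R by rewrite ltr0n.
    have h2 : 0 < k`!%:R :> R by rewrite ltr0n fact_gt0.
    by move: h1 h2; move: (k.+1%:R) (k`!%:R) => f1 f2 h1 h2; field; rewrite !gt_eqF.
  apply: eq_bigr => i _; rewrite /bump/= !add1n /bessel_coef !exprS.
  have e1 : (i.+1 + k = (i + k).+1)%N by rewrite addSn.
  have e2 : (i.+1 + k.+1 = (i + k).+2)%N by rewrite addSn addnS.
  have e3 : (i + k.+2 = (i + k).+2)%N by rewrite !addnS.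
  have n1 : i.+1%:R = i%:R + 1 :> R by rewrite natr1.
  have n2 : k.+1%:R = k%:R + 1 :> R by rewrite natr1.
  have n3 : (i + k).+1%:R = i%:R + k%:R + 1 :> R by rewrite -natrD natr1.
  have n4 : (i + k).+2%:R = i%:R + k%:R + 1 + 1 :> R by rewrite -natrD !natr1.
  rewrite e1 e2 e3 !factS !natrM n1 n2 n3 n4.
  have h1 : 0 < i%:R + 1 :> R by rewrite natr1.
  have h2 : 0 < i%:R + k%:R + 1 :> R by rewrite -natrD natr1.
  have h3 : 0 < i%:R + k%:R + 1 + 1 :> R by rewrite addr_gt0.
  move: (fact_gt0 i) (fact_gt0 (i + k)); rewrite -(ltr0n R) -(ltr0n R (i + k)`!).
  move: (i`!%:R) ((i + k)`!%:R) => f1 f2 f10 f20.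
  by field; rewrite !gt_eqF.
have c1 : (fun n => pseries (bessel_coef k) x n.+1) @ \oo --> bessel k x.
  by have := @bessel_cvg k x; rewrite -cvg_shiftS.
have c2 : (fun n => k.+1%:R * pseries (bessel_coef k.+1) x n.+1 -
    x / 4 * pseries (bessel_coef k.+2) x n) @ \oo -->
    k.+1%:R * bessel k.+1 x - x / 4 * bessel k.+2 x.
  apply: cvgB; apply: cvgM; [exact: cvg_cst| |exact: cvg_cst|exact: bessel_cvg].
  by have := @bessel_cvg k.+1 x; rewrite -cvg_shiftS.
apply: (cvg_unique _ c1) => //.
by apply: cvg_trans c2; apply: near_eq_cvg; near=> n; rewrite H.
Unshelve. all: end_near. Qed.

Lemma bessel_continuous k : continuous (bessel k).
Proof. by move=> x; exact: is_derive_continuous (is_derive_bessel k x). Qed.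

Lemma bessel0_gt0 k : 0 < bessel k 0.
Proof.
have -> : bessel k 0 = bessel_coef k 0.
  apply: cvg_lim => //; rewrite -cvg_shiftS; apply: cvg_near_cst; near=> n.
  rewrite /pseries /series/= big_mkord big_ord_recl expr0 mulr1 big1 ?addr0// => i _.
  by rewrite exprS mul0r mulr0.
by rewrite /bessel_coef expr0 mul1r invr_gt0 ltr0n muln_gt0 !fact_gt0.
Unshelve. all: end_near. Qed.

Lemma is_derive_power k x : 0 < x ->
  is_derive x 1 (fun x => x ^+ k) (k%:R / x * x ^+ k).
Proof.
move=> x0; elim: k => [|k IHk].
  by rewrite !mul0r; under eq_fun do rewrite expr0; exact: is_derive_cst.
under eq_fun do rewrite exprS.
by apply: is_derive_eq; rewrite /GRing.scale/= exprS -natr1; field; rewrite gt_eqF.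
Qed.

Let y k j x : R := x ^+ k * bessel j (x ^+ 2).

Let dy k j x : 0 < x ->
  is_derive x 1 (y k j) (k%:R / x * y k j x - x / 2 * y k j.+1 x).
Proof.
move=> x0; have D1 := is_derive_power k x0.
have D2 : is_derive x 1 (fun x => bessel j (x ^+ 2)) (- (x / 2) * bessel j.+1 (x ^+ 2)).
  suff -> : - (x / 2) * bessel j.+1 (x ^+ 2) =
      (- 4^-1 * bessel j.+1 (x ^+ 2)) * (2%:R / x * x ^+ 2).
    exact: (is_derive1_comp (is_derive_bessel j _) (is_derive_power 2 x0)).
  by field; rewrite gt_eqF.
by apply: is_derive_eq; rewrite /GRing.scale/= /y; field; rewrite gt_eqF.
Qed.

(** Here [y k k x] is [2 ^+ k] times [J_k x]. The factor [Num.sqrt x] removes the first-order term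
    of Bessel's equation: [v'' = - (1 - (k ^+ 2 - 1 / 4) / x ^+ 2) v]. *)
Let v k x : R := Num.sqrt x * y k k x.
Let v1 k x : R := Num.sqrt x * ((k%:R + 2^-1) / x * y k k x - x / 2 * y k k.+1 x).

Let dv k x : 0 < x -> is_derive x 1 (v k) (v1 k x).
Proof.
move=> x0; have D := dy k k x0; have S := is_derive1_sqrt x0.
apply: is_derive_eq; rewrite /GRing.scale/= /v1.
have s0 : 0 < Num.sqrt x by rewrite sqrtr_gt0.
have sE := sqr_sqrtr (ltW x0).
move: (y k k x) (y k k.+1 x) => A B.
move: sE s0; move: (Num.sqrt x) => s <- s0.
by field; rewrite gt_eqF.
Qed.

Let dv1 k x : 0 < x ->
  is_derive x 1 (v1 k) (- ((1 - (k%:R ^+ 2 - 4^-1) / x ^+ 2) * v k x)).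
Proof.
move=> x0; have D := dy k k x0; have D1 := dy k k.+1 x0; have S := is_derive1_sqrt x0.
have xn0 : x != 0 by rewrite gt_eqF.
have I : is_derive x 1 (fun x : R => x^-1) (- x ^- 2 *: 1) by apply: is_deriveV.
apply: is_derive_eq; rewrite /GRing.scale/= /v.
have rec : y k k x = k.+1%:R * y k k.+1 x - x ^+ 2 / 4 * y k k.+2 x.
  by rewrite /y [bessel k _]bessel_recurrence; ring.
have s0 : 0 < Num.sqrt x by rewrite sqrtr_gt0.
have sE := sqr_sqrtr (ltW x0).
rewrite rec -natr1; move: (y k k.+1 x) (y k k.+2 x) => A B.
move: sE s0; move: (Num.sqrt x) => s <- s0.
by field; rewrite gt_eqF.
Qed.

(** On the interval the equation of [v k] has a coefficient at least [(pi / h) ^+ 2], so [v k]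
    oscillates at least as fast as a sine with consecutive zeros at the two ends. The interval is
    half-open so that zeros found in adjacent intervals are distinct. *)
Lemma bessel_sturm k (x0 h : R) : 0 < x0 -> 0 < h ->
  (pi / h) ^+ 2 <= 1 - k%:R ^+ 2 / x0 ^+ 2 ->
  exists2 z, x0 <= z < x0 + h & bessel k (z ^+ 2) = 0.
Proof.
move=> x00 h0 cond; apply: contrapT => nz.
have J0 z : x0 <= z < x0 + h -> y k k z != 0.
  move=> zx; apply: mulf_neq0; last first.
    by apply/eqP => b0; apply: nz; exists z.
  by apply: expf_neq0; rewrite gt_eqF//; case/andP: zx => + _; exact: lt_le_trans.
have pos z : x0 <= z -> 0 < z by exact: lt_le_trans.
have cy : {within `[x0, x0 + h], continuous (y k k)}.
  apply: continuous_in_subspaceT => z; rewrite inE/= in_itv/= => /andP[zx _].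
  exact: is_derive_continuous (dy k k (pos _ zx)).
(* Multiplication by the value at [x0] avoids distinguishing the sign of [y k k]. *)
set A := y k k x0.
have A0 : A != 0 by apply: J0; rewrite lexx ltrDl.
have sgn z : x0 <= z < x0 + h -> 0 < A * y k k z.
  move=> /andP[xz zh]; rewrite ltNge; apply/negP => neg.
  have cont : {within `[x0, z], continuous (fun t => A * y k k t)}.
    apply: (@continuous_subspaceW _ _ _ `[x0, x0 + h]).
      by apply: subset_itvl; rewrite bnd_simp ltW.
    by move=> t; apply: cvgM; [exact: cvg_cst|exact: cy].
  have minmax : Num.min (A * y k k x0) (A * y k k z) <= 0 <= Num.max (A * y k k x0) (A * y k k z).
    by rewrite ge_min le_max neg orbT/= -/A -expr2 sqr_ge0.
  have [c] := IVT xz cont minmax.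
  rewrite in_itv/= => /andP[xc cz] /eqP; rewrite mulf_eq0 (negbTE A0)/=.
  by apply/negP/J0; rewrite xc (le_lt_trans cz).
set c := pi / h in cond.
have c0 : 0 < c by rewrite divr_gt0 ?pi_gt0.
(* Sturm comparison: [W] is the Wronskian of [v k = sqrt x * x^k * bessel k (x^2)],
   a multiple of [sqrt x * J_k x], and [sin (c (x - x0))]. *)
pose W x := A * (v1 k x * sin (c * (x - x0)) - v k x * (c * cos (c * (x - x0)))).
have dW x : 0 < x -> is_derive x 1 W (A * ((c ^+ 2 - (1 - (k%:R ^+ 2 - 4^-1) / x ^+ 2)) *
    (v k x * sin (c * (x - x0))))).
  move=> xp; have D := dv k xp; have D1 := dv1 k xp.
  have S := is_derive_sin_affine c x0 x; have C := is_derive_cos_affine c x0 x.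
  by apply: is_derive_eq; rewrite /GRing.scale/=; ring.
have x0h : x0 < x0 + h by rewrite ltrDl.
have D1 z : z \in `]x0, (x0 + h)[ -> is_derive z 1 W
    (A * ((c ^+ 2 - (1 - (k%:R ^+ 2 - 4^-1) / z ^+ 2)) * (v k z * sin (c * (z - x0))))).
  by rewrite in_itv/= => /andP[/ltW zx _]; exact: dW (pos _ zx).
have cW : {within `[x0, x0 + h], continuous W}.
  apply: continuous_in_subspaceT => z; rewrite inE/= in_itv/= => /andP[zx _].
  exact: is_derive_continuous (dW _ (pos _ zx)).
have [e] := MVT x0h D1 cW.
rewrite in_itv/= => /andP[xe eh] WE.
have ep : 0 < e by rewrite (lt_trans x00).
have W0 : W x0 < 0.
  rewrite /W subrr mulr0 sin0 cos0 mulr0 mulr1 sub0r mulrN oppr_lt0.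
  rewrite /v -/A (_ : A * _ = c * Num.sqrt x0 * A ^+ 2); last by ring.
  by apply: mulr_gt0; [rewrite mulr_gt0 ?sqrtr_gt0|rewrite exprn_even_gt0].
have Wh : 0 <= W (x0 + h).
  (* The right end may itself be a zero, so the sign there is obtained as a limit from the left. *)
  have yh : 0 <= A * y k k (x0 + h).
    have cyh : y k k z @[z --> (x0 + h)^'-] --> y k k (x0 + h).
      apply: cvg_at_left_filter; apply: is_derive_continuous (dy k k (pos _ _)).
      by rewrite lerDl ltW.
    have cA : A * y k k z @[z --> (x0 + h)^'-] --> A * y k k (x0 + h).
      by apply: cvgM; [exact: cvg_cst|exact: cyh].
    apply: (cvgr_to_ge cA).
    near=> z; apply/ltW/sgn; apply/andP; split => //.
    by apply/ltW; near: z; apply: nbhs_left_gt; rewrite ltrDl.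
  rewrite /W (_ : c * (x0 + h - x0) = pi); last by rewrite addrAC subrr add0r /c mulfVK// gt_eqF.
  rewrite sinpi cospi /v (_ : A * _ = c * Num.sqrt (x0 + h) * (A * y k k (x0 + h))); last by ring.
  by rewrite mulr_ge0// mulr_ge0 ?sqrtr_ge0// ltW.
have : W (x0 + h) - W x0 <= 0.
  rewrite WE addrAC subrr add0r mulr_le0_ge0 ?(ltW h0)//.
  rewrite mulrCA mulr_le0_ge0//.
    rewrite subr_le0 (le_trans cond)// lerB//.
    have k2 : 0 <= k%:R ^+ 2 :> R by exact: sqr_ge0.
    have xe2 : (e ^+ 2)^-1 <= (x0 ^+ 2)^-1.
      by rewrite lef_pV2 ?posrE ?exprn_gt0// lerXn2r ?nnegrE ?ltW.
    rewrite (le_trans _ (ler_wpM2l k2 xe2))// ler_wpM2r ?invr_ge0 ?sqr_ge0//.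
    by rewrite gerBl invr_ge0.
  rewrite /v (_ : A * _ = Num.sqrt e * (A * y k k e) * sin (c * (e - x0))); last by ring.
  rewrite mulr_ge0//.
    by rewrite mulr_ge0 ?sqrtr_ge0// ltW// sgn// eh ltW.
  apply: sin_ge0_pi; apply/andP; split.
    by rewrite ltW// mulr_gt0// subr_gt0.
  have -> : pi = c * h by rewrite /c divfK ?gt_eqF.
  by rewrite ler_pM2l// lerBlDl ltW.
move: W0 Wh; lra.
Unshelve. all: end_near. Qed.

End bessel.

Section continuous_operations.
Variables (R : realType) (T : topologicalType) (f g : T -> R).
Hypotheses (fc : continuous f) (gc : continuous g).

Lemma continuous_add : continuous (fun z => f z + g z).
Proof. by move=> z; apply: cvgD; [exact: fc|exact: gc]. Qed.

Lemma continuous_mul : continuous (fun z => f z * g z).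
Proof. by move=> z; apply: cvgM; [exact: fc|exact: gc]. Qed.

Lemma continuous_opp : continuous (fun z => - f z).
Proof. by move=> z; apply: cvgN; exact: fc. Qed.

Lemma continuous_sqr : continuous (fun z => f z ^+ 2).
Proof. by move=> z; under eq_fun do rewrite expr2; apply: cvgM; exact: fc. Qed.

Lemma continuous_minr : continuous (fun z => Num.min (f z) (g z)).
Proof. by move=> z; exact: (@continuous_min R T f g z (@fc z) (@gc z)). Qed.

Lemma continuous_near_lt z (c : R) : f z < c -> \forall z' \near z, f z' < c.
Proof.
by move=> fzc; exact: (@cvgr_lt _ _ _ _ _ _ (@fc z)).
Qed.

End continuous_operations.

Ltac continuity := repeat
  lazymatch goal with |- continuous ?f =>
    lazymatch f with
    | fun x => - _ => apply: continuous_opp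
    | fun x => _ + _ => apply: continuous_add
    | fun x => _ ^+ 2 => apply: continuous_sqr
    | fun x => _ * _ => apply: continuous_mul
    | fun x => fun_of_matrix x _ _ => exact: coord_continuous
    | fun x => ?c => exact: cst_continuous
    | _ => assumption
    end
  end.

(** * Eigenfunctions of the disc in separated variables *)

Section disc_modes.
Variable R : realType.
Implicit Types (x y mu r : R) (k j : nat) (s : R * R) (z : 'rV[R]_2).

Lemma is_derive_row0 (f : R -> R -> R) z l :
  is_derive (z 0 0) 1 (f^~ (z 0 1)) l ->
  is_derive z (delta_mx 0 0) (fun z => f (z 0 0) (z 0 1)) l.
Proof.
have E : (fun h : R => h^-1 *: (f ((h *: delta_mx 0 0 + z) 0 0) ((h *: delta_mx 0 0 + z) 0 1)
      - f (z 0 0) (z 0 1))) =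
    (fun h : R => h^-1 *: (f (h *: 1 + z 0 0) (z 0 1) - f (z 0 0) (z 0 1))).
  by apply/funext => h; rewrite !mxE/= mulr0 add0r.
by move=> [d <-]; split; [rewrite /derivable E|rewrite /derive E].
Qed.

Lemma is_derive_row1 (f : R -> R -> R) z l :
  is_derive (z 0 1) 1 (f (z 0 0)) l ->
  is_derive z (delta_mx 0 1) (fun z => f (z 0 0) (z 0 1)) l.
Proof.
have E : (fun h : R => h^-1 *: (f ((h *: delta_mx 0 1 + z) 0 0) ((h *: delta_mx 0 1 + z) 0 1)
      - f (z 0 0) (z 0 1))) =
    (fun h : R => h^-1 *: (f (z 0 0) (h *: 1 + z 0 1) - f (z 0 0) (z 0 1))).
  by apply/funext => h; rewrite !mxE/= mulr0 add0r.
by move=> [d <-]; split; [rewrite /derivable E|rewrite /derive E].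
Qed.

(* Conjugate harmonic polynomials: the recursion is the multiplication of the
   complex number [h.1 + i h.2] by [x - i y]. *)
Fixpoint harmonic s k x y : R * R :=
  if k is k'.+1 then
    let h := harmonic s k' x y in (x * h.1 + y * h.2, x * h.2 - y * h.1)
  else s.

Lemma is_derive_harmonic s k x y :
  [/\ is_derive x 1 (fun x => (harmonic s k x y).1) (k%:R * (harmonic s k.-1 x y).1),
      is_derive x 1 (fun x => (harmonic s k x y).2) (k%:R * (harmonic s k.-1 x y).2),
      is_derive y 1 (fun y => (harmonic s k x y).1) (k%:R * (harmonic s k.-1 x y).2)
    & is_derive y 1 (fun y => (harmonic s k x y).2) (- (k%:R * (harmonic s k.-1 x y).1))].
Proof.
elim: k => [|k [D1 D2 D3 D4]].
  by rewrite /= !mul0r oppr0; split; exact: is_derive_cst.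
have E : k%:R * (x * (harmonic s k.-1 x y).1 + y * (harmonic s k.-1 x y).2) =
    k%:R * (harmonic s k x y).1 /\
    k%:R * (x * (harmonic s k.-1 x y).2 - y * (harmonic s k.-1 x y).1) =
    k%:R * (harmonic s k x y).2.
  by case: k {D1 D2 D3 D4} => [|k//]; rewrite !mul0r.
case: E => E1 E2; rewrite /= -natr1.
split; apply: is_derive_eq; rewrite /GRing.scale/=; move: E1 E2; lra.
Qed.

Lemma harmonic_polar s k (rho t : R) :
  harmonic s k (rho * cos t) (rho * sin t) =
  (rho ^+ k * (s.1 * cos (k%:R * t) + s.2 * sin (k%:R * t)),
   rho ^+ k * (s.2 * cos (k%:R * t) - s.1 * sin (k%:R * t))).
Proof.
elim: k => [|k IHk] /=.
  by rewrite mul0r cos0 sin0 !mulr0 !mulr1 !mul1r addr0 subr0 -surjective_pairing.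
by rewrite IHk/= -natr1 mulrDl mul1r cosD sinD exprS; congr pair; ring.
Qed.

Variables (mu : R) (s : R * R) (k : nat).

Let H j x y := (harmonic s j x y).1.
Let G j x y := (harmonic s j x y).2.
Let B j x y := bessel j (mu * (x ^+ 2 + y ^+ 2)).

Let dBx j x y : is_derive x 1 (B j ^~ y) (- (mu / 2 * x * B j.+1 x y)).
Proof.
have D : is_derive x 1 (fun x => mu * (x ^+ 2 + y ^+ 2)) (mu * (2 * x)).
  by apply: is_derive_eq; rewrite /GRing.scale/=; ring.
have -> : - (mu / 2 * x * B j.+1 x y) = (- 4^-1 * B j.+1 x y) * (mu * (2 * x)) by field.
exact: (is_derive1_comp (is_derive_bessel j _) D).
Qed.

Let dBy j x y : is_derive y 1 (B j x) (- (mu / 2 * y * B j.+1 x y)).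
Proof.
have D : is_derive y 1 (fun y => mu * (x ^+ 2 + y ^+ 2)) (mu * (2 * y)).
  by apply: is_derive_eq; rewrite /GRing.scale/=; ring.
have -> : - (mu / 2 * y * B j.+1 x y) = (- 4^-1 * B j.+1 x y) * (mu * (2 * y)) by field.
exact: (is_derive1_comp (is_derive_bessel j _) D).
Qed.

(** The product of a harmonic polynomial and a radial function, followed by its partial derivatives.
    The indices [k.-1] and [k.-2] saturate at [0] exactly where the factors [k%:R] and [kk] make the
    terms vanish. *)
Let phi x y := H k x y * B k x y.
Let phix x y := k%:R * H k.-1 x y * B k x y - mu / 2 * x * H k x y * B k.+1 x y.
Let phiy x y := k%:R * G k.-1 x y * B k x y - mu / 2 * y * H k x y * B k.+1 x y.
Let kk : R := k%:R * k.-1%:R.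
Let phixx x y := kk * H k.-2 x y * B k x y - mu * x * k%:R * H k.-1 x y * B k.+1 x y
  - mu / 2 * H k x y * B k.+1 x y + (mu / 2) ^+ 2 * x ^+ 2 * H k x y * B k.+2 x y.
Let phiyy x y := - (kk * H k.-2 x y * B k x y) - mu * y * k%:R * G k.-1 x y * B k.+1 x y
  - mu / 2 * H k x y * B k.+1 x y + (mu / 2) ^+ 2 * y ^+ 2 * H k x y * B k.+2 x y.
Let phixy x y := kk * G k.-2 x y * B k x y - mu / 2 * k%:R * (x * G k.-1 x y + y * H k.-1 x y)
  * B k.+1 x y + (mu / 2) ^+ 2 * x * y * H k x y * B k.+2 x y.

Let derivs x y :
  [/\ is_derive x 1 (phi^~ y) (phix x y), is_derive y 1 (phi x) (phiy x y),
      is_derive x 1 (phix^~ y) (phixx x y), is_derive y 1 (phix x) (phixy x y)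
    & is_derive x 1 (phiy^~ y) (phixy x y)] /\
  is_derive y 1 (phiy x) (phiyy x y).
Proof.
have [h1 h2 h3 h4] := is_derive_harmonic s k x y.
have [g1 g2 g3 g4] := is_derive_harmonic s k.-1 x y.
have b1 j := dBx j x y.
have b2 j := dBy j x y.
by split; [split|]; apply: is_derive_eq;
  rewrite /GRing.scale/= /phix /phiy /phixx /phixy /phiyy /kk /H /G; field.
Qed.

(** The second derivatives of the harmonic polynomial cancel, Euler's identity for homogeneous
    polynomials evaluates the mixed terms, and [bessel_recurrence] does the rest. *)
Let laplacian x y : phixx x y + phiyy x y = - mu * phi x y.
Proof.
have E : k%:R * (x * H k.-1 x y + y * G k.-1 x y) = k%:R * H k x y.
  by rewrite /H /G; case: k => [|k']//=; rewrite !mul0r.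
have -> : phixx x y + phiyy x y = - mu * (k%:R * (x * H k.-1 x y + y * G k.-1 x y)) * B k.+1 x y
    - mu * H k x y * B k.+1 x y
    + mu * (mu * (x ^+ 2 + y ^+ 2)) / 4 * H k x y * B k.+2 x y.
  by rewrite /phixx /phiyy; field.
rewrite E /phi /B [bessel k _]bessel_recurrence -natr1; ring.
Qed.

Let C0 z := phi (z 0 0) (z 0 1).

Let harmc j : continuous (fun z => H j (z 0 0) (z 0 1)) /\
  continuous (fun z => G j (z 0 0) (z 0 1)).
Proof.
elim: j => [|j [c1 c2]]; first by split; exact: cst_continuous.
by split; rewrite /H /G/=; continuity.
Qed.

Let Bc j : continuous (fun z => B j (z 0 0) (z 0 1)).
Proof.
have c : continuous (fun z : 'rV[R]_2 => mu * (z 0 0 ^+ 2 + z 0 1 ^+ 2)) by continuity.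
by move=> z; apply: continuous_comp; [exact: c|exact: bessel_continuous].
Qed.

Let second_continuous :
  [/\ continuous (fun z => phixx (z 0 0) (z 0 1)), continuous (fun z => phixy (z 0 0) (z 0 1))
    & continuous (fun z => phiyy (z 0 0) (z 0 1))].
Proof.
have [h0 g0] := harmc k; have [h1 g1] := harmc k.-1; have [h2 g2] := harmc k.-2.
have b0 := @Bc k; have b1 := @Bc k.+1; have b2 := @Bc k.+2.
rewrite /phixx /phixy /phiyy; move: h0 g0 h1 g1 h2 g2 b0 b1 b2.
move: (H k) (G k) (H k.-1) (G k.-1) (H k.-2) (G k.-2) (B k) (B k.+1) (B k.+2).
by move=> *; split; continuity.
Qed.

Variable r : R.
Hypotheses (r0 : 0 < r) (zr : bessel k (mu * r ^+ 2) = 0).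

(** In polar coordinates with [mu > 0] this is a multiple of [J_k (sqrt mu rho)] times [cos (k t)]
    or [sin (k t)], or a combination of them according to [s]. The minimum freezes the argument of
    [bessel] at its zero outside the disc, which extends the mode continuously by [0]. *)
Definition disc_mode z : R :=
  (harmonic s k (z 0 0) (z 0 1)).1 *
  bessel k (mu * Num.min (z 0 0 ^+ 2 + z 0 1 ^+ 2) (r ^+ 2)).

Let enorm2 z : enorm z = Num.sqrt (z 0 0 ^+ 2 + z 0 1 ^+ 2).
Proof.
rewrite /enorm !big_ord_recl big_ord0 addr0; congr (Num.sqrt (_ + z 0 _ ^+ 2)).
exact: val_inj.
Qed.

Let enorm_lt z : (enorm z < r) = (z 0 0 ^+ 2 + z 0 1 ^+ 2 < r ^+ 2).
Proof.
by rewrite enorm2 -[in LHS](ger0_norm (ltW r0)) -sqrtr_sqr ltr_sqrt ?exprn_gt0.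
Qed.

Let norm_continuous : continuous (fun z : 'rV[R]_2 => z 0 0 ^+ 2 + z 0 1 ^+ 2).
Proof. by continuity. Qed.

Let disc_mode_near z : enorm z < r -> \forall z' \near z, disc_mode z' = C0 z'.
Proof.
rewrite enorm_lt => zr'; near=> z'.
rewrite /disc_mode min_l//; apply: ltW; near: z'.
exact: (continuous_near_lt norm_continuous).
Unshelve. all: end_near. Qed.

Let C1 (i : 'I_2) z := if i == 0 then phix (z 0 0) (z 0 1) else phiy (z 0 0) (z 0 1).
Let C2 (i j : 'I_2) z :=
  if i == 0 then (if j == 0 then phixx (z 0 0) (z 0 1) else phixy (z 0 0) (z 0 1))
  else (if j == 0 then phixy (z 0 0) (z 0 1) else phiyy (z 0 0) (z 0 1)).

Let dC0 (i : 'I_2) z : is_derive z (delta_mx 0 i) C0 (C1 i z).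
Proof.
have [[d1 d2 _ _ _] _] := derivs (z 0 0) (z 0 1).
rewrite /C1; case: eqP => [->|/eqP i0]; first exact: is_derive_row0.
have -> : i = 1 by apply/val_inj; move: i0; case: i => -[|[|]].
exact: is_derive_row1.
Qed.

Let dC1 (i j : 'I_2) z : is_derive z (delta_mx 0 j) (C1 i) (C2 i j z).
Proof.
have [[_ _ d1 d2 d3] d4] := derivs (z 0 0) (z 0 1).
rewrite /C1 /C2; case: (i == 0); case: (eqVneq j 0) => [->|j0]; try exact: is_derive_row0.
all: have -> : j = 1 by apply/val_inj; move: j0; case: j => -[|[|]].
all: exact: is_derive_row1.
Qed.

Let sum2 (F : 'I_2 -> R) : \sum_i F i = F 0 + F 1.
Proof. by rewrite !big_ord_recl big_ord0 addr0; congr (_ + F _); exact: val_inj. Qed.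

Let C2c (i j : 'I_2) : continuous (C2 i j).
Proof. by have [? ? ?] := second_continuous; rewrite /C2; case: (i == 0); case: (j == 0). Qed.

Let disc_open z : enorm z < r -> \forall z' \near z, enorm z' < r.
Proof.
move=> zr'; near=> z'; rewrite enorm_lt; near: z'.
by apply: (continuous_near_lt norm_continuous); rewrite -enorm_lt.
Unshelve. all: end_near. Qed.

Let near_partial1 (i : 'I_2) z : enorm z < r -> partial i disc_mode z = C1 i z.
Proof.
move=> zr'; have [_ <-] := dC0 i z.
exact: near_eq_derive (disc_mode_near zr').
Qed.

Let near_partial1' (i : 'I_2) z : enorm z < r -> \forall z' \near z, partial i disc_mode z' = C1 i z'.
Proof. by move=> /disc_open; apply: filterS => z'; exact: near_partial1. Qed.

Let near_partial2 (i j : 'I_2) z : enorm z < r -> partial j (partial i disc_mode) z = C2 i j z.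
Proof.
move=> zr'; have [_ <-] := dC1 i j z.
exact: near_eq_derive (near_partial1' i zr').
Qed.

Lemma disc_mode_eigenfunction : disc_eigenfunction r mu disc_mode.
Proof.
split.
- have h := (harmc k).1.
  have b : continuous (fun z => bessel k (mu * Num.min (z 0 0 ^+ 2 + z 0 1 ^+ 2) (r ^+ 2))).
    have c : continuous (fun z : 'rV[R]_2 => Num.min (z 0 0 ^+ 2 + z 0 1 ^+ 2) (r ^+ 2)).
      exact: continuous_minr norm_continuous (@cst_continuous _ _ _).
    have mc : continuous (fun z : 'rV[R]_2 => mu * Num.min (z 0 0 ^+ 2 + z 0 1 ^+ 2) (r ^+ 2)).
      by continuity.
    by move=> z; apply: continuous_comp; [exact: mc|exact: bessel_continuous].
  exact: continuous_mul h b.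
- move=> z; rewrite leNgt enorm_lt -leNgt => rz.
  by rewrite /disc_mode min_r// zr mulr0.
- move=> z zr'; split.
    move=> i j; split.
    + apply: (near_eq_derivable (f := C0)); last by have [] := dC0 i z.
      by have := disc_mode_near zr'; apply: filterS => z' ->.
    + apply: (near_eq_derivable (f := C1 i)); last by have [] := dC1 i j z.
      by have := near_partial1' i zr'; apply: filterS => z' ->.
    + have n2 : \forall z' \near z, C2 i j z' = partial j (partial i disc_mode) z'.
        by move/disc_open: zr'; apply: filterS => z' /near_partial2 ->.
      rewrite /prop_for /continuous_at near_partial2//.
      by apply: cvg_trans (near_eq_cvg n2) _; exact: C2c.
  rewrite (sum2 (fun i => partial i (partial i disc_mode) z)).
  rewrite (near_partial2 0 0 zr') (near_partial2 1 1 zr').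
  rewrite (nbhs_singleton (disc_mode_near zr')).
  have := laplacian (z 0 0) (z 0 1); rewrite mulNr => lapE.
  by apply: (canLR (@opprK R)); rewrite -lapE.
Qed.

End disc_modes.

(** * Independence of the modes and Weyl upper bound for the discs *)

Section independence.
Variable R : realType.
Implicit Types (t lam : R).

(** The hypothesis extends to all polynomials; the one used vanishes at every node except [y]. Nodes
    may coincide, so only the sums over equal nodes are determined. *)
Lemma vandermonde_vanish n (x c : 'I_n -> R) :
  (forall m, \sum_i c i * x i ^+ m = 0) -> forall y, \sum_(i | x i == y) c i = 0.
Proof.
move=> H y.
have Hp (p : {poly R}) : \sum_i c i * p.[x i] = 0.
  under eq_bigr do rewrite horner_coef mulr_sumr.
  rewrite exchange_big big1// => m _.
  under eq_bigr do rewrite mulrCA.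
  by rewrite -mulr_sumr H mulr0.
pose p := \prod_(z <- [seq z <- codom x | z != y]) ('X - z%:P).
have py : p.[y] != 0.
  by rewrite -rootE root_prod_XsubC mem_filter eqxx.
apply/(mulfI py); rewrite mulr0 -[RHS](Hp p) mulr_sumr.
rewrite [RHS](bigID (fun i => x i == y))/= [X in _ + X]big1 ?addr0.
  by apply: eq_bigr => i /eqP ->; rewrite mulrC.
move=> i xiy; rewrite (_ : p.[x i] = 0) ?mulr0//.
by apply/rootP; rewrite root_prod_XsubC mem_filter xiy codom_f.
Qed.

Lemma is_derive_zero (f : R -> R) (x d : R) :
  (\forall y \near x, f y = 0) -> is_derive x 1 f d -> d = 0.
Proof.
move=> f0 [_ <-]; rewrite (near_eq_derive (g := cst 0))//.
by rewrite derive_val.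
Qed.

Lemma is_derive_bigsum n (f df : 'I_n -> R -> R) (x : R) :
  (forall i, is_derive x 1 (f i) (df i x)) ->
  is_derive x 1 (fun x => \sum_i f i x) (\sum_i df i x).
Proof.
move=> H; rewrite (_ : (fun x => \sum_i f i x) = \sum_i f i).
  exact: is_derive_sum.
by apply/funext => y; rewrite fct_sumE.
Qed.

(** Differentiating twice multiplies the [i]-th term by the negative of the squared frequency, so
    the Vandermonde argument separates the frequencies. Then [t = 0] isolates the cosines and
    [t = pi / 2 / j] the sines. *)
Lemma trigonometric_vanish n (k : 'I_n -> nat) (A B : 'I_n -> R) :
  (forall t, \sum_i (A i * cos ((k i)%:R * t) + B i * sin ((k i)%:R * t)) = 0) ->
  forall j, \sum_(i | k i == j) A i = 0 /\ ((0 < j)%N -> \sum_(i | k i == j) B i = 0).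
Proof.
move=> H.
pose f i t := A i * cos ((k i)%:R * t) + B i * sin ((k i)%:R * t).
pose g i t := B i * cos ((k i)%:R * t) - A i * sin ((k i)%:R * t).
have Hm m t : \sum_i ((k i)%:R ^+ 2) ^+ m * f i t = 0.
  elim: m t => [|m IHm] t.
    by rewrite -[RHS](H t); apply: eq_bigr => i _; rewrite expr0 mul1r.
  have S (c u : R) : is_derive u 1 (fun t => sin (c * t)) (c * cos (c * u)).
    by have := is_derive_sin_affine c 0 u; under eq_fun do rewrite subr0; rewrite subr0.
  have C (c u : R) : is_derive u 1 (fun t => cos (c * t)) (- (c * sin (c * u))).
    by have := is_derive_cos_affine c 0 u; under eq_fun do rewrite subr0; rewrite subr0.
  have D (u : R) i : is_derive u 1 (fun t => ((k i)%:R ^+ 2) ^+ m * f i t)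
      (((k i)%:R ^+ 2) ^+ m * (k i)%:R * g i u).
    have s := S (k i)%:R u; have c := C (k i)%:R u.
    by move: (_ ^+ m) => K; apply: is_derive_eq; rewrite /GRing.scale/= /g; ring.
  have D2 (u : R) i : is_derive u 1 (fun u => ((k i)%:R ^+ 2) ^+ m * (k i)%:R * g i u)
      (- (((k i)%:R ^+ 2) ^+ m.+1 * f i u)).
    have s := S (k i)%:R u; have c := C (k i)%:R u.
    rewrite [_ ^+ m.+1]exprS; move: (_ ^+ m) => K.
    by apply: is_derive_eq; rewrite /GRing.scale/= /f; ring.
  have g0 u : \sum_i ((k i)%:R ^+ 2) ^+ m * (k i)%:R * g i u = 0.
    apply: (is_derive_zero _ (@is_derive_bigsum _ _
      (fun i u => ((k i)%:R ^+ 2) ^+ m * (k i)%:R * g i u) _ (D u))).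
    by near=> v; exact: IHm.
  have /eqP : \sum_i - (((k i)%:R ^+ 2) ^+ m.+1 * f i t) = 0.
    apply: (is_derive_zero _ (@is_derive_bigsum _ _
      (fun i u => - (((k i)%:R ^+ 2) ^+ m.+1 * f i u)) _ (D2 t))).
    by near=> v; exact: g0.
  by rewrite sumrN oppr_eq0 => /eqP.
move=> j.
have Hj t : \sum_(i | k i == j) f i t = 0.
  rewrite -[RHS](@vandermonde_vanish n (fun i => (k i)%:R ^+ 2) (fun i => f i t) _ (j%:R ^+ 2)).
    by apply: eq_bigl => i; rewrite eqrXn2// eqr_nat.
  by move=> m; rewrite -[RHS](Hm m t); apply: eq_bigr => i _; rewrite mulrC.
split.
  rewrite -[RHS](Hj 0); apply: eq_bigr => i _.
  by rewrite /f mulr0 cos0 sin0 mulr1 mulr0 addr0.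
move=> j0; rewrite -[RHS](Hj (pi / 2 / j%:R)); apply: eq_bigr => i /eqP kj.
have jR : 0 < j%:R :> R by rewrite ltr0n.
rewrite /f kj mulrCA divff ?gt_eqF// mulr1.
by rewrite cos_pihalf sin_pihalf mulr0 mulr1 add0r.
Unshelve. all: end_near. Qed.

(** Each derivative in [t] brings out a factor [mu i] and raises the index. In the limit [t = 0] the
    Bessel factor is positive and common to all terms, which leaves the moments of [c] at the nodes
    [mu]. *)
Lemma bessel_vanish n k (mu c : 'I_n -> R) T : 0 < T ->
  (forall t, 0 < t < T -> \sum_i c i * bessel k (mu i * t) = 0) ->
  forall y, \sum_(i | mu i == y) c i = 0.
Proof.
move=> T0 H; apply: vandermonde_vanish => m.
pose f m t := \sum_i c i * mu i ^+ m * bessel (k + m) (mu i * t).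
have D j l t : is_derive t 1 (fun t => bessel j (mu l * t)) (- 4^-1 * bessel j.+1 (mu l * t) * mu l).
  have D1 : is_derive t 1 (fun t => mu l * t) (mu l).
    by have := is_deriveZ (mu l) (is_derive_id t (1 : R)); rewrite /GRing.scale/= mulr1.
  exact: (is_derive1_comp (is_derive_bessel j _) D1).
have df l t : is_derive t 1 (f l) (- 4^-1 * f l.+1 t).
  have -> : - 4^-1 * f l.+1 t =
      \sum_i c i * mu i ^+ l * (- 4^-1 * bessel (k + l).+1 (mu i * t) * mu i).
    rewrite mulr_sumr; apply: eq_bigr => i _; rewrite addnS exprSr; ring.
  rewrite /f; apply: (@is_derive_bigsum _ (fun i t => c i * mu i ^+ l * bessel (k + l) (mu i * t))
    (fun i t => c i * mu i ^+ l * (- 4^-1 * bessel (k + l).+1 (mu i * t) * mu i))).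
have f0 t : 0 < t < T -> f m t = 0.
  elim: m t => [|m IHm] t /andP[t0 tT].
    rewrite -[RHS](H t) ?t0//; apply: eq_bigr => i _.
    by rewrite expr0 mulr1 addn0.
  have /eqP : - 4^-1 * f m.+1 t = 0.
    apply: is_derive_zero (df m t); near=> u; apply: IHm; apply/andP; split.
      by near: u; exact: lt_nbhsr.
    by near: u; exact: lt_nbhsl.
  by rewrite mulf_eq0 oppr_eq0 invr_eq0 pnatr_eq0/= => /eqP.
have : f m 0 = 0.
  have c1 : f m t @[t --> 0^'+] --> f m 0.
    by apply: cvg_at_right_filter; exact: is_derive_continuous (df m 0).
  have c2 : f m t @[t --> 0^'+] --> 0.
    apply: cvg_near_cst; near=> t; apply: f0; apply/andP; split=> //.
  exact: (cvg_unique _ c1 c2).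
rewrite /f; under eq_bigr do rewrite mulr0.
rewrite -mulr_suml => /eqP; rewrite mulf_eq0 [X in _ || X]gt_eqF ?bessel0_gt0// orbF.
by move/eqP.
Unshelve. all: end_near. Qed.

Variable r : bool -> R.
Hypothesis r0 : forall b, 0 < r b.

(** The index [((b, (k, c)), mu)] consists of the disc [b], the angular order [k], the choice [c] of
    the sine ([true]) or cosine ([false]), and the eigenvalue [mu]. *)
Definition disc_sum_mode (m : bool * (nat * bool) * R) (b : bool) : 'rV[R]_2 -> R :=
  if b == m.1.1
  then disc_mode m.2 (if m.1.2.2 then (0, 1) else (1, 0)) m.1.2.1 (r b)
  else cst 0.

Lemma disc_mode_polar mu s k (rho R0 t : R) : 0 < rho < R0 ->
  disc_mode mu s k R0 (\row_j (if j == 0 then rho * cos t else rho * sin t)) =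
  rho ^+ k * bessel k (mu * rho ^+ 2) *
    (s.1 * cos (k%:R * t) + s.2 * sin (k%:R * t)).
Proof.
move=> /andP[rho0 rhoR].
rewrite /disc_mode !mxE/= harmonic_polar/= min_l.
  rewrite !exprMn -mulrDr cos2Dsin2 mulr1; ring.
rewrite !exprMn -mulrDr cos2Dsin2 mulr1 ler_sqr ?nnegrE ltW//.
exact: lt_trans rhoR.
Qed.

Lemma disc_sum_mode_lin_indep n (m : 'I_n -> bool * (nat * bool) * R) :
  injective m -> (forall i, (m i).1.2.1 = 0%N -> (m i).1.2.2 = false) ->
  lin_indep (fun i => disc_sum_mode (m i)).
Proof.
move=> mI mc c Hc i0.
set b0 := (m i0).1.1; set k0 := (m i0).1.2.1; set s0 := (m i0).1.2.2.
pose w i := if ((m i).1.1 == b0) && ((m i).1.2 == (k0, s0)) then c i else 0.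
suff H t : 0 < t < r b0 ^+ 2 -> \sum_i w i * bessel k0 ((m i).2 * t) = 0.
  have := @bessel_vanish _ k0 (fun i => (m i).2) w _ (exprn_gt0 2 (r0 b0)) H (m i0).2.
  rewrite (bigD1 i0)//= /w -/b0 {1}[(m i0).1.2]surjective_pairing -/k0 -/s0 !eqxx/=.
  rewrite big1 ?addr0// => i /andP[/eqP mi2 ii0]; case: ifP => // /andP[/eqP e1 /eqP e2].
  case/eqP: ii0; apply: mI; move: mi2 e1 e2; rewrite /b0 /k0 /s0.
  by case: (m i) => -[b [k s]] mu; case: (m i0) => -[b' [k' s']] mu'/= -> -> [-> ->].
move=> /andP[t0 tr]; set rho := Num.sqrt t.
have rho0 : 0 < rho by rewrite sqrtr_gt0.
have rho2 : rho ^+ 2 = t by rewrite sqr_sqrtr// ltW.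
have rhor : rho < r b0 by rewrite -ltr_sqr ?nnegrE ?(ltW rho0) ?ltW// rho2.
pose K i := (m i).1.2.1.
pose V i := if (m i).1.1 == b0 then c i * (rho ^+ K i * bessel (K i) ((m i).2 * t)) else 0.
have T := @trigonometric_vanish n K (fun i => if (m i).1.2.2 then 0 else V i)
  (fun i => if (m i).1.2.2 then V i else 0).
have {T} [] := T _ k0.
  move=> u; pose z : 'rV[R]_2 := \row_j (if j == 0 then rho * cos u else rho * sin u).
  have e : (\sum_i c i *: disc_sum_mode (m i)) b0 z = 0 by rewrite Hc.
  rewrite -[RHS]e !fct_sumE; apply: eq_bigr => i _.
  rewrite -[(c i *: _) b0 z]/(c i * disc_sum_mode (m i) b0 z).
  rewrite /GRing.scale/= /disc_sum_mode /V eq_sym; case: eqP => [bi|]; last first.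
    by move=> _; rewrite if_same !mul0r mulr0 addr0.
  rewrite disc_mode_polar ?rho0// rho2 /K.
  by case: ((m i).1.2.2); rewrite /= mul0r mul1r ?add0r ?addr0 -?mulrA.
move=> HA HB.
have HV : \sum_(i | K i == k0) (if (m i).1.2.2 == s0 then V i else 0) = 0.
  case: (boolP s0) => s0E.
    rewrite -[RHS]HB; first by apply: eq_bigr => i _; case: ((m i).1.2.2).
    rewrite lt0n; apply/eqP => k00; have := mc i0 k00.
    by rewrite -/s0 s0E.
  by rewrite -[RHS]HA; apply: eq_bigr => i _; case: ((m i).1.2.2).
have rk : rho ^+ k0 != 0 by rewrite expf_neq0 ?gt_eqF.
apply: (mulfI rk); rewrite mulr0 -[RHS]HV [in RHS]big_mkcond mulr_sumr; apply: eq_bigr => i _.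
rewrite /w /V /K.
have -> : ((m i).1.2 == (k0, s0)) = ((m i).1.2.1 == k0) && ((m i).1.2.2 == s0) by [].
case: ((m i).1.2.1 =P k0) => [->|_]; case: ((m i).1.1 == b0);
  by case: ((m i).1.2.2 == s0); rewrite /= ?mul0r ?mulr0// mulrCA.
Qed.

(** Supplies the component of a mode on the disc where it is not supported. *)
Lemma zero_eigenfunction R0 mu : disc_eigenfunction R0 mu (cst 0 : 'rV[R]_2 -> R).
Proof.
have P (i : 'I_2) : partial i (cst 0 : 'rV[R]_2 -> R) = cst 0.
  by apply/funext => z; rewrite /partial derive_cst.
split => // [z|z _]; first exact: cst_continuous.
split; last by rewrite big1 ?oppr0 ?mulr0// => i _; rewrite !P.
by move=> i j; rewrite !P; split; [exact: derivable_cst..|exact: cst_continuous].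
Qed.

Lemma lambda_discs_le n (m : 'I_n -> bool * (nat * bool) * R) lam :
  injective m -> (forall i, (m i).1.2.1 = 0%N -> (m i).1.2.2 = false) ->
  (forall i, bessel (m i).1.2.1 ((m i).2 * r (m i).1.1 ^+ 2) = 0) ->
  (forall i, (m i).2 <= lam) ->
  (lambda_discs (r true) (r false) n <= lam%:E)%E.
Proof.
move=> mI mc mz ml; apply: ereal_inf_lbound; exists lam => //.
exists (fun i => disc_sum_mode (m i)); split; first exact: disc_sum_mode_lin_indep.
move=> i; exists (m i).2; first exact: ml.
have H b : disc_eigenfunction (r b) (m i).2 (disc_sum_mode (m i) b).
  rewrite /disc_sum_mode; case: eqP => [->|_]; last exact: zero_eigenfunction.
  exact: disc_mode_eigenfunction.
by split.
Qed.

(** In the variable [Num.sqrt lam] times the radius, each cell satisfies the condition of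
    [bessel_sturm] and contains a zero [z], which gives the eigenvalue [(z / r b) ^+ 2 <= lam].
    Different cells give different zeros, hence different modes. The band touching the centre is
    omitted. *)
Lemma lambda_discs_le_of_partition lam (N K j : nat) :
  0 < lam -> (0 < N)%N ->
  let n b k i := Num.truncn (r b / N%:R / pi * radial_freq lam (r b / N%:R * i%:R) k) in
  (j <= (\sum_(k < K) \sum_(i < N | (0 < i)%N) n true k.+1 i).*2 +
        (\sum_(k < K) \sum_(i < N | (0 < i)%N) n false k.+1 i).*2)%N ->
  (lambda_discs (r true) (r false) j <= lam%:E)%E.
Proof.
move=> lam0 N0 n jn.
have NR : 0 < N%:R :> R by rewrite ltr0n.
have h0 b : 0 < r b / N%:R by rewrite divr_gt0.
pose w := Num.sqrt lam.
have w0 : 0 < w by rewrite sqrtr_gt0.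
pose good i := (0 < i)%N.
pose cl b k (x : nat * nat) := w * cell_left (n b k) (r b / N%:R) x.
pose cr b k (x : nat * nat) := w * cell_right (n b k) (r b / N%:R) x.
have zE b k (x : nat * nat) : exists z : R, x \in cells good (n b k) N ->
    cl b k x <= z < cr b k x /\ bessel k (z ^+ 2) = 0.
  have [xc|] := boolP (x \in cells good (n b k) N); last by exists 0.
  have := xc; rewrite mem_cells => /and3P[xN gx xn].
  have x10 : 0 < x.1%:R :> R by rewrite ltr0n.
  set mi := r b / N%:R * x.1%:R.
  have m0 : 0 < mi by rewrite mulr_gt0.
  have cl0 : w * mi <= cl b k x by rewrite ler_pM2l// cell_left_ge.
  have clp : 0 < cl b k x by rewrite (lt_le_trans _ cl0)// mulr_gt0.
  have wd : 0 < cr b k x - cl b k x by rewrite /cr /cl -mulrBr mulr_gt0// subr_gt0 cell_lt.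
  have n0 : 0 < (n b k x.1)%:R :> R by rewrite ltr0n (leq_ltn_trans _ xn).
  have [|z zx bz] := bessel_sturm clp wd (k := k); last first.
    by exists z => _; split; rewrite // -[cr b k x](subrK (cl b k x)) addrC.
  set f := radial_freq lam mi k.
  have nle : (n b k x.1)%:R <= r b / N%:R / pi * f.
    by rewrite truncn_le mulr_ge0 ?sqrtr_ge0// divr_ge0 ?pi_ge0 ?ltW.
  have f0 : 0 < f.
    by move: (lt_le_trans n0 nle); rewrite pmulr_rgt0// divr_gt0 ?pi_gt0.
  have f2 : f ^+ 2 = lam - k%:R ^+ 2 / mi ^+ 2.
    by rewrite sqr_sqrtr// ltW// -sqrtr_gt0.
  have w2 : w ^+ 2 = lam by rewrite sqr_sqrtr// ltW.
  have pih : pi / (cr b k x - cl b k x) <= f / w.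
    rewrite /cr /cl -mulrBr cell_width; move: nle (pi_gt0 R); move: (pi : R) => pp nle pp0.
    have e1 : (n b k x.1)%:R * pp <= r b / N%:R * f.
      by move: nle; rewrite mulrAC ler_pdivlMr.
    rewrite ler_pdivlMr// (_ : _ / _ * w = (n b k x.1)%:R * pp / (r b / N%:R)); last first.
      have rb0 := r0 b.
      by field; rewrite !gt_eqF.
    by rewrite ler_pdivrMr// [leRHS]mulrC.
  have pih0 : 0 <= pi / (cr b k x - cl b k x) by rewrite divr_ge0 ?pi_ge0 ?ltW.
  apply: (@le_trans _ _ ((f / w) ^+ 2)).
    by rewrite lerXn2r ?nnegrE// (le_trans pih0).
  rewrite expr_div_n f2 w2 mulrBl divff ?gt_eqF// lerB//.
  have k2 : 0 <= k%:R ^+ 2 :> R by exact: sqr_ge0.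
  have mw0 : 0 < mi * w by rewrite mulr_gt0.
  rewrite -[leRHS]mulrA -invfM -w2 -exprMn; apply: (ler_wpM2l k2).
  rewrite lef_pV2 ?posrE ?exprn_gt0//.
  by rewrite lerXn2r ?nnegrE ?(ltW clp) ?(ltW mw0)// mulrC.
have /choice[z zP] : forall bkx : bool * nat * (nat * nat), exists z : R,
    bkx.2 \in cells good (n bkx.1.1 bkx.1.2) N ->
    cl bkx.1.1 bkx.1.2 bkx.2 <= z < cr bkx.1.1 bkx.1.2 bkx.2 /\ bessel bkx.1.2 (z ^+ 2) = 0.
  by move=> [[b k] x]; exact: zE.
pose bools := [:: true; false].
pose base := [seq (b, kc) | b <- bools, kc <- [seq (k.+1, c) | k <- iota 0 K, c <- bools]].
pose pairs := [seq (y, x) | y <- base, x <- cells good (n y.1 y.2.1) N].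
pose mode (y : (bool * (nat * bool)) * (nat * nat)) := (y.1, (z ((y.1.1, y.1.2.1), y.2) / r y.1.1) ^+ 2).
pose modes := map mode pairs.
have size_pairs : size pairs =
    ((\sum_(k < K) \sum_(i < N | (0 < i)%N) n true k.+1 i).*2 +
        (\sum_(k < K) \sum_(i < N | (0 < i)%N) n false k.+1 i).*2)%N.
  rewrite size_allpairs_dep sumnE big_map; under eq_bigr do rewrite size_cells.
  have E b : (\sum_(kc <- [seq (k.+1, c) | k <- iota 0 K, c <- bools])
      \sum_(i < N | good i) n b kc.1 i =
      (\sum_(k < K) \sum_(i < N | (0 < i)%N) n b k.+1 i).*2)%N.
    rewrite big_allpairs_dep/=.
    rewrite -(big_mkord xpredT (fun k => \sum_(i < N | good i) n b k.+1 i)%N).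
    rewrite /index_iota subn0 -mul2n big_distrr/=; apply: eq_bigr => k _.
    by rewrite !big_cons big_nil addn0 mul2n addnn.
  by rewrite big_allpairs_dep/= !big_cons big_nil addn0 !E.
have memP y x : (y, x) \in pairs -> (0 < y.2.1)%N /\ x \in cells good (n y.1 y.2.1) N.
  move=> /allpairsPdep[y' [x' [+ xc [-> ->]]]] => yb; split=> //; move: yb.
  by move=> /allpairsP[[b kc] [_ /allpairsP[[k c] [_ _ /= ->]] ->]].
have zpos y x : (y, x) \in pairs -> 0 < z ((y.1, y.2.1), x).
  move=> /memP[k0 xc]; have [/andP[+ _] _] := zP ((y.1, y.2.1), x) xc.
  apply: lt_le_trans; move: xc; rewrite mem_cells => /and3P[_ x10 _].
  by rewrite mulr_gt0// (lt_le_trans _ (cell_left_ge _ (h0 _) _))// mulr_gt0// ltr0n.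
have uniq_modes : uniq modes.
  rewrite map_inj_in_uniq.
    apply: allpairs_uniq_dep.
    - apply: allpairs_uniq => //; last by move=> [? ?] [? ?].
      by apply: allpairs_uniq; rewrite ?iota_uniq// => -[? ?] [? ?] _ _ /= [-> ->].
    - by move=> y _; exact: uniq_cells.
    - by move=> [y x] [y' x'] _ _ /= [-> ->].
  move=> [y x] [y' x'] yx yx' [yy' zz]; rewrite -yy' in yx' zz *; congr pair.
  have zz' : z ((y.1, y.2.1), x) = z ((y.1, y.2.1), x').
    have /eqP := zz; rewrite eqrXn2//; first by move=> /eqP/divIf; apply; rewrite gt_eqF.
    - by rewrite divr_ge0// ltW// zpos.
    - by rewrite divr_ge0// ltW// zpos.
  apply/eqP; apply: contraT => xx'.
  have [_ xc] := memP _ _ yx; have [_ xc'] := memP _ _ yx'.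
  have [/andP[l1 r1] _] := zP ((y.1, y.2.1), x) xc.
  have [/andP[l2 r2] _] := zP ((y.1, y.2.1), x') xc'.
  move: xc xc'; rewrite !mem_cells => /and3P[_ _ xn] /and3P[_ _ xn'].
  have := cells_disjoint (h0 y.1) xn xn' xx'.
  move=> /orP[]; rewrite -(ler_pM2l w0) => H.
    by move: (lt_le_trans r1 (le_trans H l2)); rewrite zz' ltxx.
  by move: (lt_le_trans r2 (le_trans H l1)); rewrite zz' ltxx.
have sizeE : size modes = size pairs by rewrite size_map.
have jlt (i : 'I_j) : (i < size modes)%N by rewrite sizeE size_pairs (leq_trans (ltn_ord i)).
pose d : bool * (nat * bool) * R := (true, (0%N, true), 0).
have modesP m : m \in modes -> [/\ (0 < m.1.2.1)%N, bessel m.1.2.1 (m.2 * r m.1.1 ^+ 2) = 0 & m.2 <= lam].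
  move=> /mapP[[y x] yx ->] /=; have [k0 xc] := memP _ _ yx; split => //.
    have [_] := zP ((y.1, y.2.1), x) xc.
    by rewrite -exprMn divfK ?gt_eqF.
  have [/andP[_ zr] _] := zP ((y.1, y.2.1), x) xc.
  rewrite -[leRHS](sqr_sqrtr (ltW lam0)) lerXn2r ?nnegrE ?sqrtr_ge0//.
    by rewrite divr_ge0// ltW// zpos.
  rewrite ler_pdivrMr// (le_trans (ltW zr))// ler_pM2l//.
  move: xc; rewrite mem_cells => /and3P[xN _ xn].
  rewrite (le_trans (cell_right_le (h0 _) xn))// mulrAC ler_pdivrMr// ler_pM2l//.
  by rewrite ler_nat.
apply: (@lambda_discs_le j (fun i => nth d modes i)).
- by move=> i i' /eqP; rewrite nth_uniq// => /eqP; exact: val_inj.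
- move=> i k0; have [] := modesP _ (mem_nth d (jlt i)).
  by rewrite k0.
- by move=> i; have [] := modesP _ (mem_nth d (jlt i)).
- by move=> i; have [] := modesP _ (mem_nth d (jlt i)).
Qed.

(** The concentric bands have radii [r b / N * i], and the sum of the [i < N] gives [r b ^+ 2 / 2],
    the area divided by [2 * pi], up to the factor [1 - 1 / N]. *)
Lemma weyl_discs_upper del : 0 < del < 1 ->
  exists2 lam0 : R, 0 < lam0 & forall lam j, lam0 <= lam ->
    j%:R <= (1 - del) * weyl_density R * lam * ((r true ^+ 2 + r false ^+ 2) / 2) ->
    (lambda_discs (r true) (r false) j <= lam%:E)%E.
Proof.
move=> /andP[del0 del1]; set d := del / 2.
have d0 : 0 < d by rewrite divr_gt0.
(* With [1 / N <= d], the losses by truncation and by discretization leave the factor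
   [(1 - d) ^+ 2 >= 1 - del]. *)
set N := (Num.truncn d^-1).+1.
have NR : 0 < N%:R :> R by rewrite ltr0n.
have Nd : N%:R^-1 <= d.
  by rewrite -[leRHS]invrK lef_pV2 ?posrE ?invr_gt0// ltW// truncnS_gt.
set rmin := Num.min (r true) (r false); set rmax := Num.max (r true) (r false).
have rb b : rmin <= r b <= rmax.
  by case: b; rewrite ge_min le_max lexx ?orbT.
have rmin0 : 0 < rmin by rewrite lt_min !r0.
have h0 : 0 < rmin / N%:R by rewrite divr_gt0.
have [lam0 lam00 H] := truncn_mode_count_ge d0 h0 h0.
exists lam0 => // lam j lamlam0 jle.
have lam_gt0 : 0 < lam by rewrite (lt_le_trans lam00).
set K := Num.truncn (rmax * Num.sqrt lam).
pose n b k i := Num.truncn (r b / N%:R / pi * radial_freq lam (r b / N%:R * i%:R) k).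
apply: (@lambda_discs_le_of_partition lam N K) => //.
rewrite -(ler_nat R) natrD (le_trans jle)// [_ / 2]mulrDl mulrDr.
suff Hb b : (1 - del) * weyl_density R * lam * (r b ^+ 2 / 2) <=
    ((\sum_(k < K) \sum_(i < N | (0 < i)%N) n b k.+1 i).*2)%:R by exact: lerD.
have [rb1 rb2] := andP (rb b).
rewrite (double_sum_exchange K N (leq 1) (fun k => n b k.+1)) natr_sum.
apply: (@le_trans _ _ (\sum_(i < N | (0 < i)%N)
    (1 - d) * weyl_density R * lam * (r b / N%:R * (r b / N%:R * i%:R)))); last first.
  apply: ler_sum => i i0; apply: H => //.
  - by rewrite ler_pM2r ?invr_gt0.
  - rewrite (@le_trans _ _ (r b / N%:R))//; first by rewrite ler_pM2r ?invr_gt0.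
    by rewrite ler_peMr ?ler1n// divr_ge0// ltW.
  - rewrite ltW// (le_lt_trans _ (truncnS_gt _))// ler_wpM2r ?sqrtr_ge0//.
    rewrite (le_trans _ rb2)// mulrAC -mulrA ler_piMr ?(ltW (r0 b))//.
    by rewrite ler_pdivrMr// mul1r ler_nat ltnW.
have sumE : \sum_(i < N | (0 < i)%N) i%:R = N%:R * (N%:R - 1) / 2 :> R.
  rewrite -(big_mkord (fun i => 0 < i)%N (fun i => i%:R)) big_mkcond/=.
  elim: N {NR Nd h0 H n rb1 rb2 jle lamlam0 K} => [|M IHM].
    by rewrite big_geq// mul0r mul0r.
  rewrite big_nat_recr//= IHM -natr1; case: M {IHM} => [|M].
    by rewrite ltnn subrr mulr0 !mul0r addr0.
  by rewrite /= -natr1; field.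
have E i : (1 - d) * weyl_density R * lam * (r b / N%:R * (r b / N%:R * i%:R)) =
    (1 - d) * weyl_density R * lam * (r b / N%:R) ^+ 2 * i%:R by ring.
under eq_bigr do rewrite E.
rewrite -mulr_sumr sumE.
have -> : (1 - d) * weyl_density R * lam * (r b / N%:R) ^+ 2 * (N%:R * (N%:R - 1) / 2) =
    (1 - d) * (1 - N%:R^-1) * (weyl_density R * lam * (r b ^+ 2 / 2)).
  by field; rewrite gt_eqF.
set M := weyl_density R * lam * (r b ^+ 2 / 2).
have M0 : 0 <= M.
  have W0 := ltW (weyl_density_gt0 R).
  by rewrite (mulr_ge0 (mulr_ge0 W0 (ltW lam_gt0)))// divr_ge0 ?sqr_ge0.
rewrite (_ : (1 - del) * weyl_density R * lam * (r b ^+ 2 / 2) = (1 - del) * M); last by rewrite /M; ring.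
apply: ler_wpM2r => //.
have d1 : 0 <= 1 - d by rewrite /d; lra.
have : (1 - d) * (1 - d) <= (1 - d) * (1 - N%:R^-1) by rewrite ler_wpM2l// lerB.
by apply: le_trans; have := sqr_ge0 d; rewrite expr2 /d; lra.
Qed.

End independence.

(** * Polygons and compactness *)

Lemma ae_lebesgue_notin (R : realType) (s : seq R) :
  {ae (@lebesgue_measure R), forall t, t \notin s}.
Proof.
elim: s => [|x s IHs]; first exact: aeW.
apply: ae_lebesgueS (ae_lebesgueI (ae_lebesgue_neq x) IHs) => t [tx ts].
by rewrite inE negb_or tx.
Qed.

Section polygon.
Variables (R : realType) (z : nat -> R * R) (n : nat).
Notation mu := (@lebesgue_measure R).
Implicit Types (i j m : nat) (t x y : R).

Definition edge i : R := norm2 (z i.+1 - z i).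

Definition edge_sum m : R := \sum_(i < m) edge i.

(* The length of the part of the [i]-th edge run through at arclength [x]; for an
   edge of length [0] the junk value [covered i x / edge i = 0] is harmless. *)
Let covered i x : R := Num.min (Num.max (x - edge_sum i) 0) (edge i).

Let partial_path m x : R * R :=
  z 0%N + \sum_(i < m) (covered i x / edge i) *: (z i.+1 - z i).

Definition polygon t : R * R := partial_path n (edge_sum n * t).

Let edge_ge0 i : 0 <= edge i. Proof. exact: norm2_ge0. Qed.

Let edge_sumS m : edge_sum m.+1 = edge_sum m + edge m.
Proof. by rewrite /edge_sum big_ord_recr. Qed.

Let edge_sum_le i j : (i <= j)%N -> edge_sum i <= edge_sum j.
Proof.
elim: j => [|j IHj]; first by rewrite leqn0 => /eqP ->.
rewrite leq_eqVlt => /predU1P[->//|/IHj ij].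
by rewrite edge_sumS (le_trans ij)// lerDl.
Qed.

Lemma edge_sum_ge0 m : 0 <= edge_sum m.
Proof. by apply: sumr_ge0. Qed.

Let covered_sum m x : \sum_(i < m) covered i x = Num.min (Num.max x 0) (edge_sum m).
Proof.
elim: m => [|m IHm].
  by rewrite /edge_sum !big_ord0 min_r// le_max lexx orbT.
rewrite big_ord_recr/= IHm edge_sumS /covered.
have := edge_sum_ge0 m; have := edge_ge0 m.
move: (edge_sum m) (edge m) => S e e0 S0.
rewrite /Num.max /Num.min; do ![case: ifP => //=]; lra.
Qed.

Let covered_le i x y : x <= y -> covered i x <= covered i y.
Proof.
move=> xy; rewrite /covered /Num.max /Num.min; do ![case: ifP => //=]; lra.
Qed.

Let unit_edge i : norm2 ((edge i)^-1 *: (z i.+1 - z i)) <= 1.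
Proof.
rewrite (norm2_scale (edge i)^-1 (z i.+1 - z i)) ger0_norm ?invr_ge0// -/(edge i).
have [->|e0] := eqVneq (edge i) 0; first by rewrite mulr0.
by rewrite mulVf.
Qed.

Let norm2_sum (r : nat) (F : nat -> R * R) :
  norm2 (\sum_(i < r) F i) <= \sum_(i < r) norm2 (F i).
Proof.
elim: r => [|r IHr]; first by rewrite !big_ord0 norm2_0.
by rewrite !big_ord_recr/= (le_trans (norm2D _ _))// lerD2r.
Qed.

(** The covered parts of the edges add up to the arclength, so the triangle inequality can be
    applied edge by edge. *)
Let partial_path_dist m x y : x <= y -> 0 <= x -> y <= edge_sum m ->
  norm2 (partial_path m y - partial_path m x) <= y - x.
Proof.
move=> xy x0 ym; rewrite /partial_path opprD addrACA subrr add0r -sumrB.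
have -> : y - x = \sum_(i < m) (covered i y - covered i x).
  have y0 := le_trans x0 xy.
  by rewrite sumrB !covered_sum !max_l// !min_l// (le_trans xy).
have h1 := norm2_sum m (fun i => (covered i y / edge i) *: (z i.+1 - z i) -
    (covered i x / edge i) *: (z i.+1 - z i)).
apply: (le_trans h1); apply: ler_sum => i _.
rewrite -scalerBl -mulrBl -scalerA.
have := norm2_scale (covered i y - covered i x) ((edge i)^-1 *: (z i.+1 - z i)).
rewrite -/((covered i y - covered i x) *: _) => ->.
by rewrite ger0_norm ?subr_ge0 ?covered_le// ler_piMr// subr_ge0 covered_le.
Qed.

Let edge_scale i : (edge i / edge i) *: (z i.+1 - z i) = z i.+1 - z i.
Proof.
have [e0|e0] := eqVneq (edge i) 0; last by rewrite divff// scale1r.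
by rewrite (norm2_eq0 e0) scaler0.
Qed.

Let partial_path_vertex m x : edge_sum m <= x -> partial_path m x = z m.
Proof.
elim: m => [|m IHm] mx; first by rewrite /partial_path big_ord0 addr0.
rewrite /partial_path big_ord_recr/= addrA -/(partial_path m x).
have mx' := le_trans (edge_sum_le (leqnSn m)) mx.
rewrite IHm//; have -> : covered m x = edge m.
  by rewrite /covered min_r// le_max lerBrDl -edge_sumS mx.
by rewrite edge_scale addrC subrK.
Qed.

Let partial_pathE j m x : (j < m)%N -> edge_sum j <= x <= edge_sum j.+1 ->
  partial_path m x = z j + ((x - edge_sum j) / edge j) *: (z j.+1 - z j).
Proof.
move=> jm /andP[jx xj]; elim: m jm => // m IHm.
rewrite ltnS leq_eqVlt /partial_path big_ord_recr/= addrA -/(partial_path m x).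
move=> /predU1P[jE|jm]; last first.
  rewrite IHm// (_ : covered m x = 0) ?mul0r ?scale0r ?addr0//.
  rewrite /covered max_r ?min_l// subr_le0 (le_trans xj)//.
  exact: edge_sum_le.
rewrite -jE partial_path_vertex//; congr (_ + (_ / _) *: _).
by rewrite /covered max_l ?subr_ge0// min_l// lerBlDl -edge_sumS.
Qed.

Let vertex_between m x : 0 <= x <= edge_sum m -> (0 < m)%N ->
  exists2 j, (j < m)%N & edge_sum j <= x <= edge_sum j.+1.
Proof.
elim: m => // -[|m] IHm /andP[x0 xm] _.
  by exists 0%N => //; rewrite /edge_sum big_ord0 x0.
have [xm'|xm'] := leP x (edge_sum m.+1).
  by have [|//|j jm jx] := IHm; [rewrite x0|exists j => //; exact: ltnW].
by exists m.+1 => //; rewrite (ltW xm').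
Qed.

Hypotheses (n0 : (0 < n)%N) (zpos : forall i, (i <= n)%N -> 0 < (z i).1).
Hypothesis z_neq : z 0%N <> z n.

Let partial_path0 : partial_path n 0 = z 0%N.
Proof.
rewrite (@partial_pathE 0 n)//.
  by rewrite [X in (_ - X)]/edge_sum big_ord0 subrr mul0r scale0r addr0.
by rewrite edge_sum_ge0 andbT /edge_sum big_ord0.
Qed.

Lemma edge_sum_gt0 : 0 < edge_sum n.
Proof.
rewrite lt_neqAle eq_sym edge_sum_ge0 andbT; apply/eqP => s0; apply: z_neq.
by rewrite -partial_path0 partial_path_vertex// s0.
Qed.

Let edge_index t : 0 <= t <= 1 ->
  exists2 j, (j < n)%N & edge_sum j <= edge_sum n * t <= edge_sum j.+1.
Proof.
move=> /andP[t0 t1]; apply: vertex_between => //.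
by rewrite mulr_ge0 ?edge_sum_ge0//= ler_piMr ?edge_sum_ge0.
Qed.

Let polygon_between j t : (j < n)%N -> edge_sum j <= edge_sum n * t <= edge_sum j.+1 ->
  exists2 c, 0 <= c <= 1 & polygon t = z j + c *: (z j.+1 - z j).
Proof.
move=> jn jt; exists ((edge_sum n * t - edge_sum j) / edge j); last exact: partial_pathE.
move: jt; rewrite edge_sumS => /andP[h1 h2].
rewrite divr_ge0 ?subr_ge0//=.
have [->|e0] := eqVneq (edge j) 0; first by rewrite invr0 mulr0.
have e1 : 0 < edge j by rewrite lt_neqAle eq_sym e0 edge_ge0.
by rewrite ler_pdivrMr// mul1r lerBlDl.
Qed.

Lemma polygon_le j t : (j < n)%N -> edge_sum j <= edge_sum n * t <= edge_sum j.+1 ->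
  Num.min (z j).1 (z j.+1).1 <= (polygon t).1 <= Num.max (z j).1 (z j.+1).1.
Proof.
move=> jn /(polygon_between jn)[c /andP[c0 c1] ->] /=.
move: (z j).1 (z j.+1).1 => x y; rewrite /GRing.scale/=.
rewrite ge_min le_max; apply/andP; split.
  by case: (leP x y) => xy; apply/orP; [left|right]; nra.
by case: (leP x y) => xy; apply/orP; [right|left]; nra.
Qed.

(** Makes polygons admissible competitors: the speed is constant except at the finitely many
    parameters of the vertices. *)
Lemma polygon_meridian : meridian_of_speed (z 0%N) (z n) polygon (edge_sum n).
Proof.
have s0 := edge_sum_gt0.
have dist s t : 0 <= s <= 1 -> 0 <= t <= 1 ->
    norm2 (polygon s - polygon t) <= edge_sum n * `|s - t|.
  move=> s01 t01; wlog st : s t s01 t01 / s <= t.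
    move=> H; have [/H|/ltW/H] := leP s t; first exact.
    by rewrite -norm2_opp opprB distrC; exact.
  rewrite -norm2_opp opprB distrC ger0_norm ?subr_ge0// mulrBr.
  case/andP: s01 => s1 s2; case/andP: t01 => t1 t2.
  apply: partial_path_dist; first by rewrite ler_pM2l.
    by rewrite mulr_ge0// ltW.
  by rewrite ler_piMr// ltW.
split.
- apply: (@lipschitz01I _ _ _ (edge_sum n)) => s t s01 t01.
  by rewrite (le_trans (norm_le_norm2 _))// dist.
- exact: ltW.
- move=> t /edge_index[j jn /(polygon_le jn)/andP[+ _]].
  by apply: lt_le_trans; rewrite lt_min !zpos// ltnW.
- split; last by rewrite /polygon mulr1 partial_path_vertex.
  by rewrite /polygon mulr0 partial_path0.
pose vertices := [seq edge_sum i / edge_sum n | i <- iota 0 n.+1].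
apply: ae_lebesgueS (ae_lebesgue_notin vertices) => t tv t01.
have [j jn jt] := edge_index t01.
have tne i : (i <= n)%N -> edge_sum n * t != edge_sum i.
  move=> iN; apply: contra tv => /eqP ti; apply/mapP; exists i.
    by rewrite mem_iota.
  by rewrite -ti mulrAC divff ?mul1r// gt_eqF.
have jt' : edge_sum j < edge_sum n * t < edge_sum j.+1.
  case/andP: jt => h1 h2; rewrite !lt_neqAle h1 h2 !andbT eq_sym.
  by rewrite !tne// ltnW.
have e0 : 0 < edge j.
  by case/andP: jt' => h1 h2; have := lt_trans h1 h2; rewrite edge_sumS ltrDl.
set d := z j.+1 - z j; pose k := edge_sum n / edge j.
have nearE : \forall s \near t, z j + ((edge_sum n * s - edge_sum j) / edge j) *: d = polygon s.
  case/andP: jt' => h1 h2.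
  have c1 : t < edge_sum j.+1 / edge_sum n by rewrite ltr_pdivlMr// mulrC.
  have c2 : edge_sum j / edge_sum n < t by rewrite ltr_pdivrMr// mulrC.
  near=> s; rewrite /polygon (@partial_pathE j)//; apply/andP; split; apply/ltW.
    by rewrite mulrC -ltr_pdivrMr//; near: s; exact: lt_nbhsr.
  by rewrite mulrC -ltr_pdivlMr//; near: s; exact: lt_nbhsl.
have D (x c : R) : is_derive t 1 (fun s => x + (edge_sum n * s - edge_sum j) / edge j * c) (k * c).
  by apply: is_derive_eq; rewrite /GRing.scale/= /k; field; rewrite gt_eqF.
have D1 : is_derive t 1 (fun s => (polygon s).1) (k * d.1).
  by apply: near_eq_is_derive (D (z j).1 d.1); apply: filterS nearE => s <-.
have D2 : is_derive t 1 (fun s => (polygon s).2) (k * d.2).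
  by apply: near_eq_is_derive (D (z j).2 d.2); apply: filterS nearE => s <-.
rewrite /speed (derive1_pair D1 D2).
have := norm2_scale k d; rewrite /norm2 => ->.
rewrite ger0_norm ?divr_ge0 ?edge_sum_ge0// -/(norm2 d) -/(edge j).
by rewrite /k divfK ?gt_eqF.
Unshelve. all: end_near. Qed.

Lemma area_polygon_le :
  area polygon <= 2 * pi * \sum_(j < n) Num.max (z j).1 (z j.+1).1 * edge j.
Proof.
have s0 := edge_sum_gt0; have M := polygon_meridian.
rewrite (area_axis_dist M) ler_pM2l ?mulr_gt0 ?pi_gt0//.
have bP := bounded_measurable_axis_dist M.
have := @Rintegral_sum_itv R (axis_dist polygon) (fun j => edge_sum j / edge_sum n) n bP.
rewrite divff ?gt_eqF// [X in X / _]/edge_sum big_ord0 mul0r => ->; last first.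
  by move=> j; rewrite ler_pM2r ?invr_gt0// edge_sum_le.
rewrite mulr_sumr; apply: ler_sum => j _.
have -> : Num.max (z j).1 (z j.+1).1 * edge j = edge_sum n *
    (Num.max (z j).1 (z j.+1).1 * (edge_sum j.+1 / edge_sum n - edge_sum j / edge_sum n)).
  by rewrite edge_sumS; field; rewrite gt_eqF.
have jj : edge_sum j / edge_sum n <= edge_sum j.+1 / edge_sum n.
  by rewrite ler_pM2r ?invr_gt0// edge_sum_le.
rewrite ler_pM2l// -Rintegral_cst_itv//.
apply: le_Rintegral_itv => //; first exact: bounded_measurable_cst.
move=> t /andP[jt tj]; have t01 : 0 <= t <= 1.
  rewrite (le_trans _ jt) ?divr_ge0 ?edge_sum_ge0//= (le_trans tj)//.
  by rewrite ler_pdivrMr// mul1r edge_sum_le.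
rewrite /axis_dist clamp01_id//.
have jt' : edge_sum j <= edge_sum n * t <= edge_sum j.+1.
  by rewrite ![_ * t]mulrC -ler_pdivrMr// jt -ler_pdivlMr.
by have /andP[] := polygon_le (ltn_ord j) jt'.
Qed.

End polygon.

Lemma Rintegral_eq0_ae (R : realType) (f : R -> R) (s t : R) : bounded_measurable f ->
  (forall x, 0 <= f x) -> \int[@lebesgue_measure R]_(x in `[s, t]) f x = 0 ->
  {ae (@lebesgue_measure R), forall x, s <= x <= t -> f x = 0}.
Proof.
move=> bf f0 If0; have If := @integrable_bounded_measurable R f true false s t bf.
have E : (\int[@lebesgue_measure R]_(x in `[s, t]) (f x)%:E = 0)%E.
  by rewrite -[LHS]fineK ?(integrable_fin_num _ If)//; congr EFin.
have mf : measurable_fun `[s, t] (EFin \o f).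
  by apply/measurable_EFinP; apply: measurable_funTS; case: bf.
have [+ _] := ae_eq_integral_abs (@lebesgue_measure R) (measurable_itv `[s, t]) mf.
move=> /(_ _)[|N [mN N0 HN]].
  by rewrite -[RHS]E; apply: eq_integral => x _ /=; rewrite ger0_norm.
exists N; split => // x /= nx; apply: HN => /= H; apply: nx => st.
by have := H; rewrite in_itv/= => /(_ st) [].
Qed.

(** * Minimality tested on inscribed polygons *)

Section polygonal_comparison.
Variable R : realType.
Notation mu := (@lebesgue_measure R).
Variables (p q : R * R) (A L : R) (a : R -> R * R) (g1 g2 : R -> R).
Hypotheses (pq : p <> q) (minA : forall b, meridian p q b -> A <= area b).
Hypotheses (L0 : 0 <= L)
  (aL : forall s t, 0 <= s <= 1 -> 0 <= t <= 1 -> norm2 (a s - a t) <= L * `|s - t|)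
  (apos : forall t, 0 <= t <= 1 -> 0 < (a t).1) (a0 : a 0 = p) (a1 : a 1 = q).
Hypothesis ga : curve_density a g1 g2.

Let F t := (a (clamp01 t)).1.
Let G t := norm2 (g1 t, g2 t).

Let bF : bounded_measurable F.
Proof.
have L1 : 0 < L + 1 by rewrite ltr_wpDl.
apply: (@bounded_measurable_clamp01 _ (fun t => (a t).1) _ L1) => s t s01 t01.
rewrite (le_trans (norm2_abs1 (a s - a t)))// (le_trans (aL s01 t01))//.
by rewrite ler_wpM2r// lerDl.
Qed.

Let bG : bounded_measurable G.
Proof. by case: ga => ? ? _ _ _; exact: bounded_measurable_norm2. Qed.

(** The curve [a] is not known to have constant speed, so [minA] is applied to its inscribed
    polygons. With [n] equal parameter steps, replacing the radius on a chord by that of the curve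
    costs at most [L / n], which tends to [0]. *)
Lemma min_area_le_Rintegral : A <= 2 * pi * \int[mu]_(t in `[0, 1]) (F t * G t).
Proof.
have pi2 : 0 < 2 * pi :> R by rewrite mulr_gt0 ?pi_gt0.
rewrite -ler_pdivrMl// mulrC; set X := \int[mu]_(t in _) _.
set I := \int[mu]_(t in `[0, 1]) G t.
have I0 : 0 <= I by apply: Rintegral_itv_ge0 => t _; exact: norm2_ge0.
have H n : (0 < n)%N -> A / (2 * pi) <= X + L / n%:R * I.
  move=> n0; have nR : 0 < n%:R :> R by rewrite ltr0n.
  pose x i : R := i%:R / n%:R.
  have x01 i : (i <= n)%N -> 0 <= x i <= 1.
    by move=> iN; rewrite divr_ge0//= ler_pdivrMr// mul1r ler_nat.
  pose z i := a (x i).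
  have z0 : z 0%N = p by rewrite /z /x mul0r.
  have zn : z n = q by rewrite /z /x divff ?gt_eqF.
  have zpos i : (i <= n)%N -> 0 < (z i).1 by move=> /x01; exact: apos.
  have zne : z 0%N <> z n by rewrite z0 zn.
  have M := polygon_meridian n0 zpos zne; rewrite z0 zn in M.
  have Apoly := minA (iffRL (meridianP p q _) (ex_intro _ _ M)).
  have := le_trans Apoly (area_polygon_le n0 zpos zne).
  rewrite -ler_pdivrMl// mulrC => /le_trans; apply.
  have xS i : x i <= x i.+1 by rewrite ler_pM2r ?invr_gt0// ler_nat.
  have xE i : x i.+1 - x i = n%:R^-1 by rewrite /x -natr1; field; rewrite gt_eqF.
  have -> : X + L / n%:R * I = \int[mu]_(t in `[0, 1]) (F t * G t + L / n%:R * G t).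
    by rewrite RintegralD_itv ?RintegralZ_itv//; [exact: bounded_measurableM|exact: bounded_measurableZ].
  have bFG : bounded_measurable (fun t => F t * G t + L / n%:R * G t).
    by apply: bounded_measurableD; [exact: bounded_measurableM|exact: bounded_measurableZ].
  have := Rintegral_sum_itv n bFG xS; rewrite /x mul0r divff ?gt_eqF// => ->.
  apply: ler_sum => j _; rewrite -!/(x _).
  have xj := x01 _ (ltnW (ltn_ord j)); have xj1 := x01 _ (ltn_ord j).
  set K := Num.max _ _.
  have K0 : 0 <= K by rewrite le_max ltW// zpos// ltnW.
  have e1 : edge z j <= \int[mu]_(t in `[x j, x j.+1]) G t.
    by apply: chord_le_Rintegral => //; [case/andP: xj|case/andP: xj1].
  apply: (le_trans (ler_wpM2l K0 e1)); rewrite -RintegralZ_itv//.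
  apply: le_Rintegral_itv => //; first exact: bounded_measurableZ.
  move=> t /andP[jt tj]; rewrite -mulrDl ler_wpM2r ?norm2_ge0//.
  have t01 : 0 <= t <= 1.
    by case/andP: xj => h _; case/andP: xj1 => _ h'; rewrite (le_trans h)// (le_trans tj).
  have Fnear i : (i == j :> nat) || (i == j.+1) -> (z i).1 <= F t + L / n%:R.
    move=> ij; have xi01 : 0 <= x i <= 1 by case/orP: ij => /eqP ->.
    rewrite -lerBlDl /F clamp01_id// (le_trans (ler_norm _))//.
    rewrite (le_trans (norm2_abs1 (z i - a t)))// (le_trans (aL xi01 t01))//.
    rewrite ler_wpM2l// -(xE j) ler_norml.
    by case/orP: ij => /eqP ->; apply/andP; split; lra.
  by rewrite ge_max !Fnear ?eqxx ?orbT.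
rewrite leNgt; apply/negP => XA.
set d := A / (2 * pi) - X; have d0 : 0 < d by rewrite subr_gt0.
have := H (Num.truncn (L * I / d)).+1 isT; rewrite -lerBlDl -/d leNgt => /negP; apply.
rewrite mulrAC ltr_pdivrMr ?ltr0n// [ltRHS]mulrC -ltr_pdivrMr//.
exact: truncnS_gt.
Qed.

(** The velocity has norm at most [L] almost everywhere, and the chain of inequalities between [A],
    the area integral and its bound with [L] closes up. The nonnegative defect [F * (L - G)]
    therefore has integral [0], and [F] is positive. *)
Lemma minimizing_speed : 2 * pi * (L * \int[mu]_(t in `[0, 1]) F t) <= A ->
  meridian_of_speed p q a L /\ area a = A.
Proof.
move=> LA; have pi2 : 0 < 2 * pi :> R by rewrite mulr_gt0 ?pi_gt0.
have GL := speed_le L0 ga aL.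
have GL1 : {ae mu, forall t, 0 <= t <= 1 -> G t <= L}.
  apply: ae_lebesgueS (ae_lebesgueI GL (ae_lebesgueI (ae_lebesgue_neq 0) (ae_lebesgue_neq 1))).
  move=> t [H [t0 t1]] /andP[h0 h1]; apply: H.
  by rewrite !lt_neqAle h0 h1 eq_sym t0 t1.
have F0 t : 0 < F t by apply: apos; exact: clamp01_itv.
(* The minimum makes the defect nonnegative at every point, although [G <= L] is known only almost
   everywhere. *)
pose h t := F t * (L - Num.min L (G t)).
have bh : bounded_measurable h.
  apply: bounded_measurableM => //; apply: bounded_measurableB; first exact: bounded_measurable_cst.
  case: bG => mG [M GM]; split; first exact: measurable_minr.
  exists (Num.max `|L| M) => t; rewrite le_max /Num.min; case: ifP => _; first by rewrite lexx.
  by rewrite GM orbT.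
have h0 t : 0 <= h t by rewrite mulr_ge0 ?(ltW (F0 t))// subr_ge0 ge_min lexx.
have bm : bounded_measurable (fun t => Num.min L (G t)).
  case: bG => mG [M GM]; split; first exact: measurable_minr.
  exists (Num.max `|L| M) => t; rewrite le_max /Num.min; case: ifP => _; first by rewrite lexx.
  by rewrite GM orbT.
have hI : \int[mu]_(t in `[0, 1]) h t = 0.
  apply/le_anti/andP; split; last by apply: Rintegral_itv_ge0.
  have -> : \int[mu]_(t in `[0, 1]) h t =
      L * (\int[mu]_(t in `[0, 1]) F t) - \int[mu]_(t in `[0, 1]) (F t * Num.min L (G t)).
    rewrite -RintegralZ_itv// -RintegralB_itv//; [|exact: bounded_measurableZ|exact: bounded_measurableM].
    by congr Rintegral; apply/funext => t; rewrite /h; ring.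
  rewrite subr_le0 -(ler_pM2l pi2) (le_trans LA)// (le_trans min_area_le_Rintegral)//.
  rewrite ler_pM2l//; apply: ae_le_Rintegral_itv; [exact: bounded_measurableM..|].
  apply: ae_lebesgueS GL1 => t H t01; rewrite ler_pM2l//.
  by rewrite le_min H//= lexx.
have M : meridian_of_speed p q a L.
  split=> //.
    have L1 : 0 < L + 1 by rewrite ltr_wpDl.
    apply: (@lipschitz01I _ _ _ (L + 1)) => s t s01 t01.
    rewrite (le_trans (norm_le_norm2 _))// (le_trans (aL s01 t01))//.
    by rewrite ler_wpM2r// lerDl.
  case: ga => _ _ dg _ _; have hae := Rintegral_eq0_ae bh h0 hI.
  apply: ae_lebesgueS (ae_lebesgueI (ae_lebesgueI GL1 hae) (ae_lebesgueI dg
    (ae_lebesgueI (ae_lebesgue_neq 0) (ae_lebesgue_neq 1)))).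
  move=> t [[GLt ht] [dt [t0 t1]]] t01.
  have [_ _ ->] : [/\ is_derive t 1 (fun s => (a s).1) (g1 t),
      is_derive t 1 (fun s => (a s).2) (g2 t) & speed a t = norm2 (g1 t, g2 t)].
    by apply: dt; case/andP: t01 => u0 u1; rewrite !lt_neqAle u0 u1 eq_sym t0 t1.
  have /eqP := ht t01; rewrite mulf_eq0 gt_eqF//= subr_eq0 => /eqP LE.
  have := GLt t01; rewrite -/(G t) => H; apply/le_anti; rewrite H/=.
  by rewrite {1}LE ge_min lexx orbT.
split => //; apply/le_anti; rewrite minA ?andbT; last by apply/meridianP; exists L.
by rewrite (area_meridian M).
Qed.

End polygonal_comparison.

(** * Compactness of families of Lipschitz curves *)

Section curve_compactness.
Variable R : realType.
Implicit Types (s t e : R) (j n : nat).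

(** Tychonoff's theorem yields a cluster point for pointwise convergence. The index set may be
    uncountable, so instead of a subsequence one obtains, for finitely many indices at a time, terms
    arbitrarily far out. *)
Lemma pointwise_cluster (I : eqType) (f : nat -> I -> R) (B : R) :
  (forall j i, `|f j i| <= B) ->
  exists h : I -> R, forall (K : finType) (s : K -> I) (e : R) J, 0 < e ->
    exists2 j, (J <= j)%N & forall k, `|f j (s k) - h (s k)| <= e.
Proof.
move=> fB.
have cK : @compact (prod_topology (fun _ : I => R)) [set g | forall i, `[- B, B]%classic (g i)].
  exact: (@tychonoff I (fun _ => R) (fun _ => `[- B, B]%classic) (fun _ => @segment_compact _ _ _)).
have [|h [_ hcl]] := cK ((f : nat -> prod_topology (fun _ : I => R)) @ \oo).
  by exists 0%N => // j _ i; rewrite /= in_itv/= -ler_norml; exact: fB.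
exists h => K s e J e0.
have N1 : \forall g \near (h : prod_topology (fun _ : I => R)), forall k, `|g (s k) - h (s k)| <= e.
  apply: (@filter_forall _ K (fun k => [set g : prod_topology (fun _ : I => R) |
    `|g (s k) - h (s k)| <= e]) (nbhs (h : prod_topology (fun _ : I => R)))) => k.
  have U : nbhs (h (s k)) [set y : R | `|y - h (s k)| <= e].
    apply: filterS (nbhsx_ballx (h (s k)) e e0) => y.
    by rewrite -ball_normE /= distrC => /ltW.
  exact: (@proj_continuous I (fun _ => R) (s k) h _ U).
have N2 : (f @ \oo) (f @` [set j | (J <= j)%N]).
  by exists J => // j Jj; exists j.
have [_ [[j Jj <-] H]] := hcl _ _ N2 N1.
by exists j.
Qed.

(** The Lipschitz constants are treated as one more coordinate, so that the same [j] approximates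
    both [L1] and the curve. Closeness on a finite grid becomes uniform by the common Lipschitz
    bound. *)
Lemma curve_cluster (a : nat -> R -> R * R) (L : nat -> R) (M : R) :
  (forall j, 0 <= L j <= M) -> (forall j, norm2 (a j 0) <= M) ->
  (forall j s t, 0 <= s <= 1 -> 0 <= t <= 1 ->
    norm2 (a j s - a j t) <= L j * `|s - t|) ->
  exists (b : R -> R * R) (L1 : R),
    [/\ 0 <= L1 <= M,
      forall s t, 0 <= s <= 1 -> 0 <= t <= 1 -> norm2 (b s - b t) <= L1 * `|s - t| &
      forall e J, 0 < e -> exists2 j, (J <= j)%N &
        `|L j - L1| <= e /\ forall t, 0 <= t <= 1 -> norm2 (a j t - b t) <= e].
Proof.
move=> LM a0M aL.
pose f j (i : option (bool * R)) : R := match i with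
  | None => L j
  | Some (true, t) => (a j (clamp01 t)).1
  | Some (false, t) => (a j (clamp01 t)).2
  end.
have fB j i : `|f j i| <= M + M.
  have [L0 L1] := andP (LM j).
  have aM t : norm2 (a j (clamp01 t)) <= M + M.
    have c01 := clamp01_itv t.
    rewrite -[a j _](subrK (a j 0)) (le_trans (norm2D _ _))// lerD//.
    rewrite (le_trans (aL _ _ _ c01 _)) ?lexx ?ler01// subr0 (le_trans _ L1)//.
    by case/andP: c01 => c0 c1; rewrite ger0_norm// ler_piMr.
  case: i => [[[] t]|] /=.
  - by rewrite (le_trans (norm2_abs1 _)).
  - by rewrite (le_trans (norm2_abs2 _)).
  - by rewrite ger0_norm// (le_trans L1)// lerDl (le_trans L0).
have [h Hh] := pointwise_cluster fB.
pose b t := (h (Some (true, t)), h (Some (false, t))).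
pose L1 := h None.
have net n (s : 'I_n -> R) e J : 0 < e -> exists2 j, (J <= j)%N &
    `|L j - L1| <= e /\ forall k, norm2 (a j (clamp01 (s k)) - b (s k)) <= e.
  move=> e0.
  pose s' (k : option (bool * 'I_n)) := if k is Some (c, i) then Some (c, s i) else None.
  (* The Euclidean norm is at most twice the larger coordinate. *)
  have e20 : 0 < e / 2 by rewrite divr_gt0.
  have [j Jj H'] := Hh _ s' (e / 2) J e20.
  exists j => //; split; first by have := H' None; rewrite /=; lra.
  move=> k; rewrite (le_trans (norm2_le_norm _))// -ler_pdivlMl// mulrC prod_normE ge_max.
  by rewrite (H' (Some (true, k))) (H' (Some (false, k))).
have L1M : 0 <= L1 <= M.
  apply/andP; split; apply/ler_addgt0Pr => e e0;
    have [j _ [+ _]] := @net 0%N (fun _ => 0) e 0%N e0; have := LM j;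
    by rewrite ler_norml => /andP[? ?] /andP[]; lra.
have bL s t : 0 <= s <= 1 -> 0 <= t <= 1 -> norm2 (b s - b t) <= L1 * `|s - t|.
  move=> s01 t01; apply/ler_addgt0Pr => e e0.
  have e30 : 0 < e / 3 by rewrite divr_gt0.
  have [j _ [Lj H]] := @net 2 (fun k => if k == 0 then s else t) _ 0%N e30.
  have Hs := H 0; have Ht := H 1; rewrite /= !clamp01_id// in Hs Ht.
  have -> : b s - b t = - (a j s - b s) + (a j t - b t) + (a j s - a j t).
    by rewrite [b s]surjective_pairing [b t]surjective_pairing; congr pair => /=; ring.
  have h1 := norm2D (- (a j s - b s) + (a j t - b t)) (a j s - a j t).
  have h2 := norm2D (- (a j s - b s)) (a j t - b t).
  have h3 := aL j _ _ s01 t01.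
  have st1 : `|s - t| <= 1 by rewrite ler_norml; lra.
  have h4 : L j * `|s - t| <= L1 * `|s - t| + e / 3.
    have : L j * `|s - t| - L1 * `|s - t| <= e / 3 * 1.
      by rewrite -mulrBl (le_trans (ler_norm _))// normrM normr_id ler_pM.
    lra.
  by move: h1 h2 h3 h4; rewrite norm2_opp; lra.
exists b, L1; split=> // e J e0.
have M0 : 0 <= M by case/andP: (LM 0%N) => /le_trans; apply.
have e30 : 0 < e / 3 by rewrite divr_gt0.
pose n := (Num.truncn (M / (e / 3))).+1.
have nR : 0 < n%:R :> R by rewrite ltr0n.
have Mn : M / n%:R <= e / 3.
  by rewrite ler_pdivrMr// mulrC -ler_pdivrMr// ltW// truncnS_gt.
have [j Jj [Lj H]] := @net n.+1 (fun k => k%:R / n%:R) _ J e30.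
exists j => //; split; first by move: Lj; lra.
move=> t t01; pose k := Num.truncn (t * n%:R).
have tn0 : 0 <= t * n%:R by case/andP: t01 => t0 _; rewrite mulr_ge0.
have [k1 k2] : k%:R <= t * n%:R /\ t * n%:R < k.+1%:R.
  by split; [rewrite truncn_le|exact: truncnS_gt].
have kn : (k < n.+1)%N.
  rewrite ltnS -(ler_nat R) (le_trans k1)// ler_piMl ?(ltW nR)//.
  by case/andP: t01.
have u01 : 0 <= (k%:R / n%:R : R) <= 1.
  by rewrite divr_ge0//= ler_pdivrMr// mul1r ler_nat.
have tu : `|t - k%:R / n%:R| <= n%:R^-1.
  have e1 : k%:R / n%:R <= t by rewrite ler_pdivrMr.
  rewrite ger0_norm ?subr_ge0// lerBlDr -[X in X + _]mul1r -mulrDl ler_pdivlMr//.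
  by rewrite ltW// (lt_le_trans k2)// -natr1 addrC.
have := H (Ordinal kn); rewrite /= clamp01_id//; set u := k%:R / n%:R => Hu.
have -> : a j t - b t = (a j t - a j u) + (a j u - b u) + - (b t - b u).
  by rewrite [b u]surjective_pairing [b t]surjective_pairing; congr pair => /=; ring.
have h1 := norm2D ((a j t - a j u) + (a j u - b u)) (- (b t - b u)).
have h2 := norm2D (a j t - a j u) (a j u - b u).
have step c : 0 <= c <= M -> c * `|t - u| <= e / 3.
  by move=> /andP[c0 cM]; rewrite (le_trans _ Mn)// ler_pM.
have h3 := le_trans (aL j _ _ t01 u01) (step _ (LM j)).
have h4 := le_trans (bL _ _ t01 u01) (step _ L1M).
by move: h1 h2; rewrite norm2_opp; lra.
Qed.

End curve_compactness.

(** * Hausdorff convergence of surfaces of revolution *)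

Section revolution.
Variables (R : realType) (o : 'rV[R]_3) (E : 'M[R]_3).
Hypothesis hE : E *m E^T = 1%:M.
Implicit Types (a b : R -> R * R) (z w : R * R) (t e : R).

Lemma enorm_mulmx (v : 'rV[R]_3) : enorm (v *m E) = enorm v.
Proof.
have H (u : 'rV[R]_3) : enorm u = Num.sqrt ((u *m u^T) 0 0).
  by rewrite /enorm mxE; congr Num.sqrt; apply: eq_bigr => i _; rewrite mxE expr2.
by rewrite !H trmx_mul mulmxA -(mulmxA v) hE mulmx1.
Qed.

Lemma enorm_cyl z w t : enorm (cyl o E z t - cyl o E w t) = norm2 (z - w).
Proof.
rewrite /cyl opprD addrACA subrr add0r -mulmxBl enorm_mulmx /enorm /norm2.
congr Num.sqrt; rewrite !big_ord_recl big_ord0 !mxE/= addr0.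
rewrite addrA; congr (_ + _); rewrite -!mulrBl !exprMn -mulrDr cos2Dsin2 mulr1.
by [].
Qed.

Lemma hausdorff_revolve_ge0 a b : (0 <= hausdorff_dist (revolve o E a) (revolve o E b))%E.
Proof.
rewrite /hausdorff_dist le_max; apply/orP; left.
pose x := cyl o E (a 0) 0.
apply: (@le_trans _ _ (ereal_inf [set (enorm (x - y))%:E | y in revolve o E b])).
  by apply: le_ereal_inf_tmp => _ [y _ <-]; rewrite lee_fin sqrtr_ge0.
apply: ereal_sup_ubound; exists x => //; exists 0; last by exists 0.
by rewrite /= in_itv/= lexx ler01.
Qed.

(** Points with the same parameter and the same angle are paired; their distance is that of the
    meridians in the half-plane. *)
Lemma hausdorff_revolve_le a b e :
  (forall t, 0 <= t <= 1 -> norm2 (a t - b t) <= e) ->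
  (hausdorff_dist (revolve o E a) (revolve o E b) <= e%:E)%E.
Proof.
move=> ab; rewrite /hausdorff_dist ge_max; apply/andP; split;
  apply: ge_ereal_sup => _ [_ [t t01 [th _ <-]] <-].
  apply: (@le_trans _ _ (enorm (cyl o E (a t) th - cyl o E (b t) th))%:E).
    by apply: ereal_inf_lbound; eexists; last reflexivity; exists t => //; exists th.
  by rewrite lee_fin enorm_cyl; apply: ab; move: t01; rewrite /= in_itv.
apply: (@le_trans _ _ (enorm (cyl o E (b t) th - cyl o E (a t) th))%:E).
  by apply: ereal_inf_lbound; eexists; last reflexivity; exists t => //; exists th.
by rewrite lee_fin enorm_cyl -norm2_opp opprB; apply: ab; move: t01; rewrite /= in_itv.
Qed.

Notation mu := (@lebesgue_measure R).

(** Otherwise a subsequence stays away from the surface of [acat]. A cluster curve [b] of it has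
    positive distance to the axis and, by [minimizing_speed], is a meridian of minimal area;
    uniqueness identifies its surface with that of [acat], although some terms of the subsequence
    come close to it. *)
Lemma minimizing_sequence_hausdorff (p q : R * R) (A M eta : R) acat
    (a : nat -> R -> R * R) (L : nat -> R) :
  p <> q -> (forall b, meridian p q b -> A <= area b) ->
  (forall b, meridian p q b -> area b = A -> revolve o E b = revolve o E acat) ->
  0 < eta -> (forall j, meridian_of_speed p q (a j) (L j)) ->
  (forall j, L j <= M) -> (forall j t, 0 <= t <= 1 -> eta <= (a j t).1) ->
  (forall e, 0 < e -> exists J, forall j, (J <= j)%N -> area (a j) <= A + e) ->
  forall e, 0 < e -> exists J, forall j, (J <= j)%N ->
    (hausdorff_dist (revolve o E (a j)) (revolve o E acat) <= e%:E)%E.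
Proof.
move=> pq minA uniqA eta0 aL LM aeta aA e e0; apply: contrapT => H.
have {}H (J : nat) : exists j, (J <= j)%N /\
    ~ (hausdorff_dist (revolve o E (a j)) (revolve o E acat) <= e%:E)%E.
  apply: contrapT => H'; apply: H; exists J => j Jj; apply: contrapT => ja.
  by apply: H'; exists j.
have [s sP] := choice H.
have L0 j : 0 <= L j by have [_ ? _ _ _] := aL j.
have a0 j : a j 0 = p by have [_ _ _ [? _] _] := aL j.
have a1 j : a j 1 = q by have [_ _ _ [_ ?] _] := aL j.
pose M' := Num.max M (norm2 p).
have M'0 : 0 <= M' by rewrite le_max norm2_ge0 orbT.
have [|||b [L1 [/andP[L10 L1M] bL Hb]]] :=
    @curve_cluster R (fun k => a (s k)) (fun k => L (s k)) M'.
- by move=> j; rewrite L0 le_max LM.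
- by move=> j; rewrite a0 le_max lexx orbT.
- by move=> j; exact: meridian_of_speed_dist (aL _).
have small z w : (forall e', 0 < e' -> norm2 (z - w) <= e') -> z = w.
  move=> h; apply/eqP; rewrite -subr_eq0; apply/eqP/norm2_eq0/le_anti.
  rewrite norm2_ge0 andbT; apply/ler_addgt0Pr => e' e'0; rewrite add0r; exact: h.
have i0 : 0 <= (0 : R) <= 1 by rewrite lexx ler01.
have i1 : 0 <= (1 : R) <= 1 by rewrite lexx ler01.
have b0 : b 0 = p.
  apply/esym/small => e' e'0; have [j _ [_ /(_ 0 i0)]] := Hb e' 0%N e'0.
  by rewrite a0.
have b1 : b 1 = q.
  apply/esym/small => e' e'0; have [j _ [_ /(_ 1 i1)]] := Hb e' 0%N e'0.
  by rewrite a1.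
have bclose j t e' : 0 <= t <= 1 -> (forall t, 0 <= t <= 1 -> norm2 (a j t - b t) <= e') ->
    `|(a j t).1 - (b t).1| <= e'.
  by move=> t01 /(_ _ t01); apply: le_trans; exact: (norm2_abs1 (a j t - b t)).
have beta t : 0 <= t <= 1 -> eta <= (b t).1.
  move=> t01; apply/ler_addgt0Pr => e' e'0; have [j _ [_ h]] := Hb e' 0%N e'0.
  have := bclose _ _ _ t01 h; have := aeta (s j) t t01.
  by rewrite ler_norml => h1 /andP[_]; lra.
have bpos t : 0 <= t <= 1 -> 0 < (b t).1 by move=> /beta; exact: lt_le_trans.
have L11 : 0 < L1 + 1 by rewrite ltr_wpDl.
have blip : [lipschitz b t | t in `[0 : R, 1]].
  apply: (@lipschitz01I _ _ _ (L1 + 1)) => u t u01 t01.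
  rewrite (le_trans (norm_le_norm2 _))// (le_trans (bL _ _ u01 t01))//.
  by rewrite ler_wpM2r// lerDl.
have [g1 [g2 gb]] := curve_density_exists blip.
pose F t := (b (clamp01 t)).1.
have bF : bounded_measurable F.
  apply: (@bounded_measurable_clamp01 _ (fun t => (b t).1) _ L11) => u t u01 t01.
  rewrite (le_trans (norm2_abs1 (b u - b t)))// (le_trans (bL _ _ u01 t01))//.
  by rewrite ler_wpM2r// lerDl.
have pi2 : 0 < 2 * pi :> R by rewrite mulr_gt0 ?pi_gt0.
pose B := norm2 p + M'.
have B0 : 0 <= B by rewrite addr_ge0 ?norm2_ge0.
have bA : 2 * pi * (L1 * \int[mu]_(t in `[0, 1]) F t) <= A.
  apply/ler_addgt0Pr => d d0.
  (* One [d'] is lost in the area, [M' * d'] in replacing the radius of the approximating curve, and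
     [B * d'] in replacing its speed. *)
  pose C := 1 + 2 * pi * (M' + B).
  have C0 : 0 < C by rewrite ltr_pwDl// mulr_ge0 ?(ltW pi2)// addr_ge0.
  pose d' := d / C; have d'0 : 0 < d' by rewrite divr_gt0.
  have [J HJ] := aA d' d'0; have [k Jk [Lk ak]] := Hb d' J d'0.
  have /HJ := leq_trans Jk (sP k).1.
  have := aL (s k); set ak' := a (s k); set Lk' := L (s k) => ak'L.
  rewrite (area_axis_dist ak'L) => areak.
  have bk := bounded_measurable_axis_dist ak'L.
  set Ik := \int[mu]_(t in _) _ in areak; set I := \int[mu]_(t in _) _.
  have I1 : I <= Ik + d'.
    have -> : d' = \int[mu]_(t in `[0, 1]) (d' : R).
      by rewrite Rintegral_cst_itv// subr0 mulr1.
    rewrite -RintegralD_itv//; last exact: bounded_measurable_cst.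
    apply: le_Rintegral_itv => //.
      by apply: bounded_measurableD => //; exact: bounded_measurable_cst.
    move=> t _; have := bclose _ _ _ (clamp01_itv t) ak.
    by rewrite ler_norml /F /axis_dist => /andP[]; lra.
  have I2 : Ik <= B.
    have -> : B = \int[mu]_(t in `[0, 1]) (B : R).
      by rewrite Rintegral_cst_itv// subr0 mulr1.
    apply: le_Rintegral_itv => //; first exact: bounded_measurable_cst.
    move=> t _; have c01 := clamp01_itv t.
    have := meridian_of_speed_dist ak'L c01 i0; rewrite subr0 /ak' a0.
    have h1 : Lk' * `|clamp01 t| <= M'.
      rewrite (@le_trans _ _ Lk')//; last by rewrite le_max LM.
      by case/andP: c01 => c0 c1; rewrite ger0_norm// ler_piMr ?L0.
    have h2 := norm2_abs1 (a (s k) (clamp01 t) - p).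
    have h3 := norm2_abs1 p; move: h2 h3; rewrite !ler_norml /= /axis_dist -/ak'.
    by move=> /andP[_ h2] /andP[_ h3]; rewrite /B; lra.
  have Ik0 : 0 <= Ik by apply: Rintegral_itv_ge0 => t _; rewrite ltW// (axis_dist_gt0 ak'L).
  have h1 : L1 * I <= L1 * Ik + M' * d'.
    have h2 : L1 * I <= L1 * (Ik + d') by rewrite ler_wpM2l.
    have h3 : L1 * d' <= M' * d' by rewrite ler_pM2r.
    by clear - h2 h3; lra.
  have h2 : L1 * Ik <= Lk' * Ik + d' * B.
    have h3 : (L1 - Lk') * Ik <= d' * B.
      rewrite (le_trans (ler_norm _))// normrM (ger0_norm Ik0) ler_pM// distrC//.
    lra.
  have h3 : 2 * pi * (L1 * I) <= 2 * pi * (Lk' * Ik + d' * B + M' * d').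
    by rewrite ler_pM2l//; lra.
  have dC : d = d' * C by rewrite /d' divfK ?gt_eqF.
  rewrite dC /C; move: h3 areak; move: (pi : R) => pp; lra.
have [bM bArea] := minimizing_speed pq minA L10 bL bpos b0 b1 gb bA.
have bS : revolve o E b = revolve o E acat.
  by apply: uniqA => //; apply/meridianP; exists L1.
have [k _ [_ ak]] := Hb e 0%N e0.
by apply: (sP k).2; rewrite -bS; exact: hausdorff_revolve_le.
Qed.

End revolution.

(** * Comparison of areas *)

Section good_pieces.
Variable R : realType.
Notation mu := (@lebesgue_measure R).
Variables (p q : R * R) (a : R -> R * R) (L : R) (N : nat) (eps eta : R).
Hypotheses (aL : meridian_of_speed p q a L) (N0 : (0 < N)%N).
Hypotheses (eps01 : 0 < eps <= 1) (eta0 : 0 < eta).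
Let l := L / N%:R.
Hypothesis l_le : 2 * l <= eps * eta.
Let F i := axis_dist a (N%:R^-1 * i%:R).
Let m i := F i - l.
Let S := \sum_(i < N | eta <= m i) l * m i.

Let NR : 0 < N%:R :> R. Proof. by rewrite ltr0n. Qed.
Let l0 : 0 <= l. Proof. by have [_ L0 _ _ _] := aL; rewrite divr_ge0. Qed.

Let F_near i t : i%:R <= N%:R * t <= i.+1%:R -> `|axis_dist a t - F i| <= l.
Proof.
have [_ L0 _ _ _] := aL.
move=> /andP[it ti]; rewrite (le_trans (axis_dist_lipschitz aL _ _))// /l ler_wpM2l//.
have h : N%:R^-1 * i%:R <= t by rewrite ler_pdivrMl.
rewrite ger0_norm ?subr_ge0// lerBlDr.
by rewrite -[X in X + _]mulr1 -mulrDr ler_pdivlMl// addrC natr1.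
Qed.

Let FS i : `|F i.+1 - F i| <= l.
Proof. by apply: F_near; rewrite mulVKf ?gt_eqF// ler_nat leqnSn lexx. Qed.

Let eta' := eta + 2 * l.
(* Truncated at [eta'], half the squared distance to the axis is constant along
   the bad pieces and varies by about [l * m i] along a good one. *)
Let psi i : R := Num.max (F i) eta' ^+ 2 / 2.

Let psi_step i : `|psi i.+1 - psi i| <= if eta <= m i then (1 + eps) * (l * m i) else 0.
Proof.
have := FS i; rewrite ler_norml => /andP[h1 h2].
have F0 k : 0 < F k by exact: axis_dist_gt0 aL _.
have eta'0 : 0 < eta' by rewrite /eta' ltr_pwDl// mulr_ge0.
set u := Num.max (F i) eta'; set v := Num.max (F i.+1) eta'.
rewrite /psi -/u -/v -mulrBl subr_sqr.
case: ifPn => [good|]; last first.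
  rewrite -ltNge /m => bad.
  have -> : u = eta' by rewrite /u max_r// /eta'; lra.
  have -> : v = eta' by rewrite /v max_r// /eta'; lra.
  by rewrite subrr mul0r mul0r normr0.
have uv : `|v - u| <= l.
  rewrite /u /v ler_norml /Num.max; case: ltP => x1; case: ltP => x2; apply/andP; split; lra.
have um : u <= m i + 2 * l by rewrite /u ge_max /eta' /m; apply/andP; split; move: good; rewrite /m; lra.
have vm : v <= m i + 2 * l by rewrite /v ge_max /eta' /m; apply/andP; split; move: good; rewrite /m; lra.
have u0 : 0 < u by rewrite lt_max F0.
have v0 : 0 < v by rewrite lt_max F0.
have h3 : (v + u) / 2 <= (1 + eps) * m i.
  have : 2 * l <= eps * m i by rewrite (le_trans l_le)// ler_pM2l//; case/andP: eps01.
  lra.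
rewrite -mulrA normrM mulrCA ler_pM//.
by rewrite ger0_norm// divr_ge0// addr_ge0// ltW.
Qed.

(** Each of the differences [psi 0 - psi i0] and [psi N - psi i0] is at most the variation of [psi]
    on its side of [i0], and the total variation is controlled by the good pieces. *)
Let psi_sum i0 : (i0 <= N)%N -> psi 0 + psi N - 2 * psi i0 <= (1 + eps) * S.
Proof.
pose D k := \sum_(i < k) `|psi i.+1 - psi i|.
have DP i j : (i <= j)%N -> `|psi j - psi i| <= D j - D i.
  elim: j => [|j IHj]; first by rewrite leqn0 => /eqP ->; rewrite !subrr normr0.
  rewrite leq_eqVlt => /predU1P[->|/IHj ij]; first by rewrite !subrr normr0.
  rewrite /D big_ord_recr/= -/(D j) -/(D i).
  have -> : psi j.+1 - psi i = (psi j.+1 - psi j) + (psi j - psi i) by ring.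
  by have := ler_normD (psi j.+1 - psi j) (psi j - psi i); lra.
move=> iN; apply: (@le_trans _ _ (D N)).
  have := DP 0%N i0 (leq0n _); have := DP i0 N iN.
  by rewrite [D 0%N]big_ord0 !ler_norml => /andP[_ h1] /andP[h2 _]; lra.
rewrite mulr_sumr big_mkcond; apply: ler_sum => i _; exact: psi_step.
Qed.

(** At a bad piece [2 * psi i] is [eta' ^+ 2], at most [4 * eta ^+ 2] because [eta' <= 2 * eta],
    whereas [psi] is at least [p.1 ^+ 2 / 2] and [q.1 ^+ 2 / 2] at the ends; this contradicts the
    bound on [K]. So all pieces are good, and [S] bounds the whole area integral up to the factor
    [1 + eps]. *)
Lemma good_pieces_cover (K : R) : (1 + eps) * S <= K ->
  K < (p.1 ^+ 2 + q.1 ^+ 2) / 2 - 4 * eta ^+ 2 ->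
  (forall t, 0 <= t <= 1 -> eta <= (a t).1) /\
  L * \int[mu]_(t in `[0, 1]) axis_dist a t <= K.
Proof.
move=> SK Kpq; have [_ L0 _ [a0 a1] _] := aL; have [eps0 eps1] := andP eps01.
have good i : (i < N)%N -> eta <= m i.
  move=> iN; rewrite leNgt; apply/negP => bad.
  have := le_trans (psi_sum (ltnW iN)) SK.
  have psi0 : p.1 ^+ 2 / 2 <= psi 0.
    have -> : p.1 = F 0%N by rewrite /F mulr0 /axis_dist clamp01_id ?lexx ?ler01// a0.
    rewrite ler_pM2r// lerXn2r ?nnegrE ?le_max ?lexx// ltW//; exact: axis_dist_gt0 aL _.
  have psiN : q.1 ^+ 2 / 2 <= psi N.
    have -> : q.1 = F N by rewrite /F mulVf ?gt_eqF// /axis_dist clamp01_id ?lexx ?ler01// a1.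
    rewrite ler_pM2r// lerXn2r ?nnegrE ?le_max ?lexx// ltW//; exact: axis_dist_gt0 aL _.
  have psii : psi i = eta' ^+ 2 / 2.
    by rewrite /psi max_r// /eta'; move: bad l0; rewrite /m; lra.
  have e2 : eta' <= 2 * eta.
    by rewrite /eta'; have : eps * eta <= 1 * eta; [rewrite ler_pM2r|move: l_le; lra].
  have e3 : eta' ^+ 2 <= (2 * eta) ^+ 2.
    rewrite lerXn2r ?nnegrE ?mulr_ge0 ?(ltW eta0)// /eta'.
    by rewrite addr_ge0 ?(ltW eta0)// mulr_ge0.
  by rewrite psii; move: Kpq e3; rewrite exprMn; lra.
have piece (t : R) : 0 <= t <= 1 -> exists2 i, (i < N)%N & i%:R <= N%:R * t <= i.+1%:R.
  move=> /andP[t0 t1]; have Nt0 : 0 <= N%:R * t by rewrite mulr_ge0.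
  have [k1 k2] : (Num.truncn (N%:R * t))%:R <= N%:R * t /\ N%:R * t < (Num.truncn (N%:R * t)).+1%:R.
    by split; [rewrite truncn_le|exact: truncnS_gt].
  have [kN|kN] := ltnP (Num.truncn (N%:R * t)) N.
    by exists (Num.truncn (N%:R * t)); rewrite // k1 ltW.
  exists N.-1; first by rewrite prednK.
  have NtN : N%:R * t <= N%:R by rewrite ler_piMr.
  by rewrite prednK// NtN andbT (le_trans _ k1)// ler_nat (leq_trans (leq_pred _)).
split.
  move=> t t01; have [i iN it] := piece t t01; have := F_near it.
  rewrite /axis_dist clamp01_id// ler_norml => /andP[h _].
  by have := good i iN; rewrite /m; lra.
apply: le_trans SK; have bF := bounded_measurable_axis_dist aL.
have xS i : N%:R^-1 * i%:R <= N%:R^-1 * i.+1%:R :> R by rewrite ler_pM2l ?invr_gt0// ler_nat.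
have := Rintegral_sum_itv N bF xS; rewrite mulr0 mulVf ?gt_eqF// => ->.
rewrite /S !mulr_sumr [leRHS]big_mkcond; apply: ler_sum => i _; rewrite good//.
have iN : N%:R^-1 * i.+1%:R - N%:R^-1 * i%:R = N%:R^-1 :> R by rewrite -natr1; ring.
apply: (@le_trans _ _ (L * ((m i + 2 * l) * N%:R^-1))).
  rewrite ler_wpM2l//; apply: (@le_trans _ _
    (\int[mu]_(t in `[N%:R^-1 * i%:R, N%:R^-1 * i.+1%:R]) (m i + 2 * l))); last first.
    by rewrite Rintegral_cst_itv// iN.
  apply: le_Rintegral_itv => //; first exact: bounded_measurable_cst.
  move=> t /andP[it ti]; have : `|axis_dist a t - F i| <= l.
    by apply: F_near; rewrite -ler_pdivrMl// it -ler_pdivlMl.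
  by rewrite ler_norml /m => /andP[_]; lra.
have -> : L * ((m i + 2 * l) * N%:R^-1) = l * (m i + 2 * l) by rewrite /l; ring.
rewrite [leRHS]mulrCA ler_wpM2l//.
have : 2 * l <= eps * m i by rewrite (le_trans l_le)// ler_pM2l// good.
lra.
Qed.

End good_pieces.

(** * Comparison with the catenoid and with the discs *)

Section comparison.
Variable R : realType.
Notation mu := (@lebesgue_measure R).
Implicit Types (p q : R * R) (a : R -> R * R) (L K eta : R) (j : nat).

Lemma near_nat_ge (C x : R) : 0 < C -> exists J : nat, forall j, (J <= j)%N ->
  x <= j%:R / C /\ (0 < j)%N.
Proof.
move=> C0; exists (Num.truncn `|x * C|).+1 => j Jj; split; last exact: leq_trans Jj.
rewrite ler_pdivlMr// (le_trans (ler_norm _))// ltW//.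
by rewrite (lt_le_trans (truncnS_gt _))// ler_nat.
Qed.

Lemma Rintegral_axis_dist_gt0 p q a L : meridian_of_speed p q a L ->
  0 < \int[mu]_(t in `[0, 1]) axis_dist a t.
Proof.
move=> aL; apply: (@Rintegral_itv_gt0 R _ 0 1 (2^-1)).
- exact: bounded_measurable_axis_dist aL.
- exact: axis_dist_continuous aL.
- by move=> t; rewrite ltW// (axis_dist_gt0 aL).
- by apply/andP; split; lra.
- exact: axis_dist_gt0 aL _.
Qed.

(** For [lam = j / C] the Weyl lower bound gives the catenoid a [j]-th eigenvalue at least [lam]. If
    the good pieces of [a] carried too much area, the uniform upper bound at the smaller level
    [lam'] would push the [j]-th eigenvalue of [a] below [lam]. *)
Lemma lambda_ge_length p q acat Lc K eta : p <> q ->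
  meridian_of_speed p q acat Lc -> 0 < Lc -> 0 < eta -> eta <= norm2 (p - q) ->
  let A := Lc * \int[mu]_(t in `[0, 1]) axis_dist acat t in
  A < K -> K < (p.1 ^+ 2 + q.1 ^+ 2) / 2 - 4 * eta ^+ 2 ->
  exists J, forall j, (J <= j)%N -> forall a L, meridian_of_speed p q a L ->
    (lambda acat j <= lambda a j)%E ->
    (forall t, 0 <= t <= 1 -> eta <= (a t).1) /\
    L * \int[mu]_(t in `[0, 1]) axis_dist a t <= K.
Proof.
move=> pq catL Lc0 eta0 etapq A AK Kpq.
have A0 : 0 < A := mulr_gt0 Lc0 (Rintegral_axis_dist_gt0 catL).
(* The solution of [A * (1 + 15 * eps) = (1 - eps) * K]. Four factors [1 + eps] accumulate below,
   and their product is at most [1 + 15 * eps]. *)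
pose eps := (K - A) / (15 * A + K).
have K0 : 0 < K by rewrite (lt_trans A0).
have den0 : 0 < 15 * A + K by lra.
have eps0 : 0 < eps by rewrite divr_gt0// subr_gt0.
have eps1 : eps < 1 by rewrite ltr_pdivrMr//; lra.
have epsK : A * (1 + 15 * eps) <= (1 - eps) * K.
  have : eps * (15 * A + K) = K - A by rewrite divfK ?gt_eqF.
  by lra.
have W0 := weyl_density_gt0 R.
have [lamA lamA0 HA] := weyl_curve_lower catL Lc0 eps0.
have [|lamB lamB0 HB] := @weyl_curve_upper R eps eta _ eta0; first by rewrite eps0.
have e1 : 0 < 1 + eps by lra.
pose C := (1 + eps) * weyl_density R * A.
have C0 : 0 < C := mulr_gt0 (mulr_gt0 e1 W0) A0.
have [J1 HJ1] := near_nat_ge lamA C0.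
have [J2 HJ2] := near_nat_ge (lamB * (1 + eps)) C0.
exists (maxn J1 J2) => j; rewrite geq_max => /andP[/HJ1[lj j0] /HJ2[lj2 _]] a L aL lam_le.
have jR : 0 < j%:R :> R by rewrite ltr0n.
set lam := j%:R / C in lj lj2.
have lam0 : 0 < lam by rewrite divr_gt0.
have catj : (lam%:E <= lambda acat j)%E.
  apply: HA => //; rewrite -/A.
  by rewrite mulrAC -/C mulrC /lam divfK ?gt_eqF.
pose lam' := lam / (1 + eps).
have lam'B : lamB <= lam' by rewrite ler_pdivlMr.
have lam'lt : lam' < lam by rewrite ltr_pdivrMr// ltr_pMr// ltrDl.
have [_ L0 _ [a0 a1] _] := aL.
have Lpq : norm2 (p - q) <= L.
  have := meridian_of_speed_dist aL (s := 0) (t := 1).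
  by rewrite a0 a1 sub0r normrN1 mulr1; apply; rewrite lexx ler01.
have Lgt0 : 0 < L by rewrite (lt_le_trans _ (le_trans etapq Lpq)).
have ee0 : 0 < eps * eta by rewrite mulr_gt0.
(* Rounding [x] down to [N] puts [L / N] between [eps * eta / 4] and [eps * eta / 2]. The upper
   bound uses [x >= 4], which comes from [eta <= norm2 (p - q) <= L]. *)
pose x := 4 * L / (eps * eta).
have x4 : 4 <= x.
  rewrite ler_pdivlMr// ler_pM2l// (le_trans _ (le_trans etapq Lpq))//.
  by rewrite ler_piMl ?ltW.
pose N := Num.truncn x.
have [N1 N2] : N%:R <= x /\ x < N%:R + 1.
  by rewrite natr1 truncn_le ?truncnS_gt//; split => //; rewrite (le_trans _ x4).
have N0 : (0 < N)%N by rewrite -(ltr0n R); clear - x4 N2; lra.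
have NR : 0 < N%:R :> R by rewrite ltr0n.
have xE : x * (eps * eta) = 4 * L by rewrite divfK ?gt_eqF.
have LN1 : eps * eta / 4 <= L / N%:R.
  rewrite ler_pdivlMr// mulrAC ler_pdivrMr// [leRHS]mulrC -xE mulrC.
  by rewrite ler_pM2r.
have LN2 : 2 * (L / N%:R) <= eps * eta.
  rewrite mulrA ler_pdivrMr//.
  have : x * (eps * eta) <= 2 * N%:R * (eps * eta) by rewrite ler_pM2r//; clear - x4 N2; lra.
  by rewrite xE; clear; lra.
have Sle : (1 + eps) * \sum_(i < N | eta <= axis_dist a (N%:R^-1 * i%:R) - L / N%:R)
    (L / N%:R * (axis_dist a (N%:R^-1 * i%:R) - L / N%:R)) <= K.
  set S := \sum_(i < N | _) _.
  have : ~~ (j%:R <= (1 - eps) * weyl_density R * (lam' / (1 + eps)) * S).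
    apply/negP => jS; have := HB lam' p q a L N j lam'B aL Lgt0 N0 LN2 LN1 jS.
    by move=> /(le_trans (le_trans catj lam_le)); rewrite lee_fin leNgt lam'lt.
  have SE : (1 - eps) * weyl_density R * (lam' / (1 + eps)) * S =
      j%:R * ((1 - eps) * S / ((1 + eps) ^+ 3 * A)).
    have alg (T c1 c2 jj B W : R) : 0 < B -> 0 < W -> 0 < c2 ->
        c1 * W * (jj / (c2 * W * B) / c2 / c2) * T = jj * (c1 * T / (c2 ^+ 3 * B)).
      by move=> ? ? ?; field; rewrite !gt_eqF.
    exact: alg.
  rewrite -ltNge SE.
  have e3A : 0 < (1 + eps) ^+ 3 * A := mulr_gt0 (exprn_gt0 3 e1) A0.
  rewrite (gtr_pMr _ jR) (ltr_pdivrMr _ _ e3A) mul1r => SA.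
  have e2 : 0 < 1 - eps by rewrite subr_gt0.
  rewrite -(ler_pM2l e2) (le_trans _ epsK)//.
  have h1 : (1 + eps) * ((1 - eps) * S) <= (1 + eps) * ((1 + eps) ^+ 3 * A).
    by rewrite ler_pM2l// ltW.
  have h2 : (1 + eps) ^+ 4 <= 1 + 15 * eps.
    have q1 : eps ^+ 2 <= eps by rewrite expr2 ler_piMl// ltW.
    have q2 : eps ^+ 3 <= eps by rewrite exprS ler_piMr ?(ltW eps0)// exprn_ile1 ?ltW.
    have q3 : eps ^+ 4 <= eps by rewrite exprS ler_piMr ?(ltW eps0)// exprn_ile1 ?ltW.
    rewrite (_ : (1 + eps) ^+ 4 = 1 + 4 * eps + 6 * eps ^+ 2 + 4 * eps ^+ 3 + eps ^+ 4); last by ring.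
    by clear - q1 q2 q3; lra.
  have h3 : A * (1 + eps) ^+ 4 <= A * (1 + 15 * eps) by rewrite ler_pM2l.
  have e4 : (1 + eps) * ((1 + eps) ^+ 3 * A) = A * (1 + eps) ^+ 4 by ring.
  by rewrite mulrCA (le_trans h1)// e4.
have eps01 : 0 < eps <= 1 by rewrite eps0 ltW.
exact: (good_pieces_cover aL N0 eps01 eta0 LN2 Sle Kpq).
Qed.

(** The [j]-th eigenvalue is at most [j / C2] for the discs and at least [j / C1] for the catenoid,
    and [C1 < C2] since the catenoid has less area. *)
Lemma weyl_gap p q acat Lc : 0 < p.1 -> 0 < q.1 ->
  meridian_of_speed p q acat Lc -> 0 < Lc ->
  let A := Lc * \int[mu]_(t in `[0, 1]) axis_dist acat t in
  0 < A -> A < (p.1 ^+ 2 + q.1 ^+ 2) / 2 ->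
  exists J, forall j, (J <= j)%N -> (lambda_discs p.1 q.1 j < lambda acat j)%E.
Proof.
move=> p0 q0 catL Lc0 A A0; set D := (_ / 2) => AD.
have D0 : 0 < D by rewrite (lt_trans A0).
(* Half of the value for which [(1 + eps) * A] and [(1 - eps) * D] coincide. *)
pose eps := (D - A) / (2 * (A + D)).
have AD0 : 0 < 2 * (A + D) by rewrite mulr_gt0// addr_gt0.
have eps0 : 0 < eps by rewrite divr_gt0// subr_gt0.
have eps1 : eps < 1 by rewrite ltr_pdivrMr//; lra.
have epsE : (1 + eps) * A < (1 - eps) * D.
  have : eps * (2 * (A + D)) = D - A by rewrite divfK ?gt_eqF.
  by lra.
have W0 := weyl_density_gt0 R.
have [lamA lamA0 HA] := weyl_curve_lower catL Lc0 eps0.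
pose r (b : bool) := if b then p.1 else q.1.
have r0 b : 0 < r b by case: b.
have [|lamB lamB0 HB] := weyl_discs_upper r0 (del := eps); first by rewrite eps0.
have e1 : 0 < 1 + eps by lra.
have e2 : 0 < 1 - eps by lra.
pose C1 := (1 + eps) * weyl_density R * A.
pose C2 := (1 - eps) * weyl_density R * D.
have C10 : 0 < C1 := mulr_gt0 (mulr_gt0 e1 W0) A0.
have C20 : 0 < C2 := mulr_gt0 (mulr_gt0 e2 W0) D0.
have C12 : C1 < C2.
  rewrite /C1 /C2 mulrAC [ltRHS]mulrAC ltr_pM2r//.
have [J1 HJ1] := near_nat_ge lamA C10.
have [J2 HJ2] := near_nat_ge lamB C20.
exists (maxn J1 J2) => j; rewrite geq_max => /andP[/HJ1[lj j0] /HJ2[lj2 _]].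
have jR : 0 < j%:R :> R by rewrite ltr0n.
apply: (@le_lt_trans _ _ (j%:R / C2)%:E).
  apply: HB => //; rewrite -/D.
  by rewrite mulrAC -/C2 mulrC divfK ?gt_eqF.
apply: (@lt_le_trans _ _ (j%:R / C1)%:E).
  by rewrite lte_fin ltr_pM2l// ltf_pV2.
apply: HA => //; rewrite -/A.
by rewrite mulrAC -/C1 mulrC divfK ?gt_eqF.
Qed.

End comparison.

(** Used to tell the catenoid from the discs: the latter meet the axis. The orthogonality of [E]
    reduces the claim to coordinates. *)
Lemma cyl_axis (R : realType) (o : 'rV[R]_3) (E : 'M[R]_3) (z : R * R) (y s t : R) :
  E *m E^T = 1%:M -> cyl o E z s = cyl o E (0, y) t -> z.1 = 0.
Proof.
move=> hE /addrI /(congr1 (mulmx^~ E^T)); rewrite -!mulmxA hE !mulmx1 => /rowP e.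
have := e (inord 0); have := e (inord 1); rewrite !mxE !inordK//= !mul0r => h1 h2.
have : z.1 ^+ 2 = 0.
  by rewrite -[LHS]mulr1 -(cos2Dsin2 s) mulrDr -!exprMn h1 h2 expr0n addr0.
by move/eqP; rewrite sqrf_eq0 => /eqP.
Qed.

Theorem theorem1p2 (R : realType) (o : 'rV[R]_3) (E : 'M[R]_3)
    (hE : E *m E^T = 1%:M)
    (p q : R * R) (hp : 0 < p.1) (hq : 0 < q.1) (hpq : p <> q)
    (acat : R -> R * R) (hcat : catenoid p q acat)
    (P : set (surface R)) (hP : plateau_class o E p q P)
    (hmin : unique_area_minimizer P (surface_of o E acat)) :
  (\forall j \near \oo, (lambda_discs p.1 q.1 j < Lambda p q j)%E) /\
  (forall a : nat -> (R -> R * R),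
    (forall j : nat, (0 < j)%N ->
       (lambda_discs p.1 q.1 j < Lambda p q j)%E ->
       meridian p q (a j) /\ lambda (a j) j = Lambda p q j) ->
    (area (a j) @[j --> \oo] --> area acat) /\
    (hausdorff_dist (revolve o E (a j)) (revolve o E acat) @[j --> \oo]
       --> 0%E)).
Proof.
have [catm _ _] := hcat; have [Pcat Pmin Puniq] := hmin; have [Psurf Pdiscs] := hP.
have /meridianP[Lc catL] := catm.
have minA b : meridian p q b -> area acat <= area b.
  by move=> /Psurf/Pmin; rewrite lee_fin.
have uniqA b : meridian p q b -> area b = area acat -> revolve o E b = revolve o E acat.
  move=> /Psurf/Puniq H bA.
  exact: (congr1 (@Defs.support R) (H (congr1 EFin bA))).
have speed_ge b L : meridian_of_speed p q b L -> norm2 (p - q) <= L.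
  move=> bL; have [_ _ _ [b0 b1] _] := bL.
  have := meridian_of_speed_dist bL (s := 0) (t := 1).
  by rewrite b0 b1 sub0r normrN1 mulr1; apply; rewrite lexx ler01.
have pq0 : 0 < norm2 (p - q).
  rewrite lt_neqAle norm2_ge0 andbT eq_sym; apply/eqP => /norm2_eq0/eqP.
  by rewrite subr_eq0 => /eqP.
have Lc0 : 0 < Lc := lt_le_trans pq0 (speed_ge _ _ catL).
have pi2 : 0 < 2 * pi :> R by rewrite mulr_gt0 ?pi_gt0.
have areaE := area_axis_dist catL.
set A := Lc * _ in areaE; pose D := (p.1 ^+ 2 + q.1 ^+ 2) / 2.
have A0 : 0 < A := mulr_gt0 Lc0 (Rintegral_axis_dist_gt0 catL).
have discE : pi * p.1 ^+ 2 + pi * q.1 ^+ 2 = 2 * pi * D.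
  by rewrite /D; move: (pi : R) => pp; field.
have AD : A < D.
  rewrite -(ltr_pM2l pi2) -areaE -discE lt_neqAle.
  have := Pmin _ Pdiscs; rewrite lee_fin => ->; rewrite andbT; apply/eqP => AE.
  (* Equal areas would by uniqueness give equal supports, but the centre of a disc lies on the axis,
     which the catenoid avoids. *)
  have := congr1 (fun S => Defs.support S) (Puniq _ Pdiscs (congr1 EFin (esym AE))); rewrite /=.
  have : (disc o E p `|` disc o E q) (cyl o E (0, p.2) 0).
    by left; exists 0; [rewrite /= in_itv/= lexx ltW|exists 0].
  move=> /[swap] -> [t t01 [s _ /(cyl_axis hE)]].
  have [_ _ apos _ _] := catL; have := apos t; rewrite /= in_itv/= in t01.
  by move=> /(_ t01) /[swap] ->; rewrite ltxx.
have [J0 HJ0] := weyl_gap hp hq catL Lc0 A0 AD.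
have gap j : (J0 <= j)%N -> (lambda_discs p.1 q.1 j < Lambda p q j)%E.
  move=> /HJ0 /lt_le_trans; apply; apply: ereal_sup_ubound; exact: imageP.
split; first by exists J0.
move=> a Ha.
pose g := D - A; have g0 : 0 < g by rewrite subr_gt0.
(* From [eta <= 1] and [eta <= g / 8] follows [4 * eta ^+ 2 <= g / 2], which together with
   [K <= A + g / 4] leaves [K < D - 4 * eta ^+ 2]. *)
pose eta := Num.min (norm2 (p - q)) (Num.min 1 (g / 8)).
have eta0 : 0 < eta by rewrite !lt_min pq0 ltr01 divr_gt0.
have [etapq eta1 etag] : [/\ eta <= norm2 (p - q), eta <= 1 & eta <= g / 8].
  by rewrite /eta; split; rewrite !ge_min lexx ?orbT.
have key e : 0 < e -> exists J, forall j, (J <= j)%N -> meridian p q (a j) /\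
    forall L, meridian_of_speed p q (a j) L ->
      (forall t, 0 <= t <= 1 -> eta <= (a j t).1) /\
      L * \int[@lebesgue_measure R]_(t in `[0, 1]) axis_dist (a j) t <= A + e.
  move=> e0; pose K := A + Num.min e (g / 4).
  have AK : A < K by rewrite ltrDl lt_min e0 divr_gt0.
  have KD : K < D - 4 * eta ^+ 2.
    have : Num.min e (g / 4) <= g / 4 by rewrite ge_min lexx orbT.
    have : eta ^+ 2 <= eta by rewrite expr2 ler_piMl// ltW.
    by rewrite /K /g; move: etag; rewrite /g; lra.
  have [J HJ] := lambda_ge_length hpq catL Lc0 eta0 etapq AK KD.
  exists (maxn 1 (maxn J0 J)) => j; rewrite !geq_max => /and3P[j0 jJ0 jJ].
  have [am aE] := Ha j j0 (gap j jJ0); split => // L aL.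
  (* Maximality of [a j] enters here: its eigenvalue is [Lambda], which dominates that of the
     catenoid. *)
  have [|aeta aK] := HJ j jJ _ _ aL.
    by rewrite aE; apply: ereal_sup_ubound; exact: imageP.
  by split => //; rewrite (le_trans aK)// lerD2l ge_min lexx.
have area_le e : 0 < e -> exists J, forall j, (J <= j)%N ->
    area acat <= area (a j) <= area acat + e.
  move=> e0; have [|J HJ] := key (e / (2 * pi)); first by rewrite divr_gt0.
  exists J => j /HJ[am aP]; apply/andP; split; first exact: minA.
  have /meridianP[L aL] := am; have [_ aK] := aP L aL.
  rewrite (area_axis_dist aL) areaE.
  have -> : 2 * pi * A + e = 2 * pi * (A + e / (2 * pi)).
    by rewrite [RHS]mulrDr [X in _ = _ + X]mulrC divfK ?gt_eqF.
  by rewrite ler_pM2l.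
split.
  apply/cvgrPdist_le => e e0; have [J HJ] := area_le e e0.
  exists J => // j /= /HJ /andP[h1 h2].
  by rewrite distrC ger0_norm ?subr_ge0// lerBlDl.
(* From [J1] on the meridians keep distance [eta] from the axis; the sequence is shifted by [J1] so
   that this holds for all its terms. *)
have [J1 HJ1] := key 1 ltr01.
have /choice[L aL] : forall k, exists L, meridian_of_speed p q (a (k + J1)%N) L.
  by move=> k; apply/meridianP; exact: (HJ1 _ (leq_addl _ _)).1.
have aeta k t : 0 <= t <= 1 -> eta <= (a (k + J1)%N t).1.
  exact: ((HJ1 _ (leq_addl _ _)).2 _ (aL k)).1.
(* A bounded area at distance at least [eta] from the axis bounds the length, which is the speed. *)
have LM k : L k <= (A + 1) / eta.
  rewrite ler_pdivlMr//; have [_ +] := (HJ1 _ (leq_addl k _)).2 _ (aL k).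
  apply: le_trans; have [_ L0 _ _ _] := aL k; rewrite ler_wpM2l//.
  rewrite -[leLHS]mulr1 -[X in _ * X]subr0 -Rintegral_cst_itv//.
  apply: le_Rintegral_itv.
  - exact: bounded_measurable_cst.
  - exact: bounded_measurable_axis_dist (aL k).
  - by move=> t _; apply: aeta; exact: clamp01_itv.
have area_le' e : 0 < e -> exists J, forall k, (J <= k)%N -> area (a (k + J1)%N) <= area acat + e.
  move=> /area_le[J HJ]; exists J => k Jk.
  by have /andP[] := HJ (k + J1)%N (leq_trans Jk (leq_addr _ _)).
have := minimizing_sequence_hausdorff hE hpq minA uniqA eta0 aL LM aeta area_le'.
move=> Hh.
have Hh' e : 0 < e -> exists J, forall j, (J <= j)%N ->
    (hausdorff_dist (revolve o E (a j)) (revolve o E acat) <= e%:E)%E.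
  move=> /Hh[J HJ]; exists (J + J1)%N => j Jj.
  have J1j : (J1 <= j)%N := leq_trans (leq_addl J J1) Jj.
  have Jj' : (J <= j - J1)%N by rewrite leq_subRL// addnC.
  by have := HJ _ Jj'; rewrite subnK.
have ge0 j := hausdorff_revolve_ge0 o E (a j) acat.
apply/fine_cvgP; split.
  have [J HJ] := Hh' 1 ltr01; exists J => // j /= /HJ h.
  by rewrite ge0_fin_numE// (le_lt_trans h)// ltry.
apply/cvgrPdist_le => e e0; have [J HJ] := Hh' e e0.
exists J => // j /= /HJ h; rewrite sub0r normrN ger0_norm ?fine_ge0//.
by rewrite -lee_fin fineK// ge0_fin_numE// (le_lt_trans h)// ltry.
Qed.
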